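(* Let $d\in\{2,3\}$ and $k>0$, let $D\subset\mathbb{R}^d$ be bounded and open, let the nonlinear contrast $q$ satisfy the assumptions listed in the context, and let $\delta>0$ be admissible. Let $g\in\mathcal{D}(F):=\{\psi\in L^2(S^{d-1}):\|\psi\|_{L^2(S^{d-1})}\le\delta/\omega_{d-1}^{1/2}\}$. Then the far field pattern $F(g):=(V(Hg))^\infty$ of the unique small radiating solution $V(f)$ of \[ \Delta v+k^2v=-k^2q(\cdot,|v+f|)(v+f)\quad\text{in }\mathbb{R}^d,\qquad f=Hg, \] satisfies \[ F(g)=H^*T(Hg), \] where $T:\mathcal{D}(T)\subseteq L^2(D)\to L^2(D)$ with $\mathcal{D}(T):=\overline{H(\mathcal{D}(F))}$ is defined by \[ T(f)(x)=k^2q\bigl(x,|V(f)(x)+f(x)|\bigr)\,(V(f)(x)+f(x)),\qquad x\in D. \]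
   Context: Assumptions on $q$. The contrast $q\in L^\infty(\mathbb{R}^d\times\mathbb{R})$ is real-valued and satisfies: (1) $\operatorname{supp}(q)\subseteq\overline D\times\mathbb{R}$; (2) $q(x,0)=0$ for a.e. $x\in\mathbb{R}^d$; (3) there are $q_0\in L^\infty(\mathbb{R}^d)$ with $\operatorname{ess\,inf}q_0>-1$ and $\operatorname{supp}(q_0)\subseteq\overline D$, a parameter $\alpha>0$ and a constant $C_q>0$ such that for any $z_1,z_2\in\mathbb{C}$ with $|z_1|,|z_2|\le1$, $\|q(\cdot,|z_1|)z_1-q(\cdot,|z_2|)z_2-q_0(z_1-z_2)\|_{L^\infty(\mathbb{R}^d)}\le C_q(|z_1|^\alpha+|z_2|^\alpha)|z_1-z_2|$. Notation. $\Phi_k(x)=\frac{\mathrm{i}}{4}H_0^{(1)}(k|x|)$ if $d=2$, $\Phi_k(x)=e^{\mathrm{i}k|x|}/(4\pi|x|)$ if $d=3$. For a function $h$ on $D$, $(\Phi_k\ast h)(x):=\int_D\Phi_k(x-y)h(y)\,dy$. $S^{d-1}$ is the unit sphere with area $\omega_{d-1}$. $U_\delta:=\{v\in L^\infty(D):\|v\|_{L^\infty(D)}\le\delta\}$. Linear solution operator. $I-k^2\Phi_k\ast(q_0\,\cdot)$ is an isomorphism on $L^2(D)$ and on $L^\infty(D)$; $V_0f:=(I-k^2\Phi_k\ast(q_0\,\cdot))^{-1}(k^2\Phi_k\ast(q_0f))$. Nonlinear solution operator. $\delta>0$ is admissible if for every $f\in U_\delta$ the equation $v(x)=k^2\int_D\Phi_k(x-y)q(y,|v(y)+f(y)|)(v(y)+f(y))\,dy$,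 $x\in D$, has a unique solution $v=:V(f)\in L^\infty(D)$ with $v-V_0f\in U_\delta$, and for some $C'>0$ and all $f\in U_\delta$: $\|V(f)\|_{L^\infty(D)}\le C'\|f\|_{L^\infty(D)}$, $\|V(f)\|_{L^2(D)}\le C'\|f\|_{L^2(D)}$, $\|V(f)-V_0f\|_{L^\infty(D)}\le C'\|f\|_{L^\infty(D)}^{1+\alpha}$, $\|V(f)-V_0f\|_{L^2(D)}\le C'\|f\|^\alpha_{L^\infty(D)}\|f\|_{L^2(D)}$. (Sufficiently small $\delta$ are admissible.) The extension of $V(f)$ to $\mathbb{R}^d$ by the right-hand side of the integral equation is again denoted $V(f)$; it is the ''unique small radiating solution'' of the displayed differential equation. Far field pattern. The far field pattern of the extended $v=V(f)$ is the function $v^\infty\in L^2(S^{d-1})$ with $v(x)=C_de^{\mathrm{i}k|x|}|x|^{(1-d)/2}v^\infty(\hat x)+O(|x|^{-(d+1)/2})$ as $|x|\to\infty$, uniformly in $\hat x=x/|x|$, where $C_2=e^{\mathrm{i}\pi/4}/\sqrt{8\pi k}$ and $C_3=1/(4\pi)$. Herglotz operator. $H:L^2(S^{d-1})\to L^2(D)$, $(H\psi)(x):=\int_{S^{d-1}}\psi(\theta)e^{\mathrm{i}kx\cdot\theta}\,ds(\theta)$, with adjoint $(H^*\phi)(\hat x)=\int_D\phi(y)e^{-\mathrm{i}k\hat x\cdot y}\,dy$. Since $\|H\psi\|_{L^\infty(D)}\le\omega_{d-1}^{1/2}\|\psi\|_{L^2(S^{d-1})}$, one has $Hg\in U_\delta$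 for $g\in\mathcal{D}(F)$. The closure in $\mathcal{D}(T)$ is taken in $L^2(D)$. *)

(* Defs.v *)
From HB Require Import structures.
From mathcomp Require Import all_boot all_order all_algebra.
From mathcomp Require Import all_classical all_reals all_analysis.
From mathcomp Require Import measurable_realfun ess_sup_inf.
From mathcomp Require Import complex.

Set Implicit Arguments.
Unset Strict Implicit.
Unset Printing Implicit Defensive.

Import Order.TTheory GRing.Theory Num.Theory.
Import numFieldNormedType.Exports.

Local Open Scope classical_set_scope.
Local Open Scope ring_scope.
Local Open Scope complex_scope.

(* Complex-valued functions are functions into R[i]; the library integrates
   real functions only, so integrals are taken on real and imaginary parts. *)

Definition cmod {R : realType} (z : R[i]) : R := Normc.normc z.

Definition expi {R : realType} (t : R) : R[i] := cos t +i* sin t.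

Section rV_measurable.
Context {d : measure_display} {T : measurableType d} (n : nat).

Definition rV_coord (i : 'I_n) (x : 'rV[T]_n) : T := x ord0 i.

Let rV_set0 : g_sigma_preimage rV_coord set0.
Proof. exact: sigma_algebra0. Qed.

Let rV_setC A : g_sigma_preimage rV_coord A -> g_sigma_preimage rV_coord (~` A).
Proof. exact: sigma_algebraC. Qed.

Let rV_bigcup (F : (set 'rV[T]_n)^nat) : (forall i, g_sigma_preimage rV_coord (F i)) ->
  g_sigma_preimage rV_coord (\bigcup_i (F i)).
Proof. exact: sigma_algebra_bigcup. Qed.

(* The sigma-algebra on 'rV_n is generated by the coordinates; for T = R it is
   the Borel sigma-algebra of R^n. *)
HB.instance Definition _ := @isMeasurable.Build (measure_tuple_display d)
  'rV[T]_n (g_sigma_preimage rV_coord) rV_set0 rV_setC rV_bigcup.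

End rV_measurable.


Lemma measurable_rV_coord {d} {T : measurableType d} n (i : 'I_n) :
  measurable_fun [set: 'rV[T]_n] (fun x => x ord0 i).
Proof.
move=> _ Y mY; rewrite setTI; apply: sub_sigma_algebra => /=.
rewrite -bigcup_seq/=; exists i => /=; first by rewrite mem_index_enum.
by exists Y => //; rewrite setTI.
Qed.

Lemma measurable_fun_rV {d d'} {T : measurableType d} {X : measurableType d'}
    n (f : X -> 'rV[T]_n) :
  (forall i, measurable_fun [set: X] (fun x => f x ord0 i)) ->
  measurable_fun [set: X] f.
Proof.
move=> mf; suff : preimage_set_system [set: X] f measurable `<=` measurable.
  by move=> fS _ A mA; apply: fS; exists A.
rewrite -g_sigma_preimage_comp; apply: smallest_sub.
  exact: sigma_algebra_measurable.
case: n => [|n] in f mf *; first by rewrite big_ord0.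
rewrite -bigcup_mkord_ord; apply: bigcup_sub => i Ii.
by move=> A [B mB <-]; exact: mf.
Qed.

Definition consrV {R : realType} n (p : measurableTypeR R * 'rV[R]_n) : 'rV[R]_n.+1 :=
  \row_i oapp (fun j => p.2 ord0 j) p.1 (unlift ord0 i).

Definition unconsrV {R : realType} n (x : 'rV[R]_n.+1) : measurableTypeR R * 'rV[R]_n :=
  (x ord0 ord0, \row_j x ord0 (lift ord0 j)).

Lemma consrVK {R : realType} n : cancel (@consrV R n) (@unconsrV R n).
Proof.
move=> [a x]; rewrite /unconsrV /consrV mxE unlift_none/=; congr (_, _).
by apply/rowP => j; rewrite !mxE liftK.
Qed.

Lemma measurable_consrV {R : realType} n : measurable_fun [set: _] (@consrV R n).
Proof.
apply: measurable_fun_rV => i.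
under eq_fun do rewrite mxE.
case: (unliftP ord0 i) => [j _|_]/=; last exact: measurable_fst.
exact: (measurableT_comp (measurable_rV_coord j) measurable_snd).
Qed.

Lemma measurable_unconsrV {R : realType} n : measurable_fun [set: _] (@unconsrV R n).
Proof.
apply/measurable_fun_pair => /=; first exact: measurable_rV_coord.
apply: measurable_fun_rV => j.
under eq_fun do rewrite mxE.
exact: measurable_rV_coord.
Qed.

Section lebesgue_step.
Context {R : realType} (n : nat) (mu : {sigma_finite_measure set 'rV[R]_n -> \bar R}).

Definition lebesgue_cons : set 'rV[R]_n.+1 -> \bar R :=
  pushforward (@lebesgue_measure R \x mu)%E (@consrV R n).

HB.instance Definition _ := Measure.copy lebesgue_cons
  (measure_function_pushforward__canonical__measure_function_Measure
     (lebesgue_measure \x mu)%E (@measurable_consrV R n)).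

Let lebesgue_cons_sigma_finite : sigma_finite setT lebesgue_cons.
Proof.
have /sigma_finiteP[F [TF ndF Foo]] := sigma_finiteT (@lebesgue_measure R).
have /sigma_finiteP[G [TG ndG Goo]] := sigma_finiteT mu.
exists (fun i => @unconsrV R n @^-1` (F i `*` G i)).
  apply/seteqP; split => // x _; case xE : (unconsrV x) => [a y].
  have [i _ Fia] : (\bigcup_i F i) a by rewrite -TF.
  have [j _ Gjy] : (\bigcup_i G i) y by rewrite -TG.
  exists (maxn i j) => //.
  suff: (F (maxn i j) `*` G (maxn i j)) (a, y) by rewrite -xE.
  split => /=.
    by move: (a) Fia; exact/subsetPset/ndF/leq_maxl.
  by move: (y) Gjy; exact/subsetPset/ndG/leq_maxr.
move=> i; have [mF Fi] := Foo i; have [mG Gi] := Goo i; split.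
  by rewrite -[X in measurable X]setTI; apply: measurable_unconsrV => //; exact: measurableX.
rewrite /lebesgue_cons /pushforward -comp_preimage.
rewrite (_ : _ \o _ = id) ?preimage_id; last by apply/funext => p; exact: consrVK.
by rewrite product_measure1E// lte_mul_pinfty// ge0_fin_numE.
Qed.

HB.instance Definition _ := Measure_isSigmaFinite.Build _ _ _ lebesgue_cons
  lebesgue_cons_sigma_finite.

End lebesgue_step.

(* Lebesgue measure on R^n, as an iterated product of lebesgue_measure. *)
Fixpoint lebesgue {R : realType} (n : nat) : {sigma_finite_measure set 'rV[R]_n -> \bar R} :=
  if n is m.+1 then lebesgue_cons (lebesgue m) else \d_ (0 : 'rV[R]_0).

Definition dotv {R : realType} {n} (x y : 'rV[R]_n) : R := \sum_i x ord0 i * y ord0 i.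

(* The norm `|x| of the library on 'rV_n is the sup norm. *)
Definition enorm {R : realType} {n} (x : 'rV[R]_n) : R := Num.sqrt (dotv x x).

Definition direction {R : realType} {n} (x : 'rV[R]_n) : 'rV[R]_n := (enorm x)^-1 *: x.

Lemma measurable_enorm {R : realType} n : measurable_fun [set: 'rV[R]_n] enorm.
Proof.
have mdot : measurable_fun [set: 'rV[R]_n] (fun x => dotv x x).
  by apply: measurable_sum => i; apply: measurable_funM; exact: measurable_rV_coord.
exact: measurableT_comp (continuous_measurable_fun (@sqrt_continuous R)) mdot.
Qed.

Lemma measurable_direction {R : realType} n : measurable_fun [set: 'rV[R]_n] direction.
Proof.
apply: measurable_fun_rV => i; rewrite /direction.
under eq_fun do rewrite mxE -powR_inv1 ?sqrtr_ge0//.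
apply: measurable_funM; last exact: measurable_rV_coord.
exact: measurableT_comp (measurable_powR (-1)) (@measurable_enorm R n).
Qed.

Definition unit_sphere {R : realType} n : set 'rV[R]_n := [set x | enorm x = 1].

Definition punctured_ball {R : realType} n : set 'rV[R]_n := [set x | 0 < enorm x <= 1].

Lemma measurable_punctured_ball {R : realType} n : measurable (@punctured_ball R n).
Proof.
rewrite (_ : @punctured_ball R n = @enorm R n @^-1` `]0, 1]).
  by rewrite -[X in measurable X]setTI; exact: measurable_enorm.
by apply/seteqP; split => x /=; rewrite in_itv/=.
Qed.

(* Surface measure of S^(n-1), as a measure on R^n carried by the sphere:
   sphere_measure A = n * lebesgue {x | 0 < |x| <= 1, x/|x| \in A}
   (integration in polar coordinates). *)
Definition sphere_measure {R : realType} n : {measure set 'rV[R]_n -> \bar R} :=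
  mscale n%:R%:nng (measure_function_pushforward__canonical__measure_function_Measure
     (mrestr (lebesgue n) (@measurable_punctured_ball R n)) (@measurable_direction R n)).

Definition sphere_area {R : realType} n : R := fine (sphere_measure n (@unit_sphere R n)).

Section Lp.
Context {d : measure_display} {T : measurableType d} {R : realType}.
Variables (mu : {measure set T -> \bar R}) (D : set T).

Definition cintegral (f : T -> R[i]) : R[i] :=
  Rintegral mu D (fun x => complex.Re (f x)) +i* Rintegral mu D (fun x => complex.Im (f x)).

(* L^p(D)-norm; the values of f outside D are ignored. *)
Definition Lp_norm (p : \bar R) (f : T -> R[i]) : \bar R :=
  'N[mu]_p[(fun x => (cmod (f x))%:E) \_ D]%E.

Definition in_Lp (p : \bar R) (f : T -> R[i]) : Prop :=
  [/\ measurable_fun D (fun x => complex.Re (f x)),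
      measurable_fun D (fun x => complex.Im (f x)) & (Lp_norm p f < +oo)%E].

End Lp.

Section hankel.
Context {R : realType}.
Implicit Types x : R.

Definition euler_gamma : R := limn (fun n => series harmonic n - ln n%:R : R).

(* J_0(x) = sum_m (-1)^m (x/2)^(2m) / (m!)^2 *)
Definition besselJ0 x : R :=
  limn (series (fun m => (-1) ^+ m * (x / 2) ^+ (2 * m) / m`!%:R ^+ 2)).

(* Y_0(x) = (2/pi) (ln (x/2) + gamma) J_0(x)
            - (2/pi) sum_m (-1)^m (1 + 1/2 + ... + 1/m) (x/2)^(2m) / (m!)^2, for x > 0 *)
Definition besselY0 x : R :=
  2 / pi * (ln (x / 2) + euler_gamma) * besselJ0 x -
  2 / pi * limn (series (fun m =>
    (-1) ^+ m * series harmonic m * (x / 2) ^+ (2 * m) / m`!%:R ^+ 2)).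

(* The Hankel function H_0^(1) on ]0, +oo[. *)
Definition hankel0 x : R[i] := besselJ0 x +i* besselY0 x.

End hankel.

Section scattering.
Context {R : realType} {d : nat}.
Local Notation C := R[i].
Local Notation E := 'rV[R]_d.
Implicit Types (k delta alpha : R) (D : set E) (q : E -> R -> R)
  (f v u psi phi : E -> C) (x y : E).

(* Only the cases d = 2 and d = 3 are meaningful. *)
Definition Phi k x : C :=
  if d == 2%N then (0 +i* 1) / 4 * hankel0 (k * enorm x)
  else expi (k * enorm x) / (4 * pi * enorm x)%:C.

Definition farfield_const k : C :=
  if d == 2%N then expi (pi / 4) / (Num.sqrt (8 * pi * k))%:C
  else ((4 * pi)^-1)%:C.

Definition convPhi k D (h : E -> C) x : C :=
  cintegral (lebesgue d) D (fun y => Phi k (x - y) * h y).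

Definition nonlinearity q (w : E -> C) x : C := (q x (cmod (w x)))%:C * w x.

(* The superposition q(x, |w(x)|) is insensitive to null sets of R^d but not to
   those of R^d x R, so q is a representative whose exceptional sets are of
   the form N x R with N a null set of R^d. *)
Record contrast D q (q0 : E -> R) alpha : Prop := Contrast {
  contrast_measurable : measurable_fun [set: E * R] (fun p => q p.1 p.2);
  contrast_bounded : exists M : R,
    {ae lebesgue d, forall x, forall t : R, `|q x t| <= M};
  contrast_supp : {ae lebesgue d, forall x, ~ closure D x -> forall t, q x t = 0};
  contrast0 : {ae lebesgue d, forall x, q x 0 = 0};
  contrast_lin_Loo : in_Lp (lebesgue d) setT +oo (fun x => (q0 x)%:C);
  contrast_lin_inf : ((-1)%:E < ess_inf (lebesgue d) (EFin \o q0))%E;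
  contrast_lin_supp : {ae lebesgue d, forall x, ~ closure D x -> q0 x = 0};
  contrast_alpha : 0 < alpha;
  contrast_approx : exists2 Cq : R, 0 < Cq & forall z1 z2 : C,
    cmod z1 <= 1 -> cmod z2 <= 1 ->
    (Lp_norm (lebesgue d) setT +oo (fun x =>
       (q x (cmod z1))%:C * z1 - (q x (cmod z2))%:C * z2 - (q0 x)%:C * (z1 - z2))%R
     <= (Cq * (cmod z1 `^ alpha + cmod z2 `^ alpha) * cmod (z1 - z2))%:E)%E
}.

Definition U_ball D delta : set (E -> C) :=
  [set v | in_Lp (lebesgue d) D +oo v /\ (Lp_norm (lebesgue d) D +oo v <= delta%:E)%E].

(* V_0 f = (I - k^2 Phi_k * (q0 .))^-1 (k^2 Phi_k * (q0 f)), the inverse being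
   taken in L^2(D); for f in L^oo(D) it agrees with the inverse in L^oo(D). *)
Definition is_Vlin k D (q0 : E -> R) f u : Prop :=
  in_Lp (lebesgue d) D 2%:E u /\
  {ae lebesgue d, forall x, D x ->
    u x - (k ^+ 2)%:C * convPhi k D (fun y => (q0 y)%:C * u y) x =
    (k ^+ 2)%:C * convPhi k D (fun y => (q0 y)%:C * f y) x}.

Definition Vlin k D (q0 : E -> R) f : E -> C :=
  xget (fun=> 0) [set u | is_Vlin k D q0 f u].

Definition is_Vsol k D q (q0 : E -> R) delta f v : Prop :=
  [/\ in_Lp (lebesgue d) D +oo v,
      {ae lebesgue d, forall x, D x ->
        v x = (k ^+ 2)%:C * convPhi k D (nonlinearity q (fun y => v y + f y)) x} &
      U_ball D delta (fun x => v x - Vlin k D q0 f x)].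

(* Under [admissible], is_Vsol has a solution, unique almost everywhere on D. *)
Definition Vsol k D q (q0 : E -> R) delta f : E -> C :=
  xget (fun=> 0) [set v | is_Vsol k D q q0 delta f v].

(* The extension of Vsol to R^d by the right-hand side of the integral equation. *)
Definition Vsol_ext k D q (q0 : E -> R) delta f x : C :=
  (k ^+ 2)%:C * convPhi k D (nonlinearity q (fun y => Vsol k D q q0 delta f y + f y)) x.

Definition admissible k D q (q0 : E -> R) alpha delta : Prop :=
  0 < delta /\
  exists2 C' : R, 0 < C' & forall f, U_ball D delta f ->
    let Vf := Vsol k D q q0 delta f in
    let Wf := fun x => Vf x - Vlin k D q0 f x in
    let N p := Lp_norm (lebesgue d) D p in
    (exists v, is_Vsol k D q q0 delta f v) /\
    (forall v1 v2, is_Vsol k D q q0 delta f v1 -> is_Vsol k D q q0 delta f v2 ->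
       {ae lebesgue d, forall x, D x -> v1 x = v2 x}) /\
    [/\ (N +oo Vf <= C'%:E * N +oo f)%E,
        (N 2%:E Vf <= C'%:E * N 2%:E f)%E,
        (N +oo Wf <= C'%:E * (N +oo f `^ (1 + alpha)))%E &
        (N 2%:E Wf <= C'%:E * (N +oo f `^ alpha * N 2%:E f))%E].

Definition herglotz k psi x : C :=
  cintegral (sphere_measure d) (@unit_sphere R d)
    (fun theta => psi theta * expi (k * dotv x theta)).

Definition herglotz_adj k D phi xhat : C :=
  cintegral (lebesgue d) D (fun y => phi y * expi (- (k * dotv xhat y))).

Definition dom_F delta : set (E -> C) :=
  [set psi | in_Lp (sphere_measure d) (@unit_sphere R d) 2%:E psi /\
    (Lp_norm (sphere_measure d) (@unit_sphere R d) 2%:E psi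
       <= (delta / Num.sqrt (sphere_area d))%:E)%E].

(* The L^2(D)-closure of the image of dom_F under the Herglotz operator. *)
Definition dom_T k D delta : set (E -> C) :=
  [set f | in_Lp (lebesgue d) D 2%:E f /\
    forall e : R, 0 < e -> exists2 psi, dom_F delta psi &
      (Lp_norm (lebesgue d) D 2%:E (fun x => f x - herglotz k psi x)%R < e%:E)%E].

Definition Tmap k D q (q0 : E -> R) delta f x : C :=
  (k ^+ 2)%:C * nonlinearity q (fun y => Vsol k D q q0 delta f y + f y) x.

Definition is_farfield k v (vinf : E -> C) : Prop :=
  in_Lp (sphere_measure d) (@unit_sphere R d) 2%:E vinf /\
  exists M r0 : R, 0 < r0 /\ forall x, r0 <= enorm x ->
    cmod (v x - farfield_const k * expi (k * enorm x)
                * (enorm x `^ ((1 - d%:R) / 2))%:C * vinf (direction x))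
    <= M * enorm x `^ (- ((d%:R + 1) / 2)).

Definition farfield k v : E -> C := xget (fun=> 0) [set vinf | is_farfield k v vinf].

Definition farfield_map k D q (q0 : E -> R) delta psi : E -> C :=
  farfield k (Vsol_ext k D q q0 delta (herglotz k psi)).

End scattering.

(* Main.v *)
(* With h := k^2 q(., |V f + f|) (V f + f), bounded on the bounded set D, the extended solution is
   the volume potential Phi_k * h.  Far away,
     Phi_k (x - y) = C_d e^(i k |x|) |x|^((1-d)/2) e^(- i k x^ . y) + O(|x|^(-(d+1)/2))
   uniformly in y in D, so the far field pattern of Phi_k * h is H^* h; it is unique because the
   leading term dominates the remainder.  A limit in L^2(D) of functions bounded by delta is bounded
   by delta almost everywhere, hence the closure of H (dom_F) stays in U_delta.
   The kernel expansion is elementary for d = 3.  For d = 2 it rests on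
     H_0^(1) t = 2/pi e^(i t) \int_0^oo e^(- t v^2 / sqrt (1 + v^2))
                             (1 / (1 + v^2) - i / sqrt (1 + v^2)) dv.
   Real and imaginary parts of both sides solve Bessel's equation, and a solution is determined by
   its behaviour along a sequence of times tending to 0; there the integral involves Euler's constant
   through the harmonic numbers.  Comparison with a Gaussian integral gives the expansion as t -> oo. *)
Require Import Defs.
From mathcomp Require Import all_boot all_order all_algebra.
From mathcomp Require Import all_classical all_reals all_analysis.
From mathcomp Require Import measurable_realfun ess_sup_inf complex.
From mathcomp Require Import ring lra.
Import Order.TTheory GRing.Theory Num.Theory.
Import numFieldNormedType.Exports.
Set Implicit Arguments.
Unset Strict Implicit.
Unset Printing Implicit Defensive.
Local Open Scope classical_set_scope.
Local Open Scope ring_scope.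

(** * Bessel functions of order zero as power series *)

(** The obstacle is the plane: [hankel0] is given by power series at 0, whereas the far field needs
    its behaviour at infinity. The integral that bridges the two is [2 / (pi i)] times the integral
    of [e^(i t cosh w)] over the curve [w = asinh v + i atan v], [v >= 0], along which
    [sinh w = v / hyp v + i v] and [dw = (1 / hyp v + i / hyp v ^ 2) dv]. It satisfies Bessel's
    equation because [sinh w e^(i t cosh w)] vanishes at both ends. As [t] tends to 0 the integrand
    weighted by [1 / hyp v] loses its decay and a logarithm appears. Its constant term must be
    exactly the one in [Y_0], so a crude estimate is useless: at [t = 2 / N] the exponential is
    replaced by a rational function with an explicit primitive, and the integral becomes [2 ln N]
    minus a harmonic number, up to [O(1 / N)]. In the volume potential only points [x] far from [D]
    are examined, where [x - y] stays away from the singularity of the kernel. *)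

Section entire_power_series.
Context {R : realType}.
Implicit Types (c : nat -> R) (x : R).

Definition pser c x : R := limn (pseries c x).

(** A factorial bound gives convergence on the whole line by comparison with the exponential series,
    and it survives differentiation and addition, so power series can be handled without a radius of
    convergence. *)
Definition entire c :=
  exists K M : R, [/\ 0 <= K, 0 <= M & forall n, `|c n| <= K * M ^+ n / n`!%:R].

Lemma entire_cvg c x : entire c -> cvgn (pseries c x).
Proof.
move=> [K [M [K0 M0 cKM]]]; rewrite /pseries; apply: normed_cvg => /=.
apply: (@series_le_cvg _ _ (fun n => K * exp_coeff (M * `|x|) n)) => [//=|n|n|].
- by rewrite /= mulr_ge0// exp_coeff_ge0// mulr_ge0.
- rewrite /= normrM normrX /exp_coeff/= exprMn.
  rewrite (_ : K * _ = (K * M ^+ n / n`!%:R) * `|x| ^+ n); last by ring.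
  by rewrite ler_wpM2r// exprn_ge0.
- rewrite (_ : (fun n => _) = K *: (exp_coeff (M * `|x|) : R^nat)) //.
  by apply: is_cvg_seriesZ; exact: is_cvg_series_exp_coeff.
Qed.

Lemma entire_diffs c : entire c -> entire (pseries_diffs c).
Proof.
move=> [K [M [K0 M0 cKM]]]; exists (K * M), M; split => [|//|n].
  exact: mulr_ge0.
rewrite /pseries_diffs normrM ger0_norm//.
apply: le_trans (ler_wpM2l _ (cKM n.+1)) _ => //.
rewrite factS natrM invfM exprS le_eqVlt; apply/orP; left; apply/eqP.
have f0 : n`!%:R != 0 :> R by rewrite pnatr_eq0 -lt0n fact_gt0.
have n0 : n%:R + 1 != 0 :> R by rewrite natr1 pnatr_eq0.
by rewrite -?natr1; field; rewrite ?f0 ?n0.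
Qed.

Lemma entireD c e : entire c -> entire e -> entire (fun n => c n + e n).
Proof.
move=> [K [M [K0 M0 cKM]]] [K' [M' [K'0 M'0 eKM]]].
exists (K + K'), (M + M'); split; [exact: addr_ge0|exact: addr_ge0|move=> n].
apply: le_trans (ler_normD _ _) _; rewrite mulrDl mulrDl lerD//.
  apply: le_trans (cKM n) _; rewrite ler_wpM2r// ler_wpM2l//.
  by rewrite lerXn2r ?nnegrE ?addr_ge0// lerDl.
apply: le_trans (eKM n) _; rewrite ler_wpM2r// ler_wpM2l//.
by rewrite lerXn2r ?nnegrE ?addr_ge0// lerDr.
Qed.

Lemma is_derive_pser c x : entire c -> is_derive x 1 (pser c) (pser (pseries_diffs c) x).
Proof.
move=> ec; apply: (@pseries_snd_diffs _ _ (`|x| + 1)).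
- exact: entire_cvg.
- exact/entire_cvg/entire_diffs.
- exact/entire_cvg/entire_diffs/entire_diffs.
- by rewrite [ltRHS]ger0_norm ?addr_ge0// ltrDl.
Qed.

Lemma pserD c e x : entire c -> entire e ->
  pser c x + pser e x = pser (fun n => c n + e n) x.
Proof.
move=> ec ee; rewrite /pser -limD; [|exact: entire_cvg|exact: entire_cvg].
congr (lim (_ @ \oo)); apply/funext => n; rewrite /pseries /series/= fctE -big_split/=.
by apply: eq_bigr => i _; rewrite mulrDl.
Qed.

Lemma pserN c x : entire c -> - pser c x = pser (fun n => - c n) x.
Proof.
move=> ec; rewrite /pser -limN; last exact: entire_cvg.
congr (lim (_ @ \oo)); apply/funext => n; rewrite /pseries /series/= fctE -sumrN.
by apply: eq_bigr => i _; rewrite mulNr.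
Qed.

Lemma pser_mulX c x : entire c ->
  x * pser (pseries_diffs c) x = pser (fun n => n%:R * c n) x.
Proof.
move=> ec.
have cd := @entire_cvg _ x (entire_diffs ec).
apply/esym/cvg_lim => //; rewrite -cvg_shiftS/=.
rewrite (_ : (fun n => _) = (fun n => x * pseries (pseries_diffs c) x n)).
  by apply: cvgMr.
apply/funext => n; rewrite /pseries /series/= big_nat_recl//= !mul0r add0r mulr_sumr.
by apply: eq_bigr => i _; rewrite /pseries_diffs exprS; ring.
Qed.

Lemma pser0 c : entire c -> pser c 0 = c 0%N.
Proof.
move=> ec; apply/cvg_lim => //; rewrite -cvg_shiftS/=.
rewrite (_ : (fun n => _) = cst (c 0%N)); first exact: cvg_cst.
apply/funext => n; rewrite /pseries /series/= big_nat_recl//= expr0 mulr1 big1 ?addr0//.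
by move=> i _; rewrite exprS mul0r mulr0.
Qed.

End entire_power_series.

Section bessel_series.
Context {R : realType}.
Implicit Types x t : R.

(** Coefficients in the variable [s = t ^ 2 / 4], in which Bessel's equation reads
    [u' + s u'' = - u]. *)
Definition j0_coef (m : nat) : R := (-1) ^+ m / m`!%:R ^+ 2.
Definition y0_coef (m : nat) : R := (-1) ^+ m * series harmonic m / m`!%:R ^+ 2.

Lemma series_harmonic_ge0 n : 0 <= series (@harmonic R) n.
Proof. by apply: sumr_ge0 => i _; exact: harmonic_ge0. Qed.

Lemma series_harmonic_le n : series (@harmonic R) n <= n%:R.
Proof.
rewrite /series/= -[X in X%:R]subn0 -[leRHS]mulr_natr mul1r -sumr_const_nat.
by apply: ler_sum => i _; rewrite /harmonic/= invf_le1 ?ler1n// ltr0n.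
Qed.

Lemma fact_ge_id n : (n <= n`!)%N.
Proof. by case: n => // n; rewrite factS leq_pmulr// fact_gt0. Qed.

Lemma entire_j0 : entire j0_coef.
Proof.
exists 1, 1; split => // n; rewrite mul1r expr1n mul1r /j0_coef normrM normrX normrN1.
rewrite expr1n mul1r ger0_norm ?invr_ge0 ?sqr_ge0// expr2 invfM ler_piMr ?invr_ge0//.
by rewrite invf_le1 ?ltr0n ?fact_gt0// ler1n fact_gt0.
Qed.

Lemma entire_y0 : entire y0_coef.
Proof.
exists 1, 1; split => // n; rewrite mul1r expr1n mul1r /y0_coef !normrM normrX normrN1.
rewrite expr1n mul1r ger0_norm ?series_harmonic_ge0// ger0_norm ?invr_ge0 ?sqr_ge0//.
rewrite expr2 invfM mulrA ler_piMl ?invr_ge0// ler_pdivrMr ?ltr0n ?fact_gt0// mul1r.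
by rewrite (le_trans (series_harmonic_le n))// ler_nat fact_ge_id.
Qed.

Lemma j0_coef_rec x :
  pser (pseries_diffs j0_coef) x + x * pser (pseries_diffs (pseries_diffs j0_coef)) x =
  - pser j0_coef x.
Proof.
have e0 := entire_j0; have e1 := entire_diffs e0; have e2 := entire_diffs e1.
(* The recurrence itself writes this sequence as a sum of two entire ones. *)
have e3 : entire (fun n => n%:R * pseries_diffs j0_coef n).
  rewrite (_ : (fun n => _) = (fun n => - j0_coef n + - (pseries_diffs j0_coef n))).
    have eN c : entire c -> entire (fun n => - c n : R).
      by move=> [K [M [? ? cK]]]; exists K, M; split => // n; rewrite normrN.
    by apply: entireD; apply: eN.
  apply/funext => n; rewrite /pseries_diffs /j0_coef factS natrM exprS mulN1r.
  have f0 : n`!%:R != 0 :> R by rewrite pnatr_eq0 -lt0n fact_gt0.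
have n0 : n%:R + 1 != 0 :> R by rewrite natr1 pnatr_eq0.
by rewrite -?natr1; field; rewrite ?f0 ?n0.
rewrite pser_mulX// pserD// pserN//; congr pser; apply/funext => n.
rewrite /pseries_diffs /j0_coef factS natrM exprS mulN1r.
have f0 : n`!%:R != 0 :> R by rewrite pnatr_eq0 -lt0n fact_gt0.
have n0 : n%:R + 1 != 0 :> R by rewrite natr1 pnatr_eq0.
by rewrite -?natr1; field; rewrite ?f0 ?n0.
Qed.

(** The source term comes from the logarithm in [Y_0]: inserting [ln (t / 2) * J_0] into Bessel's
    equation leaves [2 J_0'], which is [t] times the first derivative of the [J_0] series in [s],
    and the present series has to cancel it. *)
Lemma y0_coef_rec x :
  pser (pseries_diffs y0_coef) x + x * pser (pseries_diffs (pseries_diffs y0_coef)) x =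
  pser (pseries_diffs j0_coef) x - pser y0_coef x.
Proof.
have e0 := entire_y0; have e1 := entire_diffs e0; have e2 := entire_diffs e1.
have f1 := entire_diffs entire_j0.
have eN : entire (fun n => - y0_coef n).
  by case: (e0) => [K [M [? ? cK]]]; exists K, M; split => // n; rewrite normrN.
have key : (fun n => pseries_diffs y0_coef n + n%:R * pseries_diffs y0_coef n) =
    (fun n => pseries_diffs j0_coef n + - y0_coef n).
  apply/funext => n; rewrite /pseries_diffs /j0_coef /y0_coef factS natrM exprS mulN1r.
  rewrite /series/= big_nat_recr//= -/(series harmonic n) /harmonic/=.
  have f0 : n`!%:R != 0 :> R by rewrite pnatr_eq0 -lt0n fact_gt0.
have n0 : n%:R + 1 != 0 :> R by rewrite natr1 pnatr_eq0.
by rewrite -?natr1; field; rewrite ?f0 ?n0.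
have e3 : entire (fun n => n%:R * pseries_diffs y0_coef n).
  rewrite (_ : (fun n => _) = (fun n => (pseries_diffs j0_coef n + - y0_coef n) +
      - pseries_diffs y0_coef n)).
    have eM c : entire c -> entire (fun n => - c n : R).
      by move=> [K [M [? ? cK]]]; exists K, M; split => // n; rewrite normrN.
    by do 2?[apply: entireD => //]; exact: eM.
  by apply/funext => n; move/(congr1 (@^~ n)): key => /= <-; rewrite addrAC subrr add0r.
by rewrite pser_mulX// pserD// key -pserD// -pserN.
Qed.

Lemma besselJ0E t : besselJ0 t = pser j0_coef (t ^+ 2 / 4).
Proof.
rewrite /besselJ0 /pser /pseries; congr (lim (_ @ \oo)); congr series.
apply/funext => m; rewrite /j0_coef exprM.
rewrite (_ : (t / 2) ^+ 2 = t ^+ 2 / 4); last by field.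
by rewrite mulrAC.
Qed.

Lemma besselY0E t : besselY0 t =
  2 / pi * (ln (t / 2) + euler_gamma) * besselJ0 t - 2 / pi * pser y0_coef (t ^+ 2 / 4).
Proof.
rewrite /besselY0 /pser /pseries; congr (_ - _ * _); congr (lim (_ @ \oo)); congr series.
apply/funext => m; rewrite /y0_coef exprM.
rewrite (_ : (t / 2) ^+ 2 = t ^+ 2 / 4); last by field.
by rewrite mulrAC.
Qed.

End bessel_series.

(** * Derivative rules for real functions *)

Section real_derivatives.
Context {R : realType}.
Implicit Types (f g : R -> R) (x a b : R).

Lemma is_derive_add f g x a b : is_derive x 1 f a -> is_derive x 1 g b ->
  is_derive x 1 (fun y => f y + g y) (a + b).
Proof. by move=> fa gb; exact: is_deriveD. Qed.

Lemma is_derive_opp f x a : is_derive x 1 f a -> is_derive x 1 (fun y => - f y) (- a).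
Proof. by move=> fa; exact: is_deriveN. Qed.

Lemma is_derive_mul f g x a b : is_derive x 1 f a -> is_derive x 1 g b ->
  is_derive x 1 (fun y => f y * g y) (a * g x + f x * b).
Proof.
move=> fa gb; have := is_deriveM fa gb; move/is_derive_eq; apply.
by rewrite addrC; congr (_ + _); rewrite [LHS]mulrC.
Qed.

Lemma is_derive_inv f x a : f x != 0 -> is_derive x 1 f a ->
  is_derive x 1 (fun y => (f y)^-1) (- a / f x ^+ 2).
Proof.
move=> fx0 fa; have := is_deriveV fx0 fa; move/is_derive_eq; apply.
by rewrite [LHS]mulrC mulrN mulNr.
Qed.

Lemma is_derive_scale c f x a : is_derive x 1 f a -> is_derive x 1 (fun y => c * f y) (c * a).
Proof.
move=> fa; have := is_derive_mul (is_derive_cst c x 1) fa; move/is_derive_eq; apply.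
by rewrite mul0r add0r.
Qed.

Lemma is_derive_exp_comp f x a : is_derive x 1 f a ->
  is_derive x 1 (fun y => expR (f y)) (a * expR (f x)).
Proof.
move=> fa; have := is_derive1_comp (is_derive_expR (f x)) fa; move/is_derive_eq; apply.
by rewrite mulrC.
Qed.

Lemma is_derive_ln_comp f x a : 0 < f x -> is_derive x 1 f a ->
  is_derive x 1 (fun y => ln (f y)) (a / f x).
Proof.
move=> fx0 fa; have := is_derive1_comp (is_derive1_ln fx0) fa; move/is_derive_eq; apply.
by rewrite mulrC.
Qed.

Lemma is_derive_pow n f x a : is_derive x 1 f a ->
  is_derive x 1 (fun y => f y ^+ n) (n%:R * f x ^+ n.-1 * a).
Proof.
move=> fa; elim: n => [|n IH].
  by rewrite !mul0r; exact: is_derive_cst.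
have := is_derive_mul fa IH.
rewrite (_ : (fun y => f y * f y ^+ n) = (fun y => f y ^+ n.+1)); last first.
  by apply/funext => y; rewrite exprS.
move/is_derive_eq; apply => /=; case: n {IH} => [|n]; first by rewrite expr0; ring.
by rewrite /= -[n.+2%:R]natr1 exprS; ring.
Qed.

Lemma is_derive_continuous f x a : is_derive x 1 f a -> {for x, continuous f}.
Proof. by move=> [fa _]; exact/differentiable_continuous/derivable1_diffP. Qed.

Lemma derive_continuous f (df : R -> R) : (forall x, is_derive x 1 f (df x)) -> continuous f.
Proof. by move=> fd x; exact: is_derive_continuous (fd x). Qed.

End real_derivatives.

(** * Integrals over the half-line dominated by [1 / (1 + x ^ 2)] *)

Section half_line.
Context {R : realType}.
Local Notation mu := (@lebesgue_measure R).
Local Notation Hl := (`[0, +oo[%classic : set R).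
Implicit Types (g G : R -> R) (x : R).

Lemma measurable_half_line : @measurable _ (measurableTypeR R) Hl.
Proof. exact: measurable_itv. Qed.

Lemma continuous_measurable g D : measurable D -> continuous g -> measurable_fun D g.
Proof. by move=> mD cg; apply: measurable_funTS; exact: continuous_measurable_fun. Qed.

Lemma integrable_oneDsqrV : mu.-integrable Hl (EFin \o (fun x => (1 + x ^+ 2)^-1)).
Proof.
apply/integrableP; split.
  apply/measurable_EFinP; apply: continuous_measurable; first exact: measurable_half_line.
  exact: (@continuous_oneDsqrV R).
rewrite (_ : \int[mu]_(x in _) _ = (pi / 2)%:E)%E ?ltry//.
rewrite -integral0y_oneDsqr; apply: eq_integral => x _ /=.
by rewrite ger0_norm// invr_ge0 addr_ge0 ?sqr_ge0.
Qed.

Lemma Rintegral_oneDsqrV : \int[mu]_(x in Hl) (1 + x ^+ 2)^-1 = pi / 2.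
Proof. by rewrite /Rintegral integral0y_oneDsqr. Qed.

Lemma half_line_integrable g C : continuous g ->
  (forall x, 0 <= x -> `|g x| <= C / (1 + x ^+ 2)) -> mu.-integrable Hl (EFin \o g).
Proof.
move=> cg gC; have iC := integrableZl measurable_half_line C integrable_oneDsqrV.
apply: (le_integrable measurable_half_line _ _ iC).
  by apply/measurable_EFinP; exact: continuous_measurable.
move=> x; rewrite /= in_itv/= andbT => x0.
by rewrite lee_fin (le_trans (gC x x0))// ler_norm.
Qed.

Lemma continuous_oneDsqrVZ C : continuous (fun x : R => C / (1 + x ^+ 2)).
Proof. by move=> x; apply: cvgMr; exact: (@continuous_oneDsqrV R). Qed.

Lemma integrable_oneDsqrVZ C : mu.-integrable Hl (EFin \o (fun x => C / (1 + x ^+ 2))).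
Proof.
apply: (@half_line_integrable _ `|C|); first exact: continuous_oneDsqrVZ.
by move=> x _; rewrite normrM [`|_^-1|]ger0_norm// invr_ge0 addr_ge0 ?sqr_ge0.
Qed.

(** Adding [C / (1 + x ^ 2)], whose primitive is [C * atan x], makes the integrand nonnegative, so
    that the fundamental theorem for nonnegative integrands applies. The added term contributes
    [C * (pi / 2)] to both sides and cancels. *)
Lemma half_line_FTC g G C l : continuous g -> (forall x, is_derive x 1 G (g x)) ->
  (forall x, 0 <= x -> `|g x| <= C / (1 + x ^+ 2)) -> G x @[x --> +oo] --> l ->
  \int[mu]_(x in Hl) g x = l - G 0.
Proof.
move=> cg dG gC Gl.
have ig := half_line_integrable cg gC.
have iC := integrable_oneDsqrVZ C.
have cC := @continuous_oneDsqrVZ C.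
have dF x : is_derive x 1 (fun x => G x + C * atan x) (g x + C * (1 + x ^+ 2)^-1).
  by apply: is_derive_add => //; apply: is_derive_scale; exact: is_derive1_atan.
have cF := derive_continuous dF.
have := @Rintegral_ge0_continuous_FTC2y R (fun x => g x + C * (1 + x ^+ 2)^-1)
  (fun x => G x + C * atan x) 0 (l + C * (pi / 2)).
rewrite (RintegralD measurable_half_line ig iC).
rewrite (RintegralZl _ measurable_half_line integrable_oneDsqrV).
rewrite Rintegral_oneDsqrV atan0 mulr0 addr0 => H.
apply: (addIr (C * (pi / 2))); rewrite addrAC; apply: H.
- move=> x x0; have := gC x x0; rewrite ler_norml => /andP[+ _]; lra.
- by apply: continuous_subspaceT => x; apply: cvgD; [exact: cg|exact: cC].
- by apply: cvgD => //; apply: cvgMr; exact: cvgy_atan.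
- by move=> x _; apply: ex_derive.
- apply: cvg_at_right_filter; have := cF 0; rewrite /prop_for/continuous_at atan0 mulr0 addr0; exact.
- by move=> x _; rewrite derive1E derive_val.
Qed.

End half_line.

(** * Steepest descent integrals *)

Section hyperbola.
Context {R : realType}.
Implicit Types v t : R.

(* On the path of steepest descent of [e^(i t cosh w)] through the saddle point [w = 0], [cosh w]
   equals [1 + i * phase v]. *)
Definition hyp v : R := Num.sqrt (1 + v ^+ 2).
Definition phase v : R := v ^+ 2 / hyp v.

Lemma hyp_sqr v : hyp v ^+ 2 = 1 + v ^+ 2.
Proof. by rewrite sqr_sqrtr// addr_ge0// sqr_ge0. Qed.

Lemma hyp_ge1 v : 1 <= hyp v.
Proof. by rewrite -[leLHS]sqrtr1 ler_wsqrtr// lerDl sqr_ge0. Qed.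

Lemma hyp_gt0 v : 0 < hyp v.
Proof. exact: lt_le_trans (hyp_ge1 v). Qed.

Lemma hyp_neq0 v : hyp v != 0.
Proof. by rewrite gt_eqF// hyp_gt0. Qed.

Lemma hyp_ge v : v <= hyp v.
Proof.
have [v0|v0] := leP 0 v; last by rewrite (le_trans (ltW v0))// ltW// hyp_gt0.
by rewrite -(@ler_pXn2r _ 2)// ?nnegrE ?(ltW (hyp_gt0 _))// hyp_sqr lerDr.
Qed.

Lemma phaseE v : phase v = hyp v - (hyp v)^-1.
Proof.
have h0 := hyp_neq0 v; have := hyp_sqr v; rewrite /phase => h2.
by apply: (mulIf h0); rewrite divfK// mulrBl mulVf// -expr2 h2; ring.
Qed.

Lemma phase_ge0 v : 0 <= phase v.
Proof. by rewrite divr_ge0 ?sqr_ge0// ltW// hyp_gt0. Qed.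

Lemma hyp_le_phase v : hyp v <= 1 + phase v.
Proof. rewrite phaseE; have := hyp_ge1 v; have : (hyp v)^-1 <= 1 by rewrite invf_le1 ?hyp_gt0 ?hyp_ge1.
lra. Qed.

Lemma is_derive_hyp v : is_derive v 1 hyp (v / hyp v).
Proof.
have v0 : 0 < 1 + v ^+ 2 by rewrite ltr_pwDl// sqr_ge0.
have d2 : is_derive v 1 (fun v => 1 + v ^+ 2) (0 + 2%:R * v ^+ 1 * 1).
  by apply: is_derive_add; exact: (is_derive_pow 2 (is_derive_id v 1)).
have := @is_derive1_comp _ _ (fun v : R => 1 + v ^+ 2) v _ _ (is_derive1_sqrt v0) d2.
move/is_derive_eq; apply.
by rewrite -/(hyp v); field; rewrite hyp_neq0.
Qed.

Lemma is_derive_phase v : is_derive v 1 phase (v / hyp v * (1 + (hyp v)^-2)).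
Proof.
rewrite (_ : phase = fun v => hyp v + - (hyp v)^-1); last first.
  by apply/funext => x; rewrite phaseE.
have := is_derive_add (is_derive_hyp v)
  (is_derive_opp (is_derive_inv (hyp_neq0 v) (is_derive_hyp v))).
by move/is_derive_eq; apply; field; rewrite hyp_neq0.
Qed.

(** The integrands with [k = 0] and [m = 1, 2] are the two in the representation of the Hankel
    function. Each derivative in [t] brings down a factor [- phase v] and so raises [k]: the family
    is closed, up to sign, under differentiation in time. *)
Definition steep k m t v : R := phase v ^+ k * expR (- (t * phase v)) * (hyp v)^-1 ^+ m.

Lemma steep_ge0 k m t v : 0 <= steep k m t v.
Proof.
by rewrite /steep !mulr_ge0 ?exprn_ge0 ?phase_ge0 ?expR_ge0// invr_ge0 ltW ?hyp_gt0.
Qed.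

Lemma is_derive_steep_phase t v : is_derive v 1 (fun v => expR (- (t * phase v)))
  (- (t * (v / hyp v * (1 + (hyp v)^-2))) * expR (- (t * phase v))).
Proof. exact: is_derive_exp_comp (is_derive_opp (is_derive_scale _ (is_derive_phase v))). Qed.

Lemma continuous_steep k m t : continuous (steep k m t).
Proof.
move=> v; have d1 := is_derive_pow k (is_derive_phase v).
have d2 := is_derive_pow m (is_derive_inv (hyp_neq0 v) (is_derive_hyp v)).
exact: is_derive_continuous (is_derive_mul (is_derive_mul d1 (is_derive_steep_phase t v)) d2).
Qed.

Lemma is_derive_steep_time k m t v :
  is_derive t 1 (fun t => steep k m t v) (- steep k.+1 m t v).
Proof.
rewrite /steep; have e1 : is_derive t 1 (fun t => t * phase v) (phase v).
  have := is_derive_mul (is_derive_id t 1) (is_derive_cst (phase v) t 1).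
  by move/is_derive_eq; apply; rewrite mul1r mulr0 addr0.
have := is_derive_mul (is_derive_scale (phase v ^+ k) (is_derive_exp_comp (is_derive_opp e1)))
  (is_derive_cst ((hyp v)^-1 ^+ m) t 1).
by move/is_derive_eq; apply; rewrite /cst exprS; ring.
Qed.

(** Since [hyp v <= 1 + phase v], multiplying by [1 + v ^ 2 = hyp v ^ 2] costs two powers of
    [1 + phase v]. The resulting power [k + 2] is absorbed by one term of the exponential series at
    [t0 * (1 + phase v)], and [expR t0] pays for the shift by 1. The bound is uniform in [t >= t0],
    as differentiation under the integral requires. *)
Lemma steep_le k m t0 t v : 0 < t0 -> t0 <= t ->
  steep k m t v <= k.+2`!%:R * expR t0 / t0 ^+ k.+2 / (1 + v ^+ 2).
Proof.
move=> t00 t0t; have S0 := phase_ge0 v; have h1 := hyp_ge1 v; have h0 := hyp_gt0 v.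
have S1 : 0 <= 1 + phase v by rewrite addr_ge0.
rewrite ler_pdivlMr; last by rewrite ltr_pwDl// sqr_ge0.
apply: (@le_trans _ _ ((1 + phase v) ^+ k * expR (- (t0 * phase v)) * (1 + phase v) ^+ 2)).
  rewrite -hyp_sqr; apply: ler_pM; rewrite ?steep_ge0 ?sqr_ge0//; last first.
    by rewrite lerXn2r ?nnegrE ?hyp_le_phase// ltW.
  rewrite /steep -[leRHS]mulr1; apply: ler_pM => //.
  - by rewrite mulr_ge0 ?exprn_ge0 ?expR_ge0.
  - by rewrite exprn_ge0// invr_ge0 ltW.
  - apply: ler_pM; rewrite ?exprn_ge0 ?expR_ge0//.
      by rewrite lerXn2r ?nnegrE// lerDr.
    by rewrite ler_expR lerN2 ler_wpM2r.
  - by rewrite exprn_ile1 ?invr_ge0 ?(ltW h0)// invf_le1.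
have T0 : 0 <= t0 * (1 + phase v) by rewrite mulr_ge0 ?(ltW t00).
have := expR_ge1Dxn k.+1 T0; set e := expR (t0 * (1 + phase v)) => He.
have -> : expR (- (t0 * phase v)) = expR t0 / e.
  by rewrite /e -expRN -expRD; congr expR; ring.
have e0 : 0 < e by exact: expR_gt0.
rewrite mulrAC -exprD addn2.
have Q0 : 0 < t0 ^+ k.+2 by exact: exprn_gt0.
have F0 : 0 < k.+2`!%:R :> R by rewrite ltr0n fact_gt0.
have HP : (1 + phase v) ^+ k.+2 <= k.+2`!%:R / t0 ^+ k.+2 * e.
  rewrite mulrAC ler_pdivlMr// -exprMn [_ * t0]mulrC [_ * e]mulrC -ler_pdivrMr//.
  by rewrite (le_trans _ He)// lerDr.
apply: le_trans (ler_wpM2r _ HP) _; first by rewrite divr_ge0// ?expR_ge0// ltW.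
rewrite le_eqVlt; apply/orP; left; apply/eqP; set F := _%:R; set Q := t0 ^+ _.
set E0 := expR t0; field; rewrite gt_eqF//= gt_eqF//.
Qed.

Local Notation mu := (@lebesgue_measure R).
Local Notation Hl := (`[0, +oo[%classic : set R).

Definition steepI k m t : R := \int[mu]_(v in Hl) steep k m t v.

Lemma steep_integrable k m t : 0 < t -> mu.-integrable Hl (EFin \o steep k m t).
Proof.
move=> t0; apply: half_line_integrable; first exact: continuous_steep.
move=> v _; rewrite ger0_norm ?steep_ge0//; exact: (steep_le k m v t0 (lexx t)).
Qed.

Lemma is_derive_steepI k m t : 0 < t -> is_derive t 1 (steepI k m) (- steepI k.+1 m t).
Proof.
move=> t0.
(* All times near [t] exceed [t / 2], so [steep_le] with [t0 = t / 2] gives one dominating function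
   for the derivative. *)
pose u := t / 2; have u0 : 0 < u by rewrite divr_gt0.
have It : `]u, (t + 1)[%classic t by rewrite /= in_itv/= /u; apply/andP; split; lra.
have int_ x : `]u, (t + 1)[%classic x -> mu.-integrable Hl (EFin \o (fun v => steep k m x v)).
  by rewrite /= in_itv/= => /andP[ux _]; apply: steep_integrable; exact: lt_trans ux.
have der x v : `]u, (t + 1)[%classic x -> Hl v -> derivable (fun x => steep k m x v) x 1.
  by move=> _ _; apply: ex_derive; exact: is_derive_steep_time.
pose K := k.+3`!%:R * expR u / u ^+ k.+3.
have K0 : 0 <= K.
  by apply: divr_ge0; [apply: mulr_ge0; [exact: ler0n|exact: expR_ge0]|exact/exprn_ge0/ltW].
have G0 (v : R) : 0 <= K * (1 + v ^+ 2)^-1.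
  by rewrite mulr_ge0// invr_ge0 addr_ge0 ?sqr_ge0.
have iG := @integrable_oneDsqrVZ R K.
have GU x v : `]u, (t + 1)[%classic x -> Hl v ->
    `|derive1 (fun x => steep k m x v) x| <= K * (1 + v ^+ 2)^-1.
  rewrite /= in_itv/= => /andP[ux _] _; rewrite derive1E.
  have [_ ->] := is_derive_steep_time k m x v.
  by rewrite normrN ger0_norm ?steep_ge0//; apply: steep_le => //; exact: ltW.
have dF := @derivable_under_integral R _ _ mu _ _ measurable_half_line _ _ _ It int_ der _ G0 iG GU.
have := @differentiation_under_integral R _ _ mu _ _ measurable_half_line _ _ _ It int_ der _ G0 iG GU.
rewrite derive1E => dFE; apply: DeriveDef; first exact: dF.
rewrite dFE /steepI -[RHS]mulN1r -(RintegralZl _ measurable_half_line (steep_integrable _ _ t0)).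
apply: eq_Rintegral => v _; rewrite /partial1of2 derive1E mulN1r.
by have [_ ->] := is_derive_steep_time k m t v.
Qed.

Lemma steepI_ge0 k m t : 0 <= steepI k m t.
Proof. by apply: Rintegral_ge0 => v _; exact: steep_ge0. Qed.

End hyperbola.

Section steep_equations.
Context {R : realType}.
Local Notation mu := (@lebesgue_measure R).
Local Notation Hl := (`[0, +oo[%classic : set R).
Implicit Types (f g : R -> R) (t v : R).

Lemma oneDsqrV_cvg0 g C : (forall v, 0 <= v -> `|g v| <= C / (1 + v ^+ 2)) ->
  g v @[v --> +oo] --> 0.
Proof.
move=> gC; apply/cvgr0Pnorm_le => e e0; near=> v.
have v1 : 1 <= v by near: v; exact: nbhs_pinfty_ge.
have v0 : 0 < v := lt_le_trans ltr01 v1.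
have Ce : C <= e * v.
  by rewrite mulrC -ler_pdivrMr//; near: v; apply: nbhs_pinfty_ge; rewrite num_real.
apply: le_trans (gC v (ltW v0)) _.
rewrite ler_pdivrMr; last by rewrite ltr_pwDl// sqr_ge0.
apply: le_trans Ce _; rewrite ler_pM2l//; nra.
Unshelve. all: by end_near. Qed.

Lemma integrable_scaleD a f g : mu.-integrable Hl (EFin \o f) -> mu.-integrable Hl (EFin \o g) ->
  mu.-integrable Hl (EFin \o (fun v => a * f v + g v)) /\
  \int[mu]_(v in Hl) (a * f v + g v) = a * \int[mu]_(v in Hl) f v + \int[mu]_(v in Hl) g v.
Proof.
move=> If Ig; have Iaf : mu.-integrable Hl (EFin \o (fun v => a * f v)).
  have H := integrableZl measurable_half_line a If.
  by have := H; apply: eq_integrable => //; exact: measurable_half_line.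
split; last by rewrite (RintegralD measurable_half_line Iaf Ig) (RintegralZl _ measurable_half_line If).
have H := integrableD measurable_half_line Iaf Ig.
by have := H; apply: eq_integrable => //; exact: measurable_half_line.
Qed.

(* The integral over the half-line of the derivative of [G], term by term. *)
Lemma steep_lincomb a1 a2 a3 a4 k1 k2 k3 k4 m1 m2 m3 m4 t G : 0 < t ->
  (forall v, is_derive v 1 G (a1 * steep k1 m1 t v + (a2 * steep k2 m2 t v +
     (a3 * steep k3 m3 t v + (a4 * steep k4 m4 t v + 0))))) ->
  G v @[v --> +oo] --> 0 -> G 0 = 0 ->
  a1 * steepI k1 m1 t + a2 * steepI k2 m2 t + a3 * steepI k3 m3 t + a4 * steepI k4 m4 t = 0.
Proof.
move=> t0 dG Goo G0.
have I0 : mu.-integrable Hl (EFin \o (fun _ : R => 0 : R)) by exact: integrable0.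
have int k m := @steep_integrable R k m t t0.
have [i4 e4] := integrable_scaleD a4 (int k4 m4) I0.
have [i3 e3] := integrable_scaleD a3 (int k3 m3) i4.
have [i2 e2] := integrable_scaleD a2 (int k2 m2) i3.
have [i1 e1] := integrable_scaleD a1 (int k1 m1) i2.
have Rint0 : \int[mu]_(v in Hl) (0 : R) = 0 by rewrite Rintegral_cst ?mul0r//; exact: measurable_half_line.
have := e1; rewrite e2 e3 e4 Rint0 !addrA addr0 -/(steepI _ _ _) => <-.
pose K k : R := k.+2`!%:R * expR t / t ^+ k.+2.
rewrite (@half_line_FTC R _ G (`|a1| * K k1 + (`|a2| * K k2 + (`|a3| * K k3 + `|a4| * K k4))) 0).
- by rewrite G0 subr0.
- move=> v; have cs k m : {for v, continuous (steep k m t)} by exact: continuous_steep.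
  by do 4![apply: cvgD; first exact: cvgMr (cs _ _)]; exact: cvg_cst.
- move=> v _; rewrite addr0 !mulrDl.
  have H a k m : `|a * steep k m t v| <= `|a| * K k / (1 + v ^+ 2).
    rewrite normrM (ger0_norm (steep_ge0 _ _ _ _)) -mulrA ler_wpM2l//.
    exact: (steep_le k m v t0 (lexx t)).
  by do 3![apply: le_trans (ler_normD _ _) _; apply: lerD => //].
- exact: Goo.
Qed.

(** Up to the constant factor [e^(i t)], this is the real part of the statement that
    [d (sinh w e^(i t cosh w))] integrates to 0 along the path. As [sinh w = v / hyp v + i v], the
    primitive is [v / hyp v * expR (- (t * phase v))]. *)
Lemma steep_ode_re t : 0 < t ->
  t * steepI 2 2 t - 2 * t * steepI 1 1 t - steepI 1 2 t + steepI 0 1 t = 0.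
Proof.
move=> t0; rewrite -[- steepI 1 2 t]mulN1r -[steepI 0 1 t in LHS]mul1r -mulNr.
apply: (@steep_lincomb t (- (2 * t)) (-1) 1 2 1 1 0 2 1 2 1 t (fun v => v / hyp v * expR (- (t * phase v)))); first exact: t0.
- move=> v; have h0 := hyp_neq0 v.
  have d1 := is_derive_mul (is_derive_id v 1) (is_derive_inv h0 (is_derive_hyp v)).
  have := is_derive_mul d1 (is_derive_steep_phase t v); move/is_derive_eq; apply.
  rewrite /steep /= phaseE; set E := expR _.
  have hv : v ^+ 2 = hyp v ^+ 2 - 1 by rewrite hyp_sqr; ring.
  transitivity (((hyp v)^-1 - v ^+ 2 / hyp v ^+ 3) * E -
    t * (v ^+ 2 / hyp v ^+ 2) * (1 + hyp v ^- 2) * E); first by field.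
  by rewrite hv; field.
- apply: (@oneDsqrV_cvg0 _ (2%N`!%:R * expR t / t ^+ 2)) => v v0.
  rewrite ger0_norm; last by rewrite mulr_ge0 ?expR_ge0// divr_ge0// ltW// hyp_gt0.
  apply: le_trans (steep_le 0 0 v t0 (lexx t)); rewrite /steep !expr0 mul1r mulr1.
  by rewrite ler_piMl ?expR_ge0// ler_pdivrMr ?hyp_gt0// mul1r hyp_ge.
- by rewrite !mul0r.
Qed.

(** The imaginary part of the same exact derivative: the primitive is [v * expR (- (t * phase v))],
    which decays because [v <= 1 + phase v]. *)
Lemma steep_ode_im t : 0 < t ->
  - t * steepI 2 1 t - 2 * t * steepI 1 2 t + steepI 1 1 t + steepI 0 2 t = 0.
Proof.
move=> t0; rewrite -[steepI 1 1 t in LHS]mul1r -[steepI 0 2 t in LHS]mul1r -[X in _ + X + _ + _]mulNr.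
apply: (@steep_lincomb (- t) (- (2 * t)) 1 1 2 1 1 0 1 2 1 2 t (fun v => v * expR (- (t * phase v)))); first exact: t0.
- move=> v; have h0 := hyp_neq0 v.
  have := is_derive_mul (is_derive_id v 1) (is_derive_steep_phase t v); move/is_derive_eq; apply.
  rewrite /steep /= phaseE; set E := expR _.
  have hv : v ^+ 2 = hyp v ^+ 2 - 1 by rewrite hyp_sqr; ring.
  transitivity (E - t * (v ^+ 2 / hyp v) * (1 + hyp v ^- 2) * E); first by field.
  by rewrite hv; field.
- apply: (@oneDsqrV_cvg0 _ (2%N`!%:R * expR t / t ^+ 2 + 3%N`!%:R * expR t / t ^+ 3)) => v v0.
  rewrite ger0_norm; last by rewrite mulr_ge0 ?expR_ge0.
  rewrite mulrDl; apply: le_trans (lerD (steep_le 0 0 v t0 (lexx t)) (steep_le 1 0 v t0 (lexx t))).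
  rewrite /steep !expr0 mul1r !mulr1 expr1 -[X in X + _]mul1r -mulrDl ler_wpM2r ?expR_ge0//.
  by rewrite (le_trans (hyp_ge v))// hyp_le_phase.
- by rewrite mul0r.
Qed.

End steep_equations.

(** * The integrals at small times *)

Section small_time.
Context {R : realType}.
Local Notation mu := (@lebesgue_measure R).
Local Notation Hl := (`[0, +oo[%classic : set R).
Implicit Types (a b t v : R).

(* Small times: [phase v] is close to [hexp v / 2], and for [t = 2 / N] the exponential
   [e^(- t * hexp v / 2)] is close to [(1 + hexp v / N)^-N], whose integral against [dv / hyp v]
   is elementary and produces the harmonic numbers that define Euler's constant. *)
Definition hexp v : R := v + hyp v.

Lemma hexp_gt0 v : 0 < hexp v.
Proof. by rewrite /hexp -ltrBlDl sub0r; have := hyp_ge1 (- v); rewrite /hyp sqrrN => h; have := hyp_sqr v; rewrite /hyp => h2; nra. Qed.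

Lemma hexp_ge v : 0 <= v -> hyp v <= hexp v.
Proof. by move=> v0; rewrite lerDr. Qed.

Lemma hexp0 : hexp 0 = 1 :> R.
Proof. by rewrite /hexp /hyp expr0n/= addr0 sqrtr1 add0r. Qed.

Lemma is_derive_hexp v : is_derive v 1 hexp (hexp v / hyp v).
Proof.
have := is_derive_add (is_derive_id v 1) (is_derive_hyp v); move/is_derive_eq; apply.
by rewrite /hexp; field; exact: hyp_neq0.
Qed.

Lemma continuous_hypV : continuous (fun v => (hyp v)^-1 : R).
Proof.
by move=> v; exact: is_derive_continuous (is_derive_inv (hyp_neq0 v) (is_derive_hyp v)).
Qed.

(** The difference is [(hyp v - v) / 2 - 1 / hyp v], and [hyp v - v <= 1 / hyp v]. Weighted by the
    further [1 / hyp v] of the integrand, the error becomes the integrable [1 / (1 + v ^ 2)]. *)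
Lemma phase_hexp v : 0 <= v -> `|phase v - hexp v / 2| <= (hyp v)^-1.
Proof.
move=> v0; rewrite phaseE /hexp; have h0 := hyp_gt0 v; have h2 := hyp_sqr v; have hv := hyp_ge v.
have i0 : 0 < (hyp v)^-1 by rewrite invr_gt0.
have hi : hyp v * (hyp v)^-1 = 1 by rewrite mulfV// hyp_neq0.
have : hyp v - v <= (hyp v)^-1 by rewrite -[leRHS]mul1r ler_pdivlMr//; nra.
rewrite ler_norml => H; apply/andP; split; lra.
Qed.

Definition binV b v : R := (1 + b * hexp v)^-1.

Lemma binV_gt0 b v : 0 <= b -> 0 < binV b v.
Proof. by move=> b0; rewrite invr_gt0 ltr_pwDl// mulr_ge0// ltW// hexp_gt0. Qed.

Lemma is_derive_binV b v : 0 <= b ->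
  is_derive v 1 (binV b) (- (b * (hexp v / hyp v)) * binV b v ^+ 2).
Proof.
move=> b0; have n0 : 1 + b * hexp v != 0 by have := binV_gt0 v b0; rewrite invr_gt0 => /lt0r_neq0.
have d1 : is_derive v 1 (fun v => 1 + b * hexp v) (0 + b * (hexp v / hyp v)).
  by apply: is_derive_add; exact: is_derive_scale (is_derive_hexp v).
have := @is_derive_inv R (fun v => 1 + b * hexp v) v _ n0 d1; move/is_derive_eq; apply.
by rewrite /binV add0r exprVn.
Qed.

(** With [u = hexp v] one has [du / u = dv / hyp v], and partial fractions reduce
    [1 / (u (1 + b u) ^ (n + 1))] one power at a time; each step contributes a term with factor
    [1 / (j + 1)], the source of the harmonic numbers. The logarithm is written [- ln (1 / u + b)],
    not as a difference of two logarithms, so that its limit at infinity is visible. *)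
Lemma is_derive_binV_prim b n v : 0 < b -> is_derive v 1
  (fun v => - ln ((hexp v)^-1 + b) + \sum_(j < n) (binV b v ^+ j.+1 * harmonic j))
  (binV b v ^+ n.+1 / hyp v).
Proof.
move=> b0; elim: n => [|n IH].
  under eq_fun do rewrite big_ord0 addr0.
  have u0 := hexp_gt0 v; have n0 : 0 < (hexp v)^-1 + b by rewrite addr_gt0 ?invr_gt0.
  have d1 : is_derive v 1 (fun v => (hexp v)^-1 + b) (- (hexp v / hyp v) / hexp v ^+ 2 + 0).
    by apply: is_derive_add; exact: is_derive_inv (lt0r_neq0 u0) (is_derive_hexp v).
  have := is_derive_opp (@is_derive_ln_comp R (fun v => (hexp v)^-1 + b) v _ n0 d1); move/is_derive_eq; apply.
  rewrite /binV expr1; field; rewrite (lt0r_neq0 u0) hyp_neq0 /=.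
  by rewrite andbT gt_eqF// ltr_pwDl// mulr_ge0// ltW.
under eq_fun do rewrite big_ord_recr/= addrA.
have d1 : is_derive v 1 (fun v => binV b v ^+ n.+1 * harmonic n)
    ((n.+1%:R * binV b v ^+ n * (- (b * (hexp v / hyp v)) * binV b v ^+ 2)) * harmonic n
     + binV b v ^+ n.+1 * 0).
  by apply: is_derive_mul; exact: is_derive_pow (is_derive_binV v (ltW b0)).
have := is_derive_add IH d1; move/is_derive_eq; apply.
have n1 : n%:R + 1 != 0 :> R by rewrite natr1 pnatr_eq0.
have w0 : 1 + b * hexp v != 0 by have := binV_gt0 v (ltW b0); rewrite invr_gt0 => /lt0r_neq0.
rewrite /harmonic/= -natr1 !exprS /binV; set W := _ ^+ n.
by field; rewrite hyp_neq0 w0 n1.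
Qed.
End small_time.

Section small_time_limit.
Context {R : realType}.
Local Notation mu := (@lebesgue_measure R).
Local Notation Hl := (`[0, +oo[%classic : set R).
Implicit Types (f g h : R -> R) (a b t v y z : R).

Lemma bernoulli_ge z n : - 1 <= z -> 1 + n%:R * z <= (1 + z) ^+ n.
Proof.
move=> z1; elim: n => [|n IH]; first by rewrite mul0r addr0 expr0.
rewrite exprS -natr1; have n0 : 0 <= n%:R :> R by [].
have z0 : 0 <= 1 + z by lra.
have := ler_wpM2l z0 IH; apply: le_trans; nra.
Qed.

(** With [P = (1 + y / N) ^ N] the difference is [P^-1 (1 - P e^(- y))]. For [x = y / N <= 1],
    raising [(1 + x) e^(- x) >= 1 - x ^ 2] to the power [N] and using Bernoulli's inequality gives
    [P e^(- y) >= 1 - y ^ 2 / N]; for [x > 1] the right-hand side is negative. Grouping the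
    [N = 3 M] factors into three blocks gives [P >= (1 + y / 3) ^ 3 >= (1 + y) ^ 3 / 27]. This cubic
    growth beats [y ^ 2] and leaves decay in [y], which is why [N] is a multiple of 3. *)
Lemma compound_exp_le y M N : 0 <= y -> (0 < M)%N -> N = (3 * M)%N ->
  `|((1 + y / N%:R) ^+ N)^-1 - expR (- y)| <= 27 / N%:R * (y * (1 + y)^-1 ^+ 2).
Proof.
move=> y0 M0 NE; have N0 : 0 < N%:R :> R by rewrite ltr0n NE muln_gt0.
have M1 : 0 < M%:R :> R by rewrite ltr0n.
have x0 : 0 <= y / N%:R by rewrite divr_ge0// ltW.
set x := y / N%:R in x0 *; have yE : y = N%:R * x by rewrite mulrC divfK// gt_eqF.
set P := (1 + x) ^+ N; have P0 : 0 < P by rewrite exprn_gt0// ltr_pwDl.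
have Pe : P * expR (- y) <= 1.
  rewrite expRN ler_pdivrMr ?expR_gt0// mul1r yE expRM_natl lerXn2r ?nnegrE ?expR_ge0 ?addr_ge0//.
  exact: expR_ge1Dx.
have Pl : 1 - y ^+ 2 / N%:R <= P * expR (- y).
  have [xl|xg] := leP x 1; last first.
    apply: (@le_trans _ _ 0); last by rewrite mulr_ge0 ?expR_ge0 ?(ltW P0).
    rewrite subr_le0 ler_pdivlMr// mul1r yE.
    have : 1 <= N%:R :> R by rewrite ler1n NE muln_gt0.
    move: N%:R => n n1; have x2 : 1 <= x ^+ 2 by nra.
    rewrite exprMn; have : n <= n ^+ 2 by nra.
    by have := sqr_ge0 n; nra.
  have ey : expR (- y) = expR (- x) ^+ N by rewrite yE -mulrN expRM_natl.
  rewrite ey /P -exprMn yE.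
  apply: (@le_trans _ _ ((1 - x ^+ 2) ^+ N)).
    have x1 : -1 <= - x ^+ 2 by nra.
    apply: le_trans (bernoulli_ge N x1); rewrite mulrN.
    by rewrite le_eqVlt; apply/orP; left; apply/eqP; field; rewrite gt_eqF.
  have x2 : 0 <= 1 - x ^+ 2 by nra.
  have xx : 1 - x ^+ 2 <= (1 + x) * expR (- x).
    rewrite (_ : 1 - x ^+ 2 = (1 + x) * (1 - x)); last by ring.
    by rewrite ler_wpM2l ?addr_ge0// expR_ge1Dx.
  by apply: lerXn2r => //; rewrite nnegrE// (le_trans x2).
have Pc : (1 + y) ^+ 3 / 27 <= P.
  apply: (@le_trans _ _ ((1 + y / 3) ^+ 3)).
    rewrite (_ : _ / 27 = ((1 + y) / 3) ^+ 3); last by field.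
    by rewrite lerXn2r ?nnegrE ?divr_ge0 ?addr_ge0 ?divr_ge0//; lra.
  rewrite /P NE mulnC exprM lerXn2r ?nnegrE ?exprn_ge0 ?addr_ge0 ?divr_ge0//.
  rewrite (_ : y / 3 = M%:R * x); first by apply: bernoulli_ge; lra.
  by rewrite /x NE natrM; field; rewrite gt_eqF.
have D0 : P^-1 - expR (- y) = P^-1 * (1 - P * expR (- y)).
  by rewrite mulrBr mulr1 mulrA mulVf ?mul1r// gt_eqF.
rewrite D0 ger0_norm; last by rewrite mulr_ge0 ?invr_ge0 ?(ltW P0)// subr_ge0.
apply: (@le_trans _ _ (P^-1 * (y ^+ 2 / N%:R))).
  by rewrite ler_wpM2l ?invr_ge0 ?(ltW P0)//; lra.
have y1 : 0 < 1 + y by rewrite ltr_pwDl.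
rewrite ler_pdivrMl// mulrA ler_pdivrMr//.
apply: (@le_trans _ _ ((1 + y) ^+ 3 / 27 * (27 * (y * (1 + y)^-1 ^+ 2)))); last first.
  rewrite [leRHS](_ : _ = P * (27 * (y * (1 + y)^-1 ^+ 2))); last first.
    by clearbody P; field; rewrite !gt_eqF.
  rewrite ler_wpM2r//; apply: mulr_ge0 => //; apply: mulr_ge0 => //.
  by rewrite exprn_ge0// invr_ge0 ltW.
rewrite (_ : _ * _ = (1 + y) * y); last by field; rewrite gt_eqF.
by rewrite expr2 ler_wpM2r// lerDr.
Qed.

Lemma invx_cvg0 g C : (forall v, 0 < v -> `|g v| <= C / v) -> g v @[v --> +oo] --> 0.
Proof.
move=> gC; apply/cvgr0Pnorm_le => e e0; near=> v.
have v0 : 0 < v by near: v; exact: nbhs_pinfty_gt.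
have Ce : C <= e * v.
  by rewrite mulrC -ler_pdivrMr//; near: v; apply: nbhs_pinfty_ge; rewrite num_real.
by apply: le_trans (gC v v0) _; rewrite ler_pdivrMr.
Unshelve. all: by end_near. Qed.

Lemma binV_le b v : 0 < b -> 0 <= v -> binV b v <= b^-1 / hyp v.
Proof.
move=> b0 v0; have u0 := hexp_gt0 v; have uh := hexp_ge v0; have h0 := hyp_gt0 v.
rewrite -invfM lef_pV2 ?posrE ?mulr_gt0// ?ltr_pwDl ?mulr_ge0 ?ltW//.
by have := ler_wpM2l (ltW b0) uh; lra.
Qed.

Lemma binV_le1 b v : 0 <= b -> binV b v <= 1.
Proof.
move=> b0; rewrite invf_le1; last by have := binV_gt0 v b0; rewrite invr_gt0.
by rewrite lerDl mulr_ge0// ltW// hexp_gt0.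
Qed.

Lemma binV_cvg0 b : 0 < b -> binV b v @[v --> +oo] --> 0.
Proof.
move=> b0; apply: (@invx_cvg0 _ b^-1) => v v0.
rewrite gtr0_norm ?binV_gt0 ?(ltW b0)//; apply: le_trans (binV_le b0 (ltW v0)) _.
by rewrite ler_wpM2l ?invr_ge0 ?(ltW b0)// lef_pV2 ?posrE ?hyp_gt0// hyp_ge.
Qed.

Lemma continuous_divhyp f : continuous f -> continuous (fun v => f v / hyp v).
Proof. by move=> cf v; apply: cvgM; [exact: cf|exact: continuous_hypV]. Qed.

Lemma continuous_binVX b n : 0 <= b -> continuous (fun v => binV b v ^+ n.+1 / hyp v).
Proof.
move=> b0; apply: continuous_divhyp => v.
exact: is_derive_continuous (is_derive_pow _ (is_derive_binV v b0)).
Qed.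

Lemma binVX_le b n v : 0 < b -> 0 <= v -> `|binV b v ^+ n.+1 / hyp v| <= b^-1 / (1 + v ^+ 2).
Proof.
move=> b0 v0; have h0 := hyp_gt0 v; have w0 := binV_gt0 v (ltW b0).
rewrite ger0_norm; last by rewrite divr_ge0 ?exprn_ge0 ?(ltW w0) ?(ltW h0).
rewrite -hyp_sqr expr2 invfM mulrA ler_wpM2r ?invr_ge0 ?(ltW h0)//.
apply: le_trans (binV_le b0 v0); rewrite exprS ler_piMr ?(ltW w0)//.
by rewrite exprn_ile1 ?(ltW w0)// binV_le1// ltW.
Qed.

Lemma binV_integral b n : 0 < b -> \int[mu]_(v in Hl) (binV b v ^+ n.+1 / hyp v) =
  ln (1 + b) - ln b - \sum_(j < n) ((1 + b)^-1 ^+ j.+1 * harmonic j).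
Proof.
move=> b0; have b0' := ltW b0.
apply: etrans (@half_line_FTC R (fun v => binV b v ^+ n.+1 / hyp v)
  (fun v => - ln ((hexp v)^-1 + b) + \sum_(j < n) (binV b v ^+ j.+1 * harmonic j))
  b^-1 (- ln b + 0) _ _ _ _) _; last first.
- rewrite hexp0 invr1 /binV hexp0 mulr1; ring.
- apply: cvgD.
    apply: cvgN; have cl : {for b, continuous (@ln R)} by exact: continuous_ln.
    apply: (@cvg_comp _ _ _ (fun v => (hexp v)^-1 + b) (@ln R) _ (nbhs b)); last exact: cl.
    suff : (hexp v)^-1 + b @[v --> +oo] --> 0 + b by rewrite add0r.
    apply: cvgD; last exact: cvg_cst.
    apply: (@invx_cvg0 _ 1) => v v0; rewrite gtr0_norm ?invr_gt0 ?hexp_gt0// mul1r.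
    by rewrite lef_pV2 ?posrE ?hexp_gt0// (le_trans (hyp_ge v))// hexp_ge// ltW.
  apply: (@invx_cvg0 _ (n%:R * b^-1)) => v v0; have w0 := binV_gt0 v b0'.
  rewrite ger0_norm; last first.
    by apply: sumr_ge0 => j _; rewrite mulr_ge0 ?exprn_ge0 ?(ltW w0)// harmonic_ge0.
  apply: (@le_trans _ _ (\sum_(j < n) (b^-1 / v))); last first.
    by rewrite sumr_const card_ord -mulrA mulr_natl.
  apply: ler_sum => j _; apply: (@le_trans _ _ (binV b v)).
    rewrite exprS -mulrA ler_piMr ?(ltW w0)// mulr_ile1 ?exprn_ge0 ?(ltW w0) ?harmonic_ge0//.
      by rewrite exprn_ile1 ?(ltW w0)// binV_le1.
    by rewrite /harmonic/= invf_le1// ler1n.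
  apply: le_trans (binV_le b0 (ltW v0)) _.
  by rewrite ler_wpM2l ?invr_ge0 ?(ltW b0)// lef_pV2 ?posrE ?hyp_gt0// hyp_ge.
- by move=> v; exact: binVX_le.
- by move=> v; exact: is_derive_binV_prim.
- exact: continuous_binVX.
Qed.

(** The integrand is minus the derivative of [binV a], so the integral is [binV a 0]. With
    [y = a * hexp v] it is the error term [y / (1 + y) ^ 2] of [compound_exp_le] weighted by
    [1 / hyp v], whose integral thus stays bounded as [a] tends to 0. *)
Lemma binV_sqr_integral a : 0 < a ->
  mu.-integrable Hl (EFin \o (fun v => a * (hexp v / hyp v) * binV a v ^+ 2)) /\
  \int[mu]_(v in Hl) (a * (hexp v / hyp v) * binV a v ^+ 2) <= 1.
Proof.
move=> a0; have a0' := ltW a0; set g := (fun v => _).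
have cg : continuous g.
  move=> v; apply: is_derive_continuous; apply: is_derive_mul.
    apply: is_derive_scale; apply: is_derive_mul (is_derive_hexp v) _.
    exact: is_derive_inv (hyp_neq0 v) (is_derive_hyp v).
  exact: is_derive_pow (is_derive_binV v a0').
have gle v : 0 <= v -> `|g v| <= a^-1 / (1 + v ^+ 2).
  move=> v0; have w0 := binV_gt0 v a0'; have h0 := hyp_gt0 v; have u0 := hexp_gt0 v.
  rewrite /g ger0_norm; last by rewrite mulr_ge0 ?exprn_ge0 ?(ltW w0)// mulr_ge0// divr_ge0// ltW.
  have gb : a * (hexp v / hyp v) * binV a v ^+ 2 <= binV a v / hyp v.
    rewrite (_ : _ * _ * _ = (a * hexp v * binV a v) * (binV a v / hyp v)); last by ring.
    rewrite ler_piMl ?divr_ge0 ?(ltW w0) ?(ltW h0)//.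
    by rewrite /binV ler_pdivrMr ?mul1r ?lerDr// ltr_pwDl// mulr_ge0// ltW.
  apply: le_trans gb _; rewrite -hyp_sqr expr2 invfM mulrA.
  by apply: ler_wpM2r; [rewrite invr_ge0 ltW|exact: binV_le].
split; first exact: half_line_integrable gle.
apply: (@le_trans _ _ (- 0 - - binV a 0)); last by rewrite oppr0 sub0r opprK binV_le1.
rewrite le_eqVlt; apply/orP; left; apply/eqP.
apply: (@half_line_FTC R g (fun v => - binV a v) a^-1).
- exact: cg.
- by move=> v; have := is_derive_opp (is_derive_binV v a0'); move/is_derive_eq; apply; rewrite /g; ring.
- exact: gle.
- by apply: cvgN; exact: binV_cvg0.
Qed.

Lemma half_line_dist f g h : mu.-integrable Hl (EFin \o f) -> mu.-integrable Hl (EFin \o g) ->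
  mu.-integrable Hl (EFin \o h) -> (forall v, 0 <= v -> `|f v - g v| <= h v) ->
  `|\int[mu]_(v in Hl) f v - \int[mu]_(v in Hl) g v| <= \int[mu]_(v in Hl) h v.
Proof.
move=> If Ig Ih fgh; rewrite -(RintegralB measurable_half_line If Ig).
have Ifg : mu.-integrable Hl (EFin \o (fun v => f v - g v)).
  by have := integrableB measurable_half_line If Ig; apply: eq_integrable => //; exact: measurable_half_line.
apply: le_trans (le_normr_Rintegral measurable_half_line Ifg) _.
apply: (le_Rintegral measurable_half_line) => //.
  by have := integrable_norm Ifg; apply: eq_integrable => //; exact: measurable_half_line.
by move=> v; rewrite /= in_itv/= andbT => v0; exact: fgh.
Qed.

Lemma expR_lipschitz x y : 0 <= x -> 0 <= y -> `|expR (- x) - expR (- y)| <= `|x - y|.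
Proof.
wlog xy : x y / x <= y => [H x0 y0|x0 y0].
  by have [|/ltW] := leP x y => xy; [exact: H|rewrite distrC [leRHS]distrC; exact: H].
rewrite ger0_norm ?subr_ge0 ?ler_expR ?lerN2// ler0_norm ?subr_le0//.
have -> : expR (- y) = expR (- x) * expR (x - y) by rewrite -expRD; congr expR; ring.
have e1 : expR (- x) <= 1 by rewrite expR_le1 oppr_le0.
have e0 := expR_ge0 (- x); have := expR_ge1Dx (x - y); nra.
Qed.

(** At [t = 2 / N] the exponent [t * phase v] is close to [hexp v / N], and [compound_exp_le]
    compares the exponential of the latter with [binV b v ^ N] for [b = 1 / N ^ 2]; the term
    [- ln b] supplies [2 ln N]. The errors, in units of [1 / N], are 27 from the exponential, [pi]
    from [phase_hexp], 1 from [ln (1 + b)], and 1 from replacing the powers of [1 / (1 + b)] by 1 in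
    the harmonic sum. *)
Lemma steepI01_dist M N : (0 < M)%N -> N = (3 * M)%N ->
  `|steepI 0 1 (2 / N%:R) - (2 * ln N%:R - series harmonic N.-1)| <= (pi + 29) / N%:R :> R.
Proof.
move=> M0 NE; have N0 : (0 < N)%N by rewrite NE muln_gt0.
have NR : 0 < N%:R :> R by rewrite ltr0n.
have NR1 : 1 <= N%:R :> R by rewrite ler1n.
pose a : R := N%:R^-1; pose b := a / N%:R.
have a0 : 0 < a by rewrite invr_gt0. have b0 : 0 < b by rewrite divr_gt0.
have t0 : 0 < 2 / N%:R :> R by rewrite divr_gt0.
have [Iq q1] := binV_sqr_integral a0.
have IE : mu.-integrable Hl (EFin \o (fun v => binV b v ^+ N / hyp v)).
  rewrite -(prednK N0); apply: (@half_line_integrable _ _ b^-1).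
    exact: continuous_binVX (ltW b0).
  by move=> v v0; exact: binVX_le.
have [Ih hE] := integrable_scaleD (27 / N%:R) Iq (@integrable_oneDsqrVZ R (2 / N%:R)).
have H := half_line_dist (steep_integrable 0 1 t0) IE Ih _.
have : `|steepI 0 1 (2 / N%:R) - \int[mu]_(v in Hl) (binV b v ^+ N / hyp v)| <=
    27 / N%:R + pi / N%:R.
  apply: le_trans (H _) _.
    move=> v v0; have h0 := hyp_gt0 v; have u0 := hexp_gt0 v.
    rewrite /steep expr0 mul1r expr1 -mulrBl normrM [`|_^-1|]gtr0_norm ?invr_gt0//.
    set y := a * hexp v; have y0 : 0 <= y by rewrite mulr_ge0 ?ltW.
    have -> : 27 / N%:R * (a * (hexp v / hyp v) * binV a v ^+ 2) + 2 / N%:R / (1 + v ^+ 2) =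
        (27 / N%:R * (y * (1 + y)^-1 ^+ 2) + 2 / N%:R / hyp v) / hyp v.
      by rewrite -hyp_sqr /binV -/y /y; field; rewrite !gt_eqF ?addr_gt0 ?mulr_gt0.
    rewrite ler_wpM2r ?invr_ge0 ?(ltW h0)//.
    set E1 := expR (- (_ * phase v)); set W := binV b v ^+ N.
    rewrite (_ : E1 - W = (E1 - expR (- y)) + (expR (- y) - W)) 1?[leRHS]addrC; last by ring.
    apply: le_trans (ler_normD _ _) _; apply: lerD; last first.
      have -> : W = ((1 + y / N%:R) ^+ N)^-1.
        by rewrite /W /binV exprVn (_ : b * hexp v = y / N%:R)// /b /y; ring.
      by rewrite distrC; exact: (compound_exp_le y0 M0 NE).
    apply: le_trans (expR_lipschitz _ _) _ => //; first by rewrite mulr_ge0 ?phase_ge0 ?ltW.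
    have -> : 2 / N%:R * phase v - y = 2 / N%:R * (phase v - hexp v / 2) by rewrite /y /a; field; rewrite gt_eqF.
    by rewrite normrM gtr0_norm// ler_wpM2l ?(ltW t0)// phase_hexp.
  rewrite hE (_ : \int[mu]_(v in Hl) (2 / N%:R / (1 + v ^+ 2)) = pi / N%:R); last first.
    rewrite (RintegralZl _ measurable_half_line (@integrable_oneDsqrV R)) Rintegral_oneDsqrV.
    by field; rewrite gt_eqF.
  by rewrite lerD2r -[leRHS]mulr1 ler_wpM2l// divr_ge0// ltW.
rewrite -{2}(prednK N0) binV_integral//.
have lb : 0 <= ln (1 + b) <= b.
  rewrite ln_ge0 ?lerDl ?(ltW b0)//=; have := @le_ln1Dx R b; apply; lra.
have bN : b <= a by rewrite /b ler_pdivrMr// -[leLHS]mulr1 ler_wpM2l ?(ltW a0).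
have lnb : ln b = - (2 * ln N%:R).
  rewrite /b /a ln_div ?posrE ?invr_gt0// lnV ?posrE//; ring.
have sm : 0 <= series harmonic N.-1 - \sum_(j < N.-1) ((1 + b)^-1 ^+ j.+1 * harmonic j) <= a.
  rewrite /series/= big_mkord -sumrB; apply/andP; split.
    apply: sumr_ge0 => j _; rewrite subr_ge0 ler_piMl ?invr_ge0//.
    by rewrite exprn_ile1 ?invr_ge0 ?invf_le1 ?addr_ge0 ?ltr_pwDl ?lerDl ?(ltW b0).
  apply: (@le_trans _ _ (\sum_(j < N.-1) b)).
    apply: ler_sum => j _; rewrite -[X in X - _]mul1r -mulrBl.
    have bb : 1 - b <= (1 + b)^-1 by rewrite -[leRHS]mul1r ler_pdivlMr ?ltr_pwDl ?(ltW b0)//; nra.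
    have b1 : 0 <= 1 - b.
      by rewrite subr_ge0 (le_trans bN)// /a invf_le1.
    have : 1 + j.+1%:R * - b <= (1 + b)^-1 ^+ j.+1.
      apply: le_trans (_ : (1 - b) ^+ j.+1 <= _); first by apply: bernoulli_ge; lra.
      by rewrite lerXn2r ?nnegrE// invr_ge0 addr_ge0 ?(ltW b0).
    rewrite ler_pdivrMr ?ltr0n//; lra.
  rewrite sumr_const card_ord -mulr_natl /b mulrCA ler_piMr ?(ltW a0)//.
  by rewrite ler_pdivrMr// mul1r ler_nat leq_pred.
rewrite lnb -/a => /ler_normlP[H1 H2]; move: lb sm => /andP[l1 l2] /andP[s1 s2].
rewrite -/a.
apply/ler_normlP; split; lra.
Qed.

(** [euler_gamma] is a [limn], meaningful only once the sequence is known to converge. From index 1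
    on it is nonincreasing and nonnegative, by [1 / (n + 2) <= ln (1 + 1 / (n + 1)) <= 1 / (n + 1)].
    The shift discards index 0, where [ln 0] is a convention. *)
Lemma euler_gamma_cvg : series harmonic n - ln n%:R @[n --> \oo] --> (euler_gamma : R).
Proof.
suff /cvg_ex[l h] : cvgn (fun n => series harmonic n.+1 - ln n.+1%:R : R).
  by move: h; rewrite (cvg_shiftS (fun n => series harmonic n - ln n%:R : R)) => /cvgP.
have lnS n : ln n.+2%:R - ln n.+1%:R = ln (1 + (n.+1%:R)^-1) :> R.
  rewrite -ln_div ?posrE ?ltr0n//; congr ln.
  by rewrite -[n.+2%:R]natr1 mulrDl mulfV ?pnatr_eq0// mul1r.
have lnl n : ln (1 + (n.+1%:R)^-1) <= (n.+1%:R)^-1 :> R.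
  by apply: le_ln1Dx; rewrite (lt_le_trans (ltrN10 _))// invr_ge0.
apply: nonincreasing_is_cvgn.
  apply/nonincreasing_seqP => n /=.
  rewrite /series/= [in leLHS]big_nat_recr//= /harmonic/=.
  set S := \sum_(0 <= i < n.+1) _; have l2 := lnS n.
  have : (n.+2%:R)^-1 <= ln (1 + (n.+1%:R)^-1) :> R.
    have n0 : 0 < n.+1%:R :> R by rewrite ltr0n.
    rewrite -[leRHS]opprK -lnV ?posrE ?addr_gt0 ?invr_gt0// lerNr.
    have -> : (1 + n.+1%:R^-1)^-1 = 1 + - n.+2%:R^-1 :> R.
      by rewrite -[n.+2%:R]natr1; move: n.+1%:R n0 => m m0; field; rewrite !gt_eqF//; lra.
    apply: le_ln1Dx; rewrite ltrN2 invf_lt1 ?ltr0n// ltr1n//.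
  by rewrite -l2; move: (ln _) (ln _) (_^-1) S => p q r S; lra.
exists 0 => _ [n _ <-] /=; rewrite subr_ge0.
apply: (@le_trans _ _ (series harmonic n)); last first.
  by rewrite /series/= big_nat_recr//= lerDl invr_ge0.
elim: n => [|n IH]; first by rewrite ln1 /series/= big_nil.
have l1 := lnS n; have l2 := lnl n.
rewrite /series/= big_nat_recr//= -[leLHS](subrK (ln n.+1%:R)) l1 addrC; exact: lerD.
Qed.

End small_time_limit.

(** * Identification with the Hankel function *)

Section bessel_equation.
Context {R : realType}.
Implicit Types (t : R) (y z : R -> R).

Lemma limn_unique (u : nat -> R) (a b : R) :
  u n @[n --> \oo] --> a -> u n @[n --> \oo] --> b -> a = b.
Proof.
move=> ua ub; have ea : limn u = a by exact: (cvg_lim (@Rhausdorff R) ua).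
by rewrite -ea; exact: (cvg_lim (@Rhausdorff R) ub).
Qed.

(* [z] stands for [t * y'(t)], so that Bessel's equation reads [z' = - t * y]. *)
Definition bessel_sol y z := forall t, 0 < t ->
  is_derive t 1 y (z t / t) /\ is_derive t 1 z (- (t * y t)).

Lemma bessel_sol_lin (a b : R) y1 z1 y2 z2 : bessel_sol y1 z1 -> bessel_sol y2 z2 ->
  bessel_sol (fun t => a * y1 t + b * y2 t) (fun t => a * z1 t + b * z2 t).
Proof.
move=> s1 s2 t t0; have [dy1 dz1] := s1 t t0; have [dy2 dz2] := s2 t t0; split.
  have := is_derive_add (is_derive_scale a dy1) (is_derive_scale b dy2).
  by move/is_derive_eq; apply; rewrite mulrDl !mulrA.
have := is_derive_add (is_derive_scale a dz1) (is_derive_scale b dz2).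
by move/is_derive_eq; apply; ring.
Qed.

(** Precomposition with [expR] carries the open half-line to the whole line, where a vanishing
    derivative forces constancy. *)
Lemma pos_derive0_cst f t1 t2 : (forall t, 0 < t -> is_derive t 1 f 0) ->
  0 < t1 -> 0 < t2 -> f t1 = f t2 :> R.
Proof.
move=> f0 t10 t20; rewrite -(@lnK _ t1) ?posrE// -(@lnK _ t2) ?posrE//.
apply: (@is_derive_0_is_cst _ (f \o expR)) => x.
by rewrite -(mul0r (expR x)); apply: is_derive1_comp; exact: (f0 _ (expR_gt0 x)).
Qed.

(** As [z] stands for [t * y'], the expression is [t] times the Wronskian; this is Abel's
    identity. *)
Lemma wronskian_cst y1 z1 y2 z2 t1 t2 : bessel_sol y1 z1 -> bessel_sol y2 z2 ->
  0 < t1 -> 0 < t2 -> y1 t1 * z2 t1 - z1 t1 * y2 t1 = y1 t2 * z2 t2 - z1 t2 * y2 t2.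
Proof.
move=> s1 s2; apply: (@pos_derive0_cst (fun t => y1 t * z2 t - z1 t * y2 t)) => t t0.
have [dy1 dz1] := s1 t t0; have [dy2 dz2] := s2 t t0.
have := is_derive_add (is_derive_mul dy1 dz2) (is_derive_opp (is_derive_mul dz1 dy2)).
by move/is_derive_eq; apply; ring.
Qed.

Definition quad t : R := t ^+ 2 / 4.

Lemma is_derive_quad t : is_derive t 1 quad (t / 2).
Proof.
have := is_derive_mul (is_derive_pow 2 (is_derive_id t 1)) (is_derive_cst (4^-1 : R) t 1).
by move/is_derive_eq; apply; rewrite mulr0 addr0 /= expr1 mulr1; field.
Qed.

Definition pserq (c : nat -> R) t : R := pser c (quad t).

Lemma is_derive_pserq c t : entire c -> is_derive t 1 (pserq c) (pserq (pseries_diffs c) t * (t / 2)).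
Proof. by move=> ec; exact: is_derive1_comp (is_derive_pser _ ec) (is_derive_quad t). Qed.

Lemma pserq0 c : entire c -> pserq c 0 = c 0%N.
Proof. by move=> ec; rewrite /pserq /quad expr0n/= mul0r pser0. Qed.

Lemma continuous_pserq c : entire c -> continuous (pserq c).
Proof. by move=> ec t; exact: is_derive_continuous (is_derive_pserq t ec). Qed.

(** This is [t] times the derivative of [pserq c], the companion that [bessel_sol] asks for. *)
Definition pserz (c : nat -> R) t : R := 2 * quad t * pserq (pseries_diffs c) t.

Lemma is_derive_pserz c t : entire c -> is_derive t 1 (pserz c)
  (t * (pser (pseries_diffs c) (quad t) +
    quad t * pser (pseries_diffs (pseries_diffs c)) (quad t))).
Proof.
move=> ec; have := is_derive_mul (is_derive_scale 2 (is_derive_quad t))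
  (is_derive_pserq t (entire_diffs ec)).
by move/is_derive_eq; apply; rewrite /pserq; field.
Qed.

(* [bessel_Y] is [pi / 2 * Y_0]; the functions named [bessel_z*] are [t] times the derivatives. *)
Definition bessel_J : R -> R := pserq j0_coef.
Local Notation J := bessel_J.
Definition bessel_zJ : R -> R := pserz j0_coef.
Local Notation zJ := bessel_zJ.
Definition bessel_L : R -> R := pserq y0_coef.
Local Notation L := bessel_L.
Definition bessel_zL : R -> R := pserz y0_coef.
Local Notation zL := bessel_zL.
Definition bessel_Y t : R := (ln (t / 2) + euler_gamma) * J t - L t.
Definition bessel_zY t : R := J t + (ln (t / 2) + euler_gamma) * zJ t - zL t.
Local Notation Y := bessel_Y.
Local Notation zY := bessel_zY.

Lemma bessel_sol_J : bessel_sol J zJ.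
Proof.
move=> t t0; split.
  have := is_derive_pserq t (@entire_j0 R); move/is_derive_eq; apply.
  by rewrite /zJ /pserz /quad; field; rewrite gt_eqF.
have := is_derive_pserz t (@entire_j0 R); move/is_derive_eq; apply.
by rewrite j0_coef_rec mulrN.
Qed.

Lemma bessel_sol_Y : bessel_sol Y zY.
Proof.
move=> t t0; have [dJ dz] := bessel_sol_J t0.
have t2 : 0 < t / 2 by rewrite divr_gt0.
have dl : is_derive t 1 (fun t => ln (t / 2) + euler_gamma) (t^-1).
  have d2 : is_derive t 1 (fun t => t / 2) (2^-1).
    have := is_derive_mul (is_derive_id t 1) (is_derive_cst (2^-1 : R) t 1).
    by move/is_derive_eq; apply; rewrite mulr0 addr0 mul1r.
  have := is_derive_add (@is_derive_ln_comp R (fun t => t / 2) t _ t2 d2) (is_derive_cst (euler_gamma : R) t 1).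
  by move/is_derive_eq; apply; field; rewrite gt_eqF.
split.
  have := is_derive_add (is_derive_mul dl dJ) (is_derive_opp (is_derive_pserq t (@entire_y0 R))).
  move/is_derive_eq; apply; rewrite /zY /zL /pserz /quad; field; rewrite gt_eqF//.
have := is_derive_add (is_derive_add dJ (is_derive_mul dl dz))
  (is_derive_opp (is_derive_pserz t (@entire_y0 R))).
move/is_derive_eq; apply; rewrite y0_coef_rec /Y /zJ /J /L /pserz /pserq /quad.
by field; rewrite gt_eqF.
Qed.

(** The logarithms cancel identically and leave a function [e] continuous at 0 with
    [e 0 = J 0 ^ 2 = 1]. The constant value equals the limit of [e] along the positive points
    [harmonic n], which tend to 0. *)
Lemma bessel_wronskian t : 0 < t -> J t * zY t - zJ t * Y t = 1.
Proof.
move=> t0; pose e t := J t * J t - J t * zL t + zJ t * L t.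
have eE s : J s * zY s - zJ s * Y s = e s by rewrite /zY /Y /e; ring.
have ce : continuous e.
  have cJ := continuous_pserq (@entire_j0 R); have cL := continuous_pserq (@entire_y0 R).
  have cz c : entire c -> continuous (pserz c).
    by move=> ec s; exact: is_derive_continuous (is_derive_pserz s ec).
  move=> s; apply: cvgD; last by apply: cvgM; [exact: cz (@entire_j0 R) s|exact: cL].
  apply: cvgB; last by apply: cvgM; [exact: cJ|exact: cz (@entire_y0 R) s].
  by apply: cvgM; exact: cJ.
have e0 : e 0 = 1.
  rewrite /e /zL /zJ /pserz /quad expr0n/= !(mul0r, mulr0) subr0 addr0 /J (pserq0 (@entire_j0 R)).
  by rewrite /j0_coef expr0 fact0 expr1n divr1 mulr1.
rewrite eE -e0; have ln : e (harmonic n) @[n --> \oo] --> e 0.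
  by apply: (cvg_comp harmonic e); [exact: cvg_harmonic|exact: ce].
apply: (@cvg_unique _ _ (e (harmonic n) @[n --> \oo])) => //.
rewrite (_ : (fun n => e (harmonic n)) = cst (e t)); first exact: cvg_cst.
apply/funext => n; rewrite -!eE.
by apply: (wronskian_cst bessel_sol_J bessel_sol_Y) => //; exact: harmonic_gt0.
Qed.

(** Multiples of 3, as [steepI01_dist] demands. At the time [2 / N] the logarithm [ln (t / 2)] in
    [bessel_Y] is exactly [- ln N]. *)
Definition nodes (n : nat) : nat := (3 * n.+1)%N.
Definition times n : R := 2 / (nodes n)%:R.

Lemma nodes_gt0 n : 0 < (nodes n)%:R :> R.
Proof. by rewrite ltr0n /nodes muln_gt0. Qed.

Lemma times_gt0 n : 0 < times n.
Proof. by rewrite divr_gt0// nodes_gt0. Qed.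

Lemma cvg_nodes : nodes n @[n --> \oo] --> \oo.
Proof.
move=> P [m _ mP]; exists m => // n /= mn; apply: mP => /=.
by rewrite (leq_trans mn)// /nodes (leq_trans (leqnSn n))// leq_pmull.
Qed.

Lemma cvg_nodesV : ((nodes n)%:R)^-1 @[n --> \oo] --> (0 : R).
Proof.
apply: (squeeze_cvgr _ (cvg_cst (0 : R)) (@cvg_harmonic R)).
apply: nearW => n; rewrite invr_ge0 ltW ?nodes_gt0//= /harmonic/=.
by rewrite lef_pV2 ?posrE ?nodes_gt0 ?ltr0n// ler_nat /nodes leq_pmull.
Qed.

Lemma cvg_times : times n @[n --> \oo] --> (0 : R).
Proof. by rewrite -[X in _ --> X](mulr0 2); apply: cvgMr; exact: cvg_nodesV. Qed.

(** From [ln N = 2 ln (sqrt N) <= 2 sqrt N], the quotient is at most [2 / sqrt N]. *)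
Lemma ln_nodes_cvg : ln (nodes n)%:R * ((nodes n)%:R)^-1 @[n --> \oo] --> (0 : R).
Proof.
have s0 : 2 * Num.sqrt ((nodes n)%:R^-1) @[n --> \oo] --> (0 : R).
  rewrite -[0 in X in _ --> X](mulr0 2); apply: cvgMr.
  by have := cvg_comp _ _ cvg_nodesV (@sqrt_continuous R 0); rewrite sqrtr0.
apply: (squeeze_cvgr _ (cvg_cst (0 : R)) s0).
apply: nearW => n /=; have N0 := nodes_gt0 n.
have N1 : 1 <= (nodes n)%:R :> R by rewrite ler1n /nodes muln_gt0.
rewrite mulr_ge0 ?ln_ge0 ?invr_ge0 ?(ltW N0)//=.
rewrite -{1}(sqr_sqrtr (ltW N0)) lnXn ?sqrtr_gt0// sqrtrV ?(ltW N0)//.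
set r := Num.sqrt _; have r0 : 0 < r by rewrite sqrtr_gt0.
have -> : (nodes n)%:R = r ^+ 2 by rewrite sqr_sqrtr ?(ltW N0).
have lr : ln r <= r by have := @le_ln1Dx R (r - 1); rewrite (_ : 1 + (r - 1) = r); [lra|ring].
rewrite ler_pdivrMr ?exprn_gt0// (_ : 2 / r * r ^+ 2 = 2 * r); last by field; rewrite gt_eqF.
by rewrite mulr2n; lra.
Qed.

Lemma ln_times n : ln (times n / 2) = - ln (nodes n)%:R.
Proof. by rewrite /times mulrAC mulfV// mul1r lnV// posrE nodes_gt0. Qed.

Lemma ln_nodes_cvgy : ln (nodes n)%:R - euler_gamma @[n --> \oo] --> (+oo : set_system R).
Proof.
apply/cvgryPge => A; pose B := A + euler_gamma.
have [m mA] : exists m : nat, expR B <= m%:R.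
  by exists (Num.trunc (expR B)).+1; rewrite ltW// truncnS_gt.
exists m => // n /= mn; rewrite lerBrDr -/B -[B]expRK ler_ln ?posrE ?expR_gt0 ?nodes_gt0//.
by rewrite (le_trans mA)// ler_nat (leq_trans mn)// /nodes (leq_trans (leqnSn n))// leq_pmull.
Qed.

Lemma inv_ln_times_cvg : (ln (times n / 2) + euler_gamma)^-1 @[n --> \oo] --> (0 : R).
Proof.
rewrite (_ : (fun n => _) = fun n => - (ln (nodes n)%:R - euler_gamma)^-1); last first.
  by apply/funext => n; rewrite ln_times -invrN; congr (_^-1); ring.
rewrite -oppr0; apply: cvgN; apply/gtr0_cvgV0; last exact: ln_nodes_cvgy.
by have /cvgryPgt/(_ 0) := ln_nodes_cvgy.
Qed.

(* Write [y = a J - b Y]: the logarithm in [Y] forces [b = 0], and then [J 0 = 1] forces [a = 0]. *)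
Lemma bessel_sol_eq0 y z t : bessel_sol y z -> y (times n) @[n --> \oo] --> 0 ->
  0 < t -> y t = 0.
Proof.
move=> s y0 t0.
(* Cramer's rule: the Wronskians of [y] with [Y] and with [J] are constant, and the determinant of
   the pair is 1 by [bessel_wronskian]. *)
pose a := y 1 * zY 1 - z 1 * Y 1; pose b := y 1 * zJ 1 - z 1 * J 1.
have yE u : 0 < u -> y u = a * J u - b * Y u.
  move=> u0; rewrite -[LHS]mulr1 -(bessel_wronskian u0).
  have -> : a = y u * zY u - z u * Y u by exact: (wronskian_cst s bessel_sol_Y).
  have -> : b = y u * zJ u - z u * J u by exact: (wronskian_cst s bessel_sol_J).
  ring.
have cJ : J (times n) @[n --> \oo] --> (1 : R).
  have <- : J 0 = 1 by rewrite /J pserq0 ?/j0_coef ?expr0 ?fact0 ?expr1n ?divr1//; exact: entire_j0.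
  by apply: (cvg_comp _ _ cvg_times); exact: continuous_pserq (@entire_j0 R) _.
have cL : L (times n) @[n --> \oo] --> (0 : R).
  have <- : L 0 = 0.
    by rewrite /L pserq0 ?/y0_coef /series/= ?big_nil ?mulr0 ?mul0r//; exact: entire_y0.
  by apply: (cvg_comp _ _ cvg_times); exact: continuous_pserq (@entire_y0 R) _.
pose l n : R := ln (times n / 2) + euler_gamma.
have cl : (l n)^-1 @[n --> \oo] --> (0 : R) := inv_ln_times_cvg.
have b0 : b = 0.
  have h1 : (l n)^-1 * y (times n) @[n --> \oo] --> (0 : R) * 0 by exact: cvgM.
  (* The relation [y = a J - b Y] divided by the divergent [l n]: the expression vanishes as soon as
     [l n] is nonzero, while its limit is [- b]. *)
  have h2 : a * ((l n)^-1 * J (times n)) - b * (J (times n) - (l n)^-1 * L (times n)) -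
      (l n)^-1 * y (times n) @[n --> \oo] --> a * (0 * 1) - b * (1 - 0 * 0) - 0 * 0.
    apply: cvgB => //; apply: cvgB; apply: cvgMr; first exact: cvgM.
    by apply: cvgB => //; exact: cvgM.
  have h3 : a * ((l n)^-1 * J (times n)) - b * (J (times n) - (l n)^-1 * L (times n)) -
      (l n)^-1 * y (times n) @[n --> \oo] --> (0 : R).
    apply: (@cvg_trans _ (cst (0 : R) @ \oo)); last exact: cvg_cst.
    apply: near_eq_cvg.
    have l0 : \forall n \near \oo, l n != 0.
      have /cvgryPgt/(_ 0) := ln_nodes_cvgy; apply: filterS => n.
      by move=> h; rewrite /l ln_times; apply: ltr0_neq0; lra.
    near=> n; rewrite yE ?times_gt0// /Y -/(l n) /=.
    by field; near: n.
  have := limn_unique h2 h3; rewrite !(mul0r, mulr0, subr0, mulr1, sub0r) => /eqP.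
  by rewrite oppr_eq0 => /eqP.
have a0 : a = 0.
  have h1 : a * J (times n) @[n --> \oo] --> a * (1 : R) by exact: cvgMr.
  have h2 : a * J (times n) @[n --> \oo] --> (0 : R).
    by move: y0; under eq_fun do [rewrite yE ?times_gt0// b0 mul0r subr0].
  by have := limn_unique h1 h2; rewrite mulr1.
by rewrite yE// a0 b0 !mul0r subr0.
Unshelve. all: by end_near. Qed.

End bessel_equation.

(** * Comparison of the integrals with [J_0] and [Y_0] *)

Section hankel_steep.
Context {R : realType}.
Local Notation mu := (@lebesgue_measure R).
Local Notation Hl := (`[0, +oo[%classic : set R).
Implicit Types (t x y : R).

Lemma cvgn_eq (u v : nat -> R) (a b : R) :
  (forall n, u n = v n) -> a = b -> u n @[n --> \oo] --> a -> v n @[n --> \oo] --> b.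
Proof. by move=> /funext -> ->. Qed.

Lemma derive_lipschitz1 (f df : R -> R) x y : (forall x, is_derive x 1 f (df x)) ->
  (forall x, `|df x| <= 1) -> `|f x - f y| <= `|x - y|.
Proof.
move=> fd df1; wlog xy : x y / x <= y => [H|].
  by have [|/ltW] := leP x y => xy; [exact: H|rewrite distrC [leRHS]distrC; exact: H].
have [c _ fc] := @MVT_segment R f df x y xy (fun x _ => fd x)
  (continuous_subspaceT (derive_continuous fd)).
by rewrite distrC fc normrM [leRHS]distrC ler_piMl.
Qed.

Lemma cos_lipschitz x y : `|cos x - cos y| <= `|x - y|.
Proof.
apply: (@derive_lipschitz1 cos (fun x => - sin x)) => z.
by rewrite normrN ler_norml sin_geN1 sin_le1.
Qed.

Lemma sin_lipschitz x y : `|sin x - sin y| <= `|x - y|.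
Proof.
apply: (@derive_lipschitz1 sin cos) => z.
by rewrite ler_norml cos_geN1 cos_le1.
Qed.

(* Real and imaginary parts of [e^(i t) (steepI 0 2 t - i steepI 0 1 t)]; [steep_re'] and
   [steep_im'] are [t] times their derivatives. *)
Definition steep_re t : R := cos t * steepI 0 2 t + sin t * steepI 0 1 t.
Definition steep_im t : R := sin t * steepI 0 2 t - cos t * steepI 0 1 t.

Definition steep_re' t : R := t * (- (cos t * steepI 1 2 t) - sin t * steepI 0 2 t
  - sin t * steepI 1 1 t + cos t * steepI 0 1 t).
Definition steep_im' t : R := t * (cos t * steepI 0 2 t - sin t * steepI 1 2 t
  + sin t * steepI 0 1 t + cos t * steepI 1 1 t).

(** The identities [steep_ode_re] and [steep_ode_im], solved for [steepI 0 1 t] and [steepI 0 2 t],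
    reduce Bessel's equation to a ring identity in [cos t], [sin t] and the remaining integrals. *)
Lemma bessel_sol_re : bessel_sol steep_re steep_re'.
Proof.
move=> t t0; have dc := is_derive_cos t; have ds := is_derive_sin t.
have dI k m := @is_derive_steepI R k m t t0.
have o1 := steep_ode_re t0; have o2 := steep_ode_im t0; split.
  have := is_derive_add (is_derive_mul dc (dI 0%N 2%N)) (is_derive_mul ds (dI 0%N 1%N)).
  by move/is_derive_eq; apply; rewrite /steep_re'; field; rewrite gt_eqF.
have := is_derive_mul (is_derive_id t 1) (is_derive_add (is_derive_add (is_derive_add
  (is_derive_opp (is_derive_mul dc (dI 1%N 2%N))) (is_derive_opp (is_derive_mul ds (dI 0%N 2%N))))
  (is_derive_opp (is_derive_mul ds (dI 1%N 1%N)))) (is_derive_mul dc (dI 0%N 1%N))).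
move/is_derive_eq; apply; rewrite /steep_re /=.
have e1 : steepI 0 1 t = - (t * steepI 2 2 t) + 2 * t * steepI 1 1 t + steepI 1 2 t by lra.
have e2 : steepI 0 2 t = t * steepI 2 1 t + 2 * t * steepI 1 2 t - steepI 1 1 t by lra.
rewrite e1 e2; ring.
Qed.

Lemma bessel_sol_im : bessel_sol steep_im steep_im'.
Proof.
move=> t t0; have dc := is_derive_cos t; have ds := is_derive_sin t.
have dI k m := @is_derive_steepI R k m t t0.
have o1 := steep_ode_re t0; have o2 := steep_ode_im t0; split.
  have := is_derive_add (is_derive_mul ds (dI 0%N 2%N))
    (is_derive_opp (is_derive_mul dc (dI 0%N 1%N))).
  by move/is_derive_eq; apply; rewrite /steep_im'; field; rewrite gt_eqF.
have := is_derive_mul (is_derive_id t 1) (is_derive_add (is_derive_add (is_derive_add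
  (is_derive_mul dc (dI 0%N 2%N)) (is_derive_opp (is_derive_mul ds (dI 1%N 2%N))))
  (is_derive_mul ds (dI 0%N 1%N))) (is_derive_mul dc (dI 1%N 1%N))).
move/is_derive_eq; apply; rewrite /steep_im /=.
have e1 : steepI 0 1 t = - (t * steepI 2 2 t) + 2 * t * steepI 1 1 t + steepI 1 2 t by lra.
have e2 : steepI 0 2 t = t * steepI 2 1 t + 2 * t * steepI 1 2 t - steepI 1 1 t by lra.
rewrite e1 e2; ring.
Qed.

Lemma steepI02_cvg : steepI 0 2 (times n) @[n --> \oo] --> (pi / 2 : R).
Proof.
rewrite /steepI /Rintegral.
have -> : pi / 2 = fine (\int[mu]_(v in Hl) ((1 + v ^+ 2)^-1)%:E)%E :> R.
  by have := @Rintegral_oneDsqrV R; rewrite /Rintegral => ->.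
apply: fine_cvg; rewrite fineK; last first.
  by rewrite integral0y_oneDsqr.
apply: (dominated_cvg (@measurable_half_line R) (g := fun v : R => ((1 + v ^+ 2)^-1)%:E)).
- move=> n; apply/measurable_EFinP; apply: continuous_measurable; first exact: measurable_half_line.
  exact: continuous_steep.
- move=> v _; apply: cvg_EFin; first exact: nearW.
  rewrite /comp /= /steep -hyp_sqr.
  have -> : (hyp v ^+ 2)^-1 = 1 * expR (- (0 * phase v)) * (hyp v)^-1 ^+ 2.
    by rewrite mul0r oppr0 expR0 !mul1r exprVn.
  apply: cvgMl; rewrite expr0; apply: cvgMr.
  apply: (cvg_comp _ (@expR R)); last exact: continuous_expR.
  by apply: cvgN; apply: cvgMl; exact: cvg_times.
- by [].
- exact: integrable_oneDsqrV.
- move=> n v _; rewrite lee_fin ger0_norm ?steep_ge0// /steep expr0 mul1r exprVn hyp_sqr.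
  rewrite ler_piMl ?invr_ge0 ?addr_ge0 ?sqr_ge0// expR_le1 oppr_le0 mulr_ge0 ?phase_ge0//.
  by rewrite ltW// times_gt0.
Qed.

(** By [steepI01_dist] the difference is close to [ln N - H_(N-1)], that is, to
    [1 / N - (H_N - ln N)]. *)
Lemma steepI01_cvg : steepI 0 1 (times n) - ln (nodes n)%:R @[n --> \oo] --> - (euler_gamma : R).
Proof.
have h1 : ((nodes n)%:R)^-1 - (series harmonic (nodes n) - ln (nodes n)%:R) @[n --> \oo] --> 0 - (euler_gamma : R).
  by apply: cvgB; [exact: cvg_nodesV|exact: (cvg_comp _ _ cvg_nodes euler_gamma_cvg)].
pose r n : R := steepI 0 1 (times n) - (2 * ln (nodes n)%:R - series harmonic (nodes n).-1).
have h2 : r n @[n --> \oo] --> (0 : R).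
  have h3 : (pi + 29) * ((nodes n)%:R)^-1 @[n --> \oo] --> (0 : R).
    by rewrite -[0 in X in _ --> X](mulr0 (pi + 29)); apply: cvgMr; exact: cvg_nodesV.
  apply: norm_cvg0; apply: (squeeze_cvgr _ (cvg_cst (0 : R)) h3); apply: nearW => n.
  by rewrite normr_ge0/=; exact: (@steepI01_dist R n.+1).
apply: cvgn_eq (cvgD h2 h1); last by rewrite add0r sub0r.
move=> n; rewrite /r.
have -> : series harmonic (nodes n) = series harmonic (nodes n).-1 + ((nodes n)%:R)^-1 :> R.
  have N0 : (0 < nodes n)%N by rewrite /nodes muln_gt0.
  by rewrite -{1 3}(prednK N0) /series/= big_nat_recr.
ring.
Qed.

(** [steepI 0 1] grows only like [ln N], and [|sin t| <= t = 2 / N], so the product is governed by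
    [ln N / N]. *)
Lemma steepI01_sin_cvg : sin (times n) * steepI 0 1 (times n) @[n --> \oo] --> (0 : R).
Proof.
have h1 : times n * (steepI 0 1 (times n) - ln (nodes n)%:R) + 2 * (ln (nodes n)%:R * ((nodes n)%:R)^-1)
    @[n --> \oo] --> 0 * - (euler_gamma : R) + 2 * 0.
  apply: cvgD; first exact: cvgM cvg_times steepI01_cvg.
  by apply: cvgMr; exact: ln_nodes_cvg.
apply: norm_cvg0; apply: (squeeze_cvgr _ (cvg_cst (0 : R))); last first.
  by move: h1; rewrite mul0r mulr0 addr0; exact.
apply: nearW => n; rewrite normr_ge0/= normrM (ger0_norm (steepI_ge0 _ _ _)).
have -> : times n * (steepI 0 1 (times n) - ln (nodes n)%:R) + 2 * (ln (nodes n)%:R * ((nodes n)%:R)^-1)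
    = times n * steepI 0 1 (times n) :> R by rewrite /times; ring.
rewrite ler_wpM2r ?steepI_ge0//; have := sin_lipschitz (times n) 0.
by rewrite sin0 !subr0 (gtr0_norm (times_gt0 n)).
Qed.

Lemma cos_times_cvg : cos (times n) @[n --> \oo] --> (1 : R).
Proof. by have := cvg_comp _ _ cvg_times (@continuous_cos R 0); rewrite cos0. Qed.

Lemma sin_times_cvg : sin (times n) @[n --> \oo] --> (0 : R).
Proof. by have := cvg_comp _ _ cvg_times (@continuous_sin R 0); rewrite sin0. Qed.

Lemma bessel_J_times_cvg : bessel_J (times n) @[n --> \oo] --> (1 : R).
Proof.
have <- : bessel_J 0 = 1 :> R.
  by rewrite /bessel_J (pserq0 (@entire_j0 R)) /j0_coef expr0 fact0 expr1n divr1.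
by apply: (cvg_comp _ _ cvg_times); exact: continuous_pserq (@entire_j0 R) _.
Qed.

Lemma bessel_L_times_cvg : bessel_L (times n) @[n --> \oo] --> (0 : R).
Proof.
have <- : bessel_L 0 = 0 :> R.
  by rewrite /bessel_L (pserq0 (@entire_y0 R)) /y0_coef /series/= big_nil mulr0 mul0r.
by apply: (cvg_comp _ _ cvg_times); exact: continuous_pserq (@entire_y0 R) _.
Qed.

Lemma besselJ0_steep t : 0 < t -> besselJ0 t = 2 / pi * steep_re t.
Proof.
move=> t0; have p0 : pi != 0 :> R by rewrite gt_eqF// pi_gt0.
have s := bessel_sol_lin (2 / pi) (-1) bessel_sol_re (@bessel_sol_J R).
rewrite besselJ0E -/(pserq _ t) -/(bessel_J t).
apply/eqP; rewrite eq_sym -subr_eq0; apply/eqP.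
have := bessel_sol_eq0 s _ t0; rewrite /= mulN1r; apply.
have e0 (p : R) : p != 0 -> 2 / p * (1 * (p / 2) + 0) + -1 * 1 = 0.
  by move=> p1; field.
rewrite -[0 in X in _ --> X](e0 pi p0); apply: cvgD; last by apply: cvgMr; exact: bessel_J_times_cvg.
apply: cvgMr; apply: cvgD; last exact: steepI01_sin_cvg.
exact: cvgM cos_times_cvg steepI02_cvg.
Qed.

(** Caratheodory's form of the derivative writes [J t - 1] as [t] times a function continuous at 0,
    and [t ln N] tends to 0. *)
Lemma bessel_J_sub1_cvg : ln (nodes n)%:R * (bessel_J (times n) - 1) @[n --> \oo] --> (0 : R).
Proof.
have [g [gE cg _]] := (is_derive1_caratheodory _ _ _).1 (is_derive_pserq 0 (@entire_j0 R)).
have h : 2 * (ln (nodes n)%:R * ((nodes n)%:R)^-1) * g (times n) @[n --> \oo] --> 2 * 0 * g 0.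
  apply: cvgM; first by apply: cvgMr; exact: ln_nodes_cvg.
  by apply: (cvg_comp _ _ cvg_times); exact: cg.
apply: cvgn_eq h; last by rewrite mulr0 mul0r.
move=> n; have -> : bessel_J (times n) - 1 = g (times n) * (times n - 0).
  rewrite -gE; congr (_ - _).
  by rewrite (pserq0 (@entire_j0 R)) /j0_coef expr0 fact0 expr1n divr1.
by rewrite subr0 /times; ring.
Qed.

Lemma cos_sub1_steepI01_cvg : (1 - cos (times n)) * steepI 0 1 (times n) @[n --> \oo] --> (0 : R).
Proof.
have h1 : times n * (steepI 0 1 (times n) - ln (nodes n)%:R) + 2 * (ln (nodes n)%:R * ((nodes n)%:R)^-1)
    @[n --> \oo] --> 0 * - (euler_gamma : R) + 2 * 0.
  apply: cvgD; first exact: cvgM cvg_times steepI01_cvg.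
  by apply: cvgMr; exact: ln_nodes_cvg.
apply: norm_cvg0; apply: (squeeze_cvgr _ (cvg_cst (0 : R))); last first.
  by move: h1; rewrite mul0r mulr0 addr0; exact.
apply: nearW => n; rewrite normr_ge0/= normrM (ger0_norm (steepI_ge0 _ _ _)).
have -> : times n * (steepI 0 1 (times n) - ln (nodes n)%:R) + 2 * (ln (nodes n)%:R * ((nodes n)%:R)^-1)
    = times n * steepI 0 1 (times n) :> R by rewrite /times; ring.
rewrite ler_wpM2r ?steepI_ge0//; have := cos_lipschitz 0 (times n).
by rewrite cos0 sub0r normrN (gtr0_norm (times_gt0 n)).
Qed.

Lemma besselY0_steep t : 0 < t -> besselY0 t = 2 / pi * steep_im t.
Proof.
move=> t0; have p0 : pi != 0 :> R by rewrite gt_eqF// pi_gt0.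
have s := bessel_sol_lin 1 (-1) bessel_sol_im (@bessel_sol_Y R).
have -> : besselY0 t = 2 / pi * bessel_Y t.
  rewrite besselY0E besselJ0E /bessel_Y /bessel_J /bessel_L /pserq /quad; ring.
congr (_ * _); apply/eqP; rewrite eq_sym -subr_eq0; apply/eqP.
have := bessel_sol_eq0 s _ t0; rewrite /= mulN1r mul1r; apply.
(* [steepI 0 1] and the logarithm in [Y] diverge by the same [ln N]. Regrouped in this way every
   term converges, and the two surviving limits [euler_gamma] and [- euler_gamma] cancel. *)
have h : sin (times n) * steepI 0 2 (times n) + (1 - cos (times n)) * steepI 0 1 (times n)
   - (steepI 0 1 (times n) - ln (nodes n)%:R) + ln (nodes n)%:R * (bessel_J (times n) - 1)
   - euler_gamma * bessel_J (times n) + bessel_L (times n)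
   @[n --> \oo] --> 0 * (pi / 2) + 0 - - (euler_gamma : R) + 0 - euler_gamma * 1 + 0.
  apply: cvgD; last exact: bessel_L_times_cvg.
  apply: cvgB; last by apply: cvgMr; exact: bessel_J_times_cvg.
  apply: cvgD; last exact: bessel_J_sub1_cvg.
  apply: cvgB; last exact: steepI01_cvg.
  apply: cvgD; last exact: cos_sub1_steepI01_cvg.
  exact: cvgM sin_times_cvg steepI02_cvg.
apply: cvgn_eq h; last by ring.
by move=> n; rewrite /steep_im /bessel_Y ln_times; ring.
Qed.

End hankel_steep.

(** * Large argument asymptotics of the fundamental solution *)

Section large_time.
Context {R : realType}.
Local Notation mu := (@lebesgue_measure R).
Local Notation Hl := (`[0, +oo[%classic : set R).
Implicit Types (t v : R).

Lemma expRN_le1D x : 0 <= x -> expR (- x) <= (1 + x)^-1 :> R.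
Proof.
move=> x0; rewrite expRN lef_pV2 ?posrE ?expR_gt0 ?expR_ge1Dx//.
by rewrite ltr_pwDl.
Qed.

Lemma expRN_mul_le1 x : 0 <= x -> x * expR (- x) <= 1 :> R.
Proof.
move=> x0; have e1 := expR_ge1Dx x; rewrite expRN ler_pdivrMr ?expR_gt0// mul1r; lra.
Qed.

Lemma expRN_sqr_le2 x : 0 <= x -> x ^+ 2 * expR (- x) <= 2 :> R.
Proof.
move=> x0; have := expR_ge1Dxn 1 x0; rewrite expRN ler_pdivrMr ?expR_gt0//.
rewrite (_ : 2`!%:R = 2)//; lra.
Qed.

Definition gauss t v : R := expR (- (t * v ^+ 2)).

Lemma continuous_gauss t : continuous (gauss t).
Proof.
move=> v; have d2 := is_derive_scale t (is_derive_pow 2 (is_derive_id v 1)).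
exact: is_derive_continuous (is_derive_exp_comp (is_derive_opp d2)).
Qed.

Lemma gauss_integrable t : 0 < t -> mu.-integrable Hl (EFin \o gauss t).
Proof.
move=> t0; apply: (@half_line_integrable _ _ (1 + t^-1)); first exact: continuous_gauss.
move=> v _; rewrite ger0_norm ?expR_ge0//.
have v2 := sqr_ge0 v; have tv0 : 0 <= t * v ^+ 2 by rewrite mulr_ge0// ltW.
apply: le_trans (expRN_le1D tv0) _.
have d1 : 0 < 1 + v ^+ 2 by rewrite ltr_pwDl.
have d2 : 0 < 1 + t * v ^+ 2 by rewrite ltr_pwDl.
rewrite ler_pdivlMr// ler_pdivrMl// mulrDr mulr1 mulrDl mul1r.
have -> : t * v ^+ 2 * t^-1 = v ^+ 2 by field; rewrite gt_eqF.
have ti : 0 <= t^-1 by rewrite invr_ge0 ltW.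
lra.
Qed.

Lemma Rintegral_gauss t : 0 < t ->
  \int[mu]_(v in Hl) gauss t v = Num.sqrt pi / 2 / Num.sqrt t.
Proof.
move=> t0; set s := Num.sqrt t; have s0 : 0 < s by rewrite sqrtr_gt0.
have s2 : s ^+ 2 = t by rewrite sqr_sqrtr// ltW.
have dF v : is_derive v 1 (fun v : R => s * v) s.
  by have := is_derive_scale s (is_derive_id v 1); move/is_derive_eq; apply; rewrite mulr1.
have dFE : derive1 (fun v : R => s * v) = cst s.
  by apply/funext => v; rewrite derive1E; have [_ ->] := dF v.
have cF := derive_continuous dF.
have H := @increasing_ge0_integration_by_substitutiony R (fun v => s * v) gauss_fun 0.
have {}H : (\int[mu]_(x in `[(s * 0)%R, +oo[) (gauss_fun x)%:E =
    \int[mu]_(x in `[0%R, +oo[) (((gauss_fun \o (fun v => s * v)) * cst s) x)%:E)%E.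
  rewrite -dFE; apply: H.
  - by move=> x y _ _; rewrite ltr_pM2l.
  - by rewrite dFE => x _; exact: cst_continuous.
  - by rewrite dFE; exact: is_cvg_cst.
  - by rewrite dFE; exact: is_cvg_cst.
  - split; first by move=> x _; apply: ex_derive.
    by apply: cvg_at_right_filter; exact: cF.
  - by apply/gt0_cvgMry => //; exact: cvg_id.
  - by apply: continuous_subspaceT; exact: continuous_gauss_fun.
  - by move=> x _; exact: gauss_fun_ge0.
have : s * \int[mu]_(v in Hl) gauss t v = Num.sqrt pi / 2.
  rewrite -(RintegralZl _ (@measurable_half_line R) (gauss_integrable t0)).
  rewrite /Rintegral (_ : Num.sqrt pi / 2 = fine (Num.sqrt pi / 2)%:E)//.
  rewrite -integral0y_gauss; move: H; rewrite mulr0 => ->; congr fine.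
  apply: eq_integral => v _; congr EFin; rewrite /= mulrC; congr (_ * _).
  by rewrite /gauss /gauss_fun /= exprMn s2.
by move=> <-; field; rewrite gt_eqF.
Qed.

Lemma phase_le v : phase v <= v ^+ 2.
Proof. by rewrite ler_pdivrMr ?hyp_gt0// ler_peMr ?sqr_ge0// hyp_ge1. Qed.

Lemma hypV_ge v : 1 - v ^+ 2 / 2 <= (hyp v)^-1.
Proof.
have h1 := hyp_ge1 v; have h0 := hyp_gt0 v; have h2 := hyp_sqr v.
rewrite -[leRHS]mul1r ler_pdivlMr// (_ : v ^+ 2 = hyp v ^+ 2 - 1); last by rewrite h2; ring.
rewrite -subr_ge0 (_ : _ - _ = (hyp v - 1) ^+ 2 * (hyp v + 2) / 2); last by field.
by rewrite divr_ge0// mulr_ge0 ?sqr_ge0// addr_ge0 ?(ltW h0).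
Qed.

Lemma phase_ge v : v ^+ 2 - v ^+ 4 / 2 <= phase v.
Proof.
have := ler_wpM2l (sqr_ge0 v) (hypV_ge v); rewrite /phase; apply: le_trans.
rewrite le_eqVlt; apply/orP; left; apply/eqP; ring.
Qed.

Lemma phase_ge_small v : 0 <= v <= 1 -> v ^+ 2 / 2 <= phase v.
Proof.
move=> /andP[v0 v1]; rewrite ler_wpM2l ?sqr_ge0// lef_pV2 ?posrE ?hyp_gt0//.
rewrite -(@ler_pXn2r _ 2)// ?nnegrE ?(ltW (hyp_gt0 _))// hyp_sqr; nra.
Qed.

Lemma phase_ge_large v : 1 <= v -> v / 2 <= phase v.
Proof.
move=> v1; have v0 : 0 < v by lra.
rewrite /phase ler_pdivlMr ?hyp_gt0// -mulrA expr2 ler_pM2l// mulrC ler_pdivrMr//.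
rewrite -(@ler_pXn2r _ 2)// ?nnegrE ?mulr_ge0 ?(ltW (hyp_gt0 _)) ?(ltW v0)// hyp_sqr; nra.
Qed.

(** From [x ^ 2 e^(- x) <= 2] at [x = t y], together with [1 + v ^ 2 <= 8 y ^ 2], which follows from
    [1 <= v <= 2 y]; hence the 16. *)
Lemma expR_large_le t y v : 1 <= t -> 1 <= v -> v / 2 <= y ->
  expR (- (t * y)) <= 16 / t ^+ 2 / (1 + v ^+ 2).
Proof.
move=> t1 v1 yv; have t0 : 0 < t by lra. have y0 : 0 < y by lra.
have ty0 : 0 <= t * y by rewrite mulr_ge0// ltW.
have := expRN_sqr_le2 ty0 => h.
have d1 : 0 < 1 + v ^+ 2 by rewrite ltr_pwDl// sqr_ge0.
rewrite ler_pdivlMr// ler_pdivlMr ?exprn_gt0//.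
have e0 := expR_ge0 (- (t * y)).
apply: (@le_trans _ _ (8 * ((t * y) ^+ 2 * expR (- (t * y))))); last by lra.
have vy : 1 + v ^+ 2 <= 8 * y ^+ 2 by nra.
rewrite (_ : 8 * _ = expR (- (t * y)) * (8 * y ^+ 2) * t ^+ 2); last by ring.
by rewrite ler_wpM2r ?sqr_ge0// ler_wpM2l.
Qed.

(** For [v <= 1], [phase v] lies between [v ^ 2 - v ^ 4 / 2] and [v ^ 2] and the weight between
    [1 - v ^ 2] and 1, so the error is at most [t v ^ 4 / 2 + v ^ 2] times [e^(- t v ^ 2 / 2)]. With
    [y = t v ^ 2 / 4] half of that exponential absorbs [8 y ^ 2 + 4 y], which gives
    [20 = 8 * 2 + 4 * 1] and leaves [gauss (t / 4) v]. For [v > 1] both terms are controlled by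
    [expR_large_le]. The trailing [+ 0] fits the nested sums integrated by [integrable_scaleD]. *)
Lemma steep_gauss_dist m t v : (m.+1 <= 2)%N -> 1 <= t -> 0 <= v ->
  `|steep 0 m.+1 t v - gauss t v| <=
     20 / t * gauss (t / 4) v + (16 / t ^+ 2 / (1 + v ^+ 2) + 0).
Proof.
move=> m2 t1 v0; have t0 : 0 < t by lra.
have h0 := hyp_gt0 v; have h1 := hyp_ge1 v.
set w := (hyp v)^-1 ^+ m.+1; have w0 : 0 <= w by rewrite exprn_ge0// invr_ge0 ltW.
have w1 : w <= 1 by rewrite exprn_ile1 ?invr_ge0 ?invf_le1// ltW.
have wl : 1 - v ^+ 2 <= w.
  have hl := hypV_ge v; have v2 := sqr_ge0 v; rewrite /w.
  have i1 : (hyp v)^-1 <= 1 by rewrite invf_le1.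
  have i0 : 0 <= (hyp v)^-1 by rewrite invr_ge0 ltW.
  case: m m2 {w w0 w1} => [|[|]]// _; first by rewrite expr1; lra.
  by rewrite expr2; move: (hyp v)^-1 hl i1 i0 => i hl i1 i0; nra.
rewrite /steep expr0 mul1r -/w addr0 /gauss.
set E1 := expR (- (t * phase v)); set E2 := expR (- (t * v ^+ 2)).
have E10 : 0 <= E1 by exact: expR_ge0. have E20 : 0 <= E2 by exact: expR_ge0.
have tS := phase_le v; have tv0 : 0 <= t * v ^+ 2 by rewrite mulr_ge0 ?sqr_ge0 ?ltW.
have E21 : E2 <= E1 by rewrite ler_expR lerN2 ler_pM2l.
have [vs|vl] := leP v 1; last first.
  have H : `|E1 * w - E2| <= 16 / t ^+ 2 / (1 + v ^+ 2).
    have l1 := expR_large_le t1 (ltW vl) (phase_ge_large (ltW vl)).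
    apply: le_trans l1; rewrite -/E1 ler_norml; apply/andP; split.
      by have := mulr_ge0 E10 w0; lra.
    by have := ler_wpM2l E10 w1; rewrite mulr1; lra.
  by apply: le_trans H _; rewrite lerDr mulr_ge0 ?expR_ge0// divr_ge0// ltW.
have H : `|E1 * w - E2| <= expR (- (t * (v ^+ 2 / 2))) * (t * (v ^+ 4 / 2) + v ^+ 2).
  have E1l : E1 <= expR (- (t * (v ^+ 2 / 2))).
    by rewrite ler_expR lerN2 ler_pM2l// phase_ge_small// v0 vs.
  set E3 := expR _ in E1l *.
  have E2E : E1 * (1 - t * (v ^+ 4 / 2)) <= E2.
    have -> : E2 = E1 * expR (- (t * (v ^+ 2 - phase v))).
      by rewrite /E1 -expRD; congr expR; ring.
    rewrite ler_wpM2l//; apply: le_trans (expR_ge1Dx _).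
    by rewrite lerD2l lerN2 ler_pM2l//; have := phase_ge v; lra.
  have v20 := sqr_ge0 v; have v40 : 0 <= v ^+ 4 by rewrite exprn_ge0.
  have tv4 : 0 <= t * (v ^+ 4 / 2) by rewrite mulr_ge0 ?divr_ge0// ltW.
  have q : E1 * (t * (v ^+ 4 / 2) + v ^+ 2) <= E3 * (t * (v ^+ 4 / 2) + v ^+ 2).
    by rewrite ler_wpM2r// addr_ge0.
  apply: le_trans q; rewrite ler_norml; apply/andP; split; last by nra.
  have : E1 * (1 - v ^+ 2) <= E1 * w by rewrite ler_wpM2l.
  have : E2 <= E1 by []. nra.
apply: le_trans H _; apply: (@le_trans _ _ (20 / t * expR (- (t / 4 * v ^+ 2)))); last first.
  by rewrite lerDl divr_ge0 ?divr_ge0 ?addr_ge0 ?sqr_ge0.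
set y := t / 4 * v ^+ 2; have y0 : 0 <= y by rewrite mulr_ge0 ?sqr_ge0// divr_ge0// ltW.
have -> : - (t * (v ^+ 2 / 2)) = - y + - y by rewrite /y; field.
have -> : t * (v ^+ 4 / 2) + v ^+ 2 = (8 * y ^+ 2 + 4 * y) / t by rewrite /y; field; rewrite gt_eqF.
have a1 := expRN_mul_le1 y0; have a2 := expRN_sqr_le2 y0.
rewrite expRD (_ : _ * _ * _ = (8 * (y ^+ 2 * expR (- y)) + 4 * (y * expR (- y))) / t * expR (- y)); last by field; rewrite gt_eqF.
by rewrite ler_wpM2r ?expR_ge0// ler_wpM2r ?invr_ge0 ?(ltW t0)//; lra.
Qed.

(** The integrated errors of [steep_gauss_dist]: [20 / t] times the Gaussian integral at [t / 4] is
    [20 sqrt pi / (t sqrt t)], and [16 / t ^ 2] times [pi / 2] is at most [8 pi / (t sqrt t)] when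
    [t >= 1]. *)
Definition asymp_const : R := 20 * Num.sqrt pi + 8 * pi.

Lemma steepI_asymp m t : (m.+1 <= 2)%N -> 1 <= t ->
  `|steepI 0 m.+1 t - Num.sqrt pi / 2 / Num.sqrt t| <= asymp_const / (t * Num.sqrt t).
Proof.
move=> m2 t1; have t0 : 0 < t by lra. have t40 : 0 < t / 4 by lra.
have [Ik kE] := integrable_scaleD (16 / t ^+ 2) (@integrable_oneDsqrV R)
  (integrable0 mu Hl : mu.-integrable Hl (EFin \o (fun _ : R => 0 : R))).
have [Ih hE] := integrable_scaleD (20 / t) (gauss_integrable t40) Ik.
rewrite -(Rintegral_gauss t0).
apply: le_trans (half_line_dist (steep_integrable 0 m.+1 t0) (gauss_integrable t0) Ih _) _.
  by move=> v v0; exact: steep_gauss_dist.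
rewrite hE kE Rintegral_oneDsqrV Rintegral_gauss// Rintegral_cst ?mul0r ?addr0; last exact: measurable_half_line.
set s := Num.sqrt t; have s1 : 1 <= s by rewrite -sqrtr1 ler_wsqrtr.
have -> : Num.sqrt (t / 4) = s / 2.
  rewrite sqrtrM ?(ltW t0)// sqrtrV// (_ : 4 = 2 ^+ 2 :> R); last by ring.
  by rewrite sqrtr_sqr ger0_norm.
have s2 : t = s ^+ 2 by rewrite sqr_sqrtr// ltW.
have s0 : 0 < s by lra.
rewrite s2 /asymp_const ler_pdivlMr ?mulr_gt0 ?exprn_gt0//.
have p0 : 0 < pi :> R by exact: pi_gt0.
have -> : (20 / s ^+ 2 * (Num.sqrt pi / 2 / (s / 2)) + 16 / (s ^+ 2) ^+ 2 * (pi / 2)) * (s ^+ 2 * s)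
   = 20 * Num.sqrt pi + 8 * pi / s by field; rewrite gt_eqF.
by rewrite lerD2l ler_pdivrMr// ler_peMr// mulr_ge0// ltW.
Qed.

End large_time.

Local Open Scope complex_scope.

(** * The modulus of complex numbers *)

Section complex_modulus.
Context {R : realType}.
Implicit Types (z w : R[i]) (a b t : R).

Lemma cmodE a b : cmod (a +i* b) = Num.sqrt (a ^+ 2 + b ^+ 2).
Proof. by []. Qed.

Lemma cmod_ge0 z : 0 <= cmod z.
Proof. by case: z => a b; rewrite cmodE sqrtr_ge0. Qed.

Lemma cmod0 : cmod (0 : R[i]) = 0.
Proof. by rewrite /cmod Normc.normc0. Qed.

Lemma cmodM z w : cmod (z * w) = cmod z * cmod w.
Proof. exact: Normc.normcM. Qed.

Lemma cmodD z w : cmod (z + w) <= cmod z + cmod w.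
Proof. exact: le_normcD. Qed.

Lemma cmodN z : cmod (- z) = cmod z.
Proof. exact: normcN. Qed.

Lemma cmod_real a : cmod a%:C = `|a|.
Proof. by rewrite cmodE expr0n/= addr0 sqrtr_sqr. Qed.

Lemma cmod_expi t : cmod (expi t) = 1.
Proof. by rewrite /expi cmodE cos2Dsin2 sqrtr1. Qed.

Lemma Re_le_cmod z : `|complex.Re z| <= cmod z.
Proof. by case: z => a b; rewrite cmodE /= -sqrtr_sqr ler_wsqrtr// lerDl sqr_ge0. Qed.

Lemma Im_le_cmod z : `|complex.Im z| <= cmod z.
Proof. by case: z => a b; rewrite cmodE /= -sqrtr_sqr ler_wsqrtr// lerDr sqr_ge0. Qed.

Lemma cmod_le_ReIm z : cmod z <= `|complex.Re z| + `|complex.Im z|.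
Proof.
case: z => a b; rewrite cmodE /= -(@ler_pXn2r _ 2)// ?nnegrE ?sqrtr_ge0 ?addr_ge0//.
rewrite sqr_sqrtr ?addr_ge0 ?sqr_ge0// sqrrD !real_normK ?num_real//.
by rewrite -addrA addrCA addrA lerD2r lerDr mulrn_wge0// mulr_ge0.
Qed.

Lemma expiD a b : expi (a + b) = expi a * expi b.
Proof. by rewrite /expi cosD sinD; apply/eqP; rewrite eq_complex /=; apply/andP; split; apply/eqP; ring. Qed.

Lemma expi_lipschitz a b : cmod (expi a - expi b) <= 2 * `|a - b|.
Proof.
apply: le_trans (cmod_le_ReIm _) _; rewrite /expi /= mulr2n mulrDl mul1r.
by rewrite lerD ?cos_lipschitz ?sin_lipschitz.
Qed.

Lemma complex_ReM z w : complex.Re (z * w) =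
  complex.Re z * complex.Re w - complex.Im z * complex.Im w.
Proof. by case: z => a b; case: w => c e; simpc. Qed.

Lemma complex_ImM z w : complex.Im (z * w) =
  complex.Re z * complex.Im w + complex.Im z * complex.Re w.
Proof. by case: z => a b; case: w => c e; simpc. Qed.

End complex_modulus.

(** * Euclidean norm and inner product *)

Section euclid.
Context {R : realType} {n : nat}.
Implicit Types (x y z : 'rV[R]_n).

Lemma dotvC x y : dotv x y = dotv y x.
Proof. by apply: eq_bigr => i _; rewrite mulrC. Qed.

Lemma dotvDl x y z : dotv (x + y) z = dotv x z + dotv y z.
Proof. by rewrite /dotv -big_split/=; apply: eq_bigr => i _; rewrite mxE mulrDl. Qed.

Lemma dotvZl a x y : dotv (a *: x) y = a * dotv x y.
Proof. by rewrite /dotv mulr_sumr; apply: eq_bigr => i _; rewrite mxE mulrA. Qed.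

Lemma dotvNl x y : dotv (- x) y = - dotv x y.
Proof. by rewrite -scaleN1r dotvZl mulN1r. Qed.

Lemma dotvv_ge0 x : 0 <= dotv x x.
Proof. by apply: sumr_ge0 => i _; rewrite -expr2 sqr_ge0. Qed.

Lemma enorm_ge0 x : 0 <= enorm x.
Proof. exact: sqrtr_ge0. Qed.

Lemma enorm_sqr x : enorm x ^+ 2 = dotv x x.
Proof. by rewrite sqr_sqrtr// dotvv_ge0. Qed.

Lemma dotvv_subZ a b x y : dotv (a *: x - b *: y) (a *: x - b *: y) =
  a ^+ 2 * dotv x x - 2 * a * b * dotv x y + b ^+ 2 * dotv y y.
Proof.
rewrite !dotvDl !dotvNl !(dotvC _ (_ + _)) !dotvDl !dotvNl !dotvZl.
rewrite !(dotvC _ (_ *: _)) !dotvZl (dotvC y x); ring.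
Qed.

Lemma dotv_cauchy x y : `|dotv x y| <= enorm x * enorm y.
Proof.
rewrite -(@ler_pXn2r _ 2)// ?nnegrE ?mulr_ge0 ?enorm_ge0// exprMn !enorm_sqr real_normK ?num_real//.
have := dotvv_ge0 (dotv y y *: x - dotv x y *: y); rewrite dotvv_subZ.
have := dotvv_ge0 y; rewrite le_eqVlt => /predU1P[y0|y0].
  have yi i : y ord0 i = 0.
    have /eqP := esym y0; rewrite psumr_eq0; last by move=> j _; rewrite -expr2 sqr_ge0.
    by move=> /allP/(_ i (mem_index_enum i)) /=; rewrite mulf_eq0 orbb => /eqP.
  rewrite (_ : dotv x y = 0); last by apply: big1 => i _; rewrite yi mulr0.
  by move=> _; rewrite expr0n /= -y0 mulr0.
set a := dotv x x; set b := dotv y y in y0 *; set c := dotv x y => H.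
have : 0 <= b * (a * b - c ^+ 2) by apply: le_trans H _; rewrite le_eqVlt; apply/orP; left; apply/eqP; ring.
by rewrite pmulr_rge0// subr_ge0.
Qed.

Lemma enormB_sqr x y : enorm (x - y) ^+ 2 = enorm x ^+ 2 - 2 * dotv x y + enorm y ^+ 2.
Proof. by have := dotvv_subZ 1 1 x y; rewrite !scale1r !enorm_sqr => ->; ring. Qed.

Lemma enormB_le x y : enorm (x - y) <= enorm x + enorm y.
Proof.
rewrite -(@ler_pXn2r _ 2)// ?nnegrE ?addr_ge0 ?enorm_ge0// enormB_sqr.
by have := dotv_cauchy x y; rewrite ler_norml => /andP[h _]; lra.
Qed.

Lemma enormB_ge x y : enorm x - enorm y <= enorm (x - y).
Proof.
have [h|h] := leP (enorm x - enorm y) 0; first by rewrite (le_trans h)// enorm_ge0.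
rewrite -(@ler_pXn2r _ 2)// ?nnegrE ?(ltW h) ?enorm_ge0// enormB_sqr.
by have := dotv_cauchy x y; rewrite ler_norml => /andP[_ h']; lra.
Qed.

Lemma dotv_direction x y : enorm x * dotv (direction x) y = dotv x y.
Proof.
rewrite /direction dotvZl mulrA; have [x0|x0] := eqVneq (enorm x) 0; last by rewrite mulfV// mul1r.
rewrite x0 !mul0r; apply/esym/eqP; rewrite -normr_eq0 eq_le normr_ge0 andbT.
by have := dotv_cauchy x y; rewrite x0 mul0r.
Qed.

Lemma enorm_direction x : 0 < enorm x -> enorm (direction x) = 1.
Proof.
move=> x0; apply/eqP; rewrite -(@eqrXn2 _ 2)// ?enorm_ge0// expr1n enorm_sqr.
by rewrite /direction dotvZl dotvC dotvZl -enorm_sqr; apply/eqP; field; rewrite gt_eqF.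
Qed.

(** With [s] the component of [y] along [x], multiplying the difference by [|x - y| + (|x| - s)]
    turns it into [|y| ^ 2 - s ^ 2], which is at most [rho ^ 2]; the multiplier is at least [|x|]
    because [2 rho <= |x|]. *)
Lemma enormB_expand x y rho : enorm y <= rho -> 2 * rho <= enorm x -> 0 < enorm x ->
  `|enorm (x - y) - (enorm x - dotv (direction x) y)| <= rho ^+ 2 / enorm x.
Proof.
move=> yr xr x0; set p := enorm (x - y); set r := enorm x in xr x0 *.
set s := dotv (direction x) y; have y0 := enorm_ge0 y; have p0 := enorm_ge0 (x - y).
have sy : `|s| <= enorm y by have := dotv_cauchy (direction x) y; rewrite enorm_direction// mul1r.
have pr : r / 2 <= p by have := enormB_ge x y; rewrite -/p -/r; lra.
have p2 : p ^+ 2 = r ^+ 2 - 2 * (r * s) + enorm y ^+ 2 by rewrite /p enormB_sqr dotv_direction.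
have := sy; rewrite ler_norml => /andP[s1 s2].
have D0 : r <= p + (r - s) by lra.
have e : (p - (r - s)) * (p + (r - s)) = enorm y ^+ 2 - s ^+ 2.
  have -> : enorm y ^+ 2 = p ^+ 2 - r ^+ 2 + 2 * (r * s) by rewrite p2; ring.
  ring.
rewrite ler_pdivlMr//; apply: (@le_trans _ _ (`|p - (r - s)| * (p + (r - s)))).
  by rewrite ler_wpM2l.
have DD : 0 <= p + (r - s) by lra.
rewrite -{1}(ger0_norm DD) -normrM e.
have sq : s ^+ 2 <= enorm y ^+ 2 by rewrite -real_normK ?num_real// lerXn2r ?nnegrE.
have yq : enorm y ^+ 2 <= rho ^+ 2 by rewrite lerXn2r ?nnegrE// (le_trans y0).
rewrite ger0_norm ?subr_ge0//; have := sqr_ge0 s; lra.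
Qed.

End euclid.

(** * Expansion of the kernel at infinity *)

Section kernel_asymptotics.
Context {R : realType} {d : nat}.
Hypothesis d23 : d = 2%N \/ d = 3%N.
Implicit Types (k r p : R) (x y z : 'rV[R]_d).

Definition amp r : R := r `^ ((1 - d%:R) / 2).

Lemma ampE r : 0 < r -> amp r = if d == 2%N then (Num.sqrt r)^-1 else r^-1.
Proof.
move=> r0; rewrite /amp; case: d23 => ->/=.
  by rewrite (_ : (1 - 2%:R) / 2 = - 2^-1); [rewrite powRN powR12_sqrt// ltW|field].
by rewrite (_ : (1 - 3%:R) / 2 = -1); [rewrite powR_inv1// ltW|field].
Qed.

Lemma amp_ge0 r : 0 <= amp r.
Proof. exact: powR_ge0. Qed.

Lemma amp_err r : 0 < r -> r `^ (- ((d%:R + 1) / 2)) = amp r / r.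
Proof.
move=> r0; rewrite -(powR_inv1 (ltW r0)) /amp -powRD; last by rewrite (gt_eqF r0) implybT.
by congr (_ `^ _); field.
Qed.

Lemma inv_le_half a b : 0 < b -> b / 2 <= a -> a^-1 <= 2 / b :> R.
Proof. by move=> b0 ab; rewrite -invf_div lef_pV2 ?posrE ?divr_gt0//; lra. Qed.

(** Replacing [|x - y|] by [|x|] in the amplitude costs one more power of [1 / r], the order of the
    remainder. In the plane, with [a] and [b] the square roots of [p] and [r], this rests on
    [1 / a - 1 / b = (r - p) / (a b (a + b))]. *)
Lemma amp_dist p r rho : 0 < r -> r / 2 <= p -> `|p - r| <= rho ->
  `|amp p - amp r| <= 2 * rho * (amp r / r) /\ amp p / p <= 4 * (amp r / r).
Proof.
move=> r0 pr pd; have p0 : 0 < p by lra.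
have pi2 := inv_le_half r0 pr; have ri0 : 0 <= r^-1 by rewrite invr_ge0 ltW.
have pi0 : 0 <= p^-1 by rewrite invr_ge0 ltW.
rewrite !ampE//; case: ifP => _; last first.
  split.
    have -> : p^-1 - r^-1 = - (p - r) * (p^-1 * r^-1) by field; rewrite !gt_eqF.
    rewrite normrM normrN [`|_ * _^-1|]ger0_norm; last by rewrite mulr_ge0.
    rewrite (_ : 2 * rho * (r^-1 / r) = rho * (2 / r * r^-1)); last by ring.
    by apply: ler_pM; rewrite ?mulr_ge0// ler_wpM2r.
  rewrite (_ : 4 * (r^-1 / r) = 2 / r * (2 / r)); last by field; rewrite gt_eqF.
  exact: ler_pM.
set a := Num.sqrt p; set b := Num.sqrt r.
have a0 : 0 < a by rewrite sqrtr_gt0. have b0 : 0 < b by rewrite sqrtr_gt0.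
have a2 : p = a ^+ 2 by rewrite sqr_sqrtr// ltW.
have b2 : r = b ^+ 2 by rewrite sqr_sqrtr// ltW.
have ab : b / 2 <= a.
  rewrite -(@ler_pXn2r _ 2)// ?nnegrE ?divr_ge0 ?(ltW a0) ?(ltW b0)//.
  by rewrite -a2 exprMn -b2 exprVn; lra.
have ai := inv_le_half b0 ab; have bi0 : 0 <= b^-1 by rewrite invr_ge0 ltW.
have ai0 : 0 <= a^-1 by rewrite invr_ge0 ltW.
split; last first.
  rewrite (_ : 4 * (b^-1 / r) = 2 / b * (2 / r)); last by field; rewrite !gt_eqF.
  exact: ler_pM.
have abi : (a + b)^-1 <= b^-1 by rewrite lef_pV2 ?posrE ?addr_gt0// lerDr ltW.
have abi0 : 0 <= (a + b)^-1 by rewrite invr_ge0 addr_ge0// ltW.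
have -> : a^-1 - b^-1 = - (p - r) * (a^-1 * b^-1 * (a + b)^-1).
  by rewrite a2 b2; field; rewrite !gt_eqF// addr_gt0.
rewrite normrM normrN [`|_ * (_ + _)^-1|]ger0_norm; last by rewrite !mulr_ge0.
rewrite (_ : 2 * rho * (b^-1 / r) = rho * (2 / b * b^-1 * b^-1)); last by rewrite b2; field; rewrite gt_eqF.
by apply: ler_pM; rewrite ?mulr_ge0// ler_pM ?mulr_ge0// ler_wpM2r.
Qed.

Lemma imag_quarterM a b : (0 +i* 1) / 4 * (a +i* b) = (- (b / 4)) +i* (a / 4) :> R[i].
Proof.
have c4 : (4 : R[i]) = (4 : R)%:C by rewrite rmorph_nat.
have n4 : (4 : R[i]) != 0 by rewrite pnatr_eq0.
apply: (mulIf n4); rewrite mulrAC divfK// c4.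
by apply/eqP; rewrite eq_complex /=; apply/andP; split; apply/eqP; field.
Qed.

Lemma cos_sin_pi4 : cos (pi / 4) = (Num.sqrt 2)^-1 :> R /\ sin (pi / 4) = (Num.sqrt 2)^-1 :> R.
Proof.
have p0 : 0 < pi :> R by exact: pi_gt0.
have c0 : 0 < cos (pi / 4) :> R by apply: cos_gt0_pihalf; apply/andP; split; lra.
have sc : sin (pi / 4) = cos (pi / 4) :> R.
  by have := @tan_piquarter R; rewrite /tan => /(canRL (mulfVK (lt0r_neq0 c0))); rewrite mul1r.
suff e : cos (pi / 4) = (Num.sqrt 2)^-1 :> R by rewrite sc.
have := cos2Dsin2 (pi / 4 : R); rewrite sc => h.
apply/eqP; rewrite -(@eqrXn2 _ 2)// ?(ltW c0)// ?invr_ge0 ?sqrtr_ge0// exprVn sqr_sqrtr//.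
by apply/eqP; lra.
Qed.

(** Both integrals share the leading term [g = sqrt pi / (2 sqrt t)]. Putting [g] in their place
    turns the kernel into [g / (2 pi)] times [(1 + i) e^(i t)], and [1 + i = sqrt 2 e^(i pi / 4)]
    produces the far field constant. What remains is linear in [A - g] and [B - g]. *)
Lemma Phi_asymp2 k r : d = 2%N -> 0 < k -> 1 <= k * r ->
  cmod ((0 +i* 1) / 4 * hankel0 (k * r) -
        expi (pi / 4) / (Num.sqrt (8 * pi * k))%:C * expi (k * r) * (amp r)%:C) <=
  2 / pi * asymp_const / (k * Num.sqrt k) * (amp r / r).
Proof.
move=> dE k0 kr1; have r0 : 0 < r by rewrite -(pmulr_rgt0 _ k0); lra.
set t := k * r in kr1 *; have t0 : 0 < t by lra.
have p0 : 0 < pi :> R by exact: pi_gt0.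
rewrite /hankel0 (besselJ0_steep t0) (besselY0_steep t0) imag_quarterM.
have h2 := @steepI_asymp R 1 t erefl kr1; have h1 := @steepI_asymp R 0 t erefl kr1.
rewrite /steep_re /steep_im; set A := steepI 0 2 t in h2 *; set B := steepI 0 1 t in h1 *.
set g := Num.sqrt pi / 2 / Num.sqrt t in h1 h2.
have -> : expi (pi / 4) / (Num.sqrt (8 * pi * k))%:C * expi t * (amp r)%:C =
   ((2 * pi)^-1 * g * (cos t - sin t)) +i* ((2 * pi)^-1 * g * (cos t + sin t)).
  have sp0 : Num.sqrt pi != 0 :> R by rewrite gt_eqF// sqrtr_gt0.
  have sk0 : Num.sqrt k != 0 by rewrite gt_eqF// sqrtr_gt0.
  have sr0 : Num.sqrt r != 0 by rewrite gt_eqF// sqrtr_gt0.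
  have -> : expi (pi / 4) / (Num.sqrt (8 * pi * k))%:C = ((4 * Num.sqrt pi * Num.sqrt k)^-1)%:C * (1 +i* 1).
    rewrite /expi; have [-> ->] := cos_sin_pi4.
    have w0 : Num.sqrt 2 != 0 :> R by rewrite gt_eqF// sqrtr_gt0.
    have w2 : Num.sqrt 2 * Num.sqrt 2 = 2 :> R by rewrite -expr2 sqr_sqrtr.
    have -> : Num.sqrt (8 * pi * k) = 2 * Num.sqrt 2 * Num.sqrt pi * Num.sqrt k.
      rewrite !sqrtrM ?mulr_ge0 ?(ltW p0)//; congr (_ * _ * _).
      have -> : 8 = 2 ^+ 2 * 2 :> R by ring.
      by rewrite sqrtrM ?sqr_ge0// sqrtr_sqr ger0_norm.
    have e : (Num.sqrt 2)^-1 * (2 * Num.sqrt 2 * Num.sqrt pi * Num.sqrt k)^-1 =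
        (4 * Num.sqrt pi * Num.sqrt k)^-1 :> R.
      rewrite (_ : 4 = 2 * (Num.sqrt 2 * Num.sqrt 2)); last by rewrite w2; ring.
      by field; rewrite w0 sp0 sk0.
    rewrite -fmorphV -e; apply/eqP; rewrite eq_complex /=.
    by apply/andP; split; apply/eqP; ring.
  rewrite ampE// dE eqxx /g /t sqrtrM ?(ltW k0)//.
  have -> : (2 * pi)^-1 = (2 * (Num.sqrt pi * Num.sqrt pi))^-1 :> R by rewrite -expr2 sqr_sqrtr ?(ltW p0).
  apply/eqP; rewrite eq_complex /=.
  by apply/andP; split; apply/eqP; field; rewrite sp0 sk0 sr0.
apply: le_trans (cmod_le_ReIm _) _; rewrite /=.
have B0 : 0 <= (2 * pi)^-1 * (`|A - g| + `|B - g|) by rewrite mulr_ge0 ?invr_ge0 ?mulr_ge0 ?(ltW p0)// addr_ge0.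
have c1 : `|cos t| <= 1 by rewrite ler_norml cos_geN1 cos_le1.
have s1 : `|sin t| <= 1 by rewrite ler_norml sin_geN1 sin_le1.
have lin (a b x y : R) : `|a| <= 1 -> `|b| <= 1 -> `|(2 * pi)^-1 * (a * x + b * y)| <= (2 * pi)^-1 * (`|x| + `|y|).
  move=> a1 b1; rewrite normrM ger0_norm ?invr_ge0 ?mulr_ge0 ?(ltW p0)//.
  rewrite ler_wpM2l ?invr_ge0 ?mulr_ge0 ?(ltW p0)//; apply: le_trans (ler_normD _ _) _.
  by rewrite !normrM lerD// ler_piMl.
apply: (@le_trans _ _ (2 * ((2 * pi)^-1 * (`|A - g| + `|B - g|)))).
  rewrite [leRHS](_ : _ = (2 * pi)^-1 * (`|A - g| + `|B - g|) + (2 * pi)^-1 * (`|A - g| + `|B - g|)); last by ring.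
  apply: lerD.
    have e1 (p : R) : p != 0 -> - (2 / p * (sin t * A - cos t * B) / 4) - (2 * p)^-1 * g * (cos t - sin t)
        = (2 * p)^-1 * (- sin t * (A - g) + cos t * (B - g)) by move=> p1; field.
    rewrite (e1 _ (lt0r_neq0 p0)).
    by apply: lin; rewrite ?normrN.
  have e2 (p : R) : p != 0 -> 2 / p * (cos t * A + sin t * B) / 4 - (2 * p)^-1 * g * (cos t + sin t)
      = (2 * p)^-1 * (cos t * (A - g) + sin t * (B - g)) by move=> p1; field.
  rewrite (e2 _ (lt0r_neq0 p0)); exact: lin.
have sr0 : 0 < Num.sqrt r by rewrite sqrtr_gt0.
have sk0 : 0 < Num.sqrt k by rewrite sqrtr_gt0.
apply: (@le_trans _ _ (2 * ((2 * pi)^-1 * (2 * (asymp_const / (t * Num.sqrt t)))))).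
  rewrite ler_wpM2l// ler_wpM2l ?invr_ge0 ?mulr_ge0 ?(ltW p0)//; lra.
rewrite ampE// dE eqxx /t sqrtrM ?(ltW k0)// le_eqVlt; apply/orP; left; apply/eqP.
have e3 (p : R) : p != 0 -> 2 * ((2 * p)^-1 * (2 * (asymp_const / (k * r * (Num.sqrt k * Num.sqrt r))))) =
    2 / p * asymp_const / (k * Num.sqrt k) * ((Num.sqrt r)^-1 / r) by move=> p1; field; rewrite p1 !gt_eqF.
exact: e3 (lt0r_neq0 p0).
Qed.

Lemma asymp_coef_ge0 k : 0 < k -> 0 <= 2 / pi * asymp_const / (k * Num.sqrt k).
Proof.
move=> k0; have p0 : 0 <= pi :> R by exact: pi_ge0.
apply: divr_ge0; last by rewrite mulr_ge0 ?sqrtr_ge0// ltW.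
apply: mulr_ge0; first exact: divr_ge0.
by rewrite addr_ge0// mulr_ge0// sqrtr_ge0.
Qed.

(** For [d = 3] the leading term is the kernel itself and the error is 0, so the constant of the
    planar case serves both dimensions. The condition [k^-1 <= enorm z] places [k |z|] in the range
    [t >= 1] of [steepI_asymp]. *)
Lemma Phi_asymp k : 0 < k -> exists2 M : R, 0 <= M & forall z : 'rV[R]_d, k^-1 <= enorm z ->
  cmod (Phi k z - @farfield_const R d k * expi (k * enorm z) * (amp (enorm z))%:C) <=
  M * (amp (enorm z) / enorm z).
Proof.
move=> k0; exists (2 / pi * asymp_const / (k * Num.sqrt k)).
  exact: asymp_coef_ge0.
move=> z kz; have z0 : 0 < enorm z by rewrite (lt_le_trans _ kz)// invr_gt0.
rewrite /Phi /farfield_const; case: ifPn => dE.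
  apply: Phi_asymp2 => //; first exact/eqP.
  by move: kz; rewrite -ler_pdivrMl// mulr1.
have -> : expi (k * enorm z) / (4 * pi * enorm z)%:C -
   ((4 * pi)^-1)%:C * expi (k * enorm z) * (amp (enorm z))%:C = 0.
  by rewrite ampE// (negbTE dE) [_%:C * expi _]mulrC -[expi _ * _ * _]mulrA -rmorphM -invfM -fmorphV subrr.
rewrite cmod0; apply: mulr_ge0; first exact: asymp_coef_ge0.
by rewrite divr_ge0 ?amp_ge0// ltW.
Qed.

Lemma kernel_asymp k rho : 0 < k -> 0 <= rho -> exists M r0 : R, [/\ 0 < r0, 0 <= M &
  forall x y : 'rV[R]_d, r0 <= enorm x -> enorm y <= rho -> r0 / 2 <= enorm (x - y) /\
  cmod (Phi k (x - y) - @farfield_const R d k * expi (k * enorm x) * (amp (enorm x))%:C *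
          expi (- (k * dotv (direction x) y))) <= M * (amp (enorm x) / enorm x)].
Proof.
move=> k0 rho0; have [M M0 HM] := Phi_asymp k0.
set c := @farfield_const R d k in HM *.
(* The summands account for the expansion of [Phi] at [x - y], where [amp p / p] is at most 4 times
   [amp r / r]; for the change of amplitude; and for the change of phase, where [expi_lipschitz]
   contributes the factor 2. The radius ensures [2 rho <= |x|] and [k^-1 <= |x - y|]. *)
exists (M * 4 + cmod c * (2 * rho) + cmod c * (2 * (k * rho ^+ 2))), (2 * (rho + k^-1)).
have ki0 : 0 < k^-1 by rewrite invr_gt0.
split; first by rewrite mulr_gt0// ltr_wpDl.
  by rewrite !addr_ge0 ?mulr_ge0 ?cmod_ge0 ?sqr_ge0// ltW.
move=> x y xr yr; have y0 := enorm_ge0 y.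
have r0 : 0 < enorm x by lra.
have g := enormB_ge x y; have g' := enormB_le x y.
have ex := @enormB_expand R d x y rho yr _ r0.
set r := enorm x in xr r0 g g' ex *; set p := enorm (x - y) in g g' ex *.
set s := dotv (direction x) y in ex *.
split; first lra.
have pr : r / 2 <= p by lra.
have pd : `|p - r| <= rho by rewrite ler_norml; apply/andP; split; lra.
have [a1 a2] := amp_dist r0 pr pd.
have kp : k^-1 <= p by lra.
have H1 := HM (x - y) kp.
rewrite (_ : _ - _ = (Phi k (x - y) - c * expi (k * p) * (amp p)%:C) +
   (c * expi (k * p) * (amp p - amp r)%:C) +
   (c * (amp r)%:C * (expi (k * p) - expi (k * (r - s))))); last first.
  rewrite mulrBr [k * (r - s)]mulrBr expiD rmorphB /=; ring.
apply: le_trans (cmodD _ _) _; rewrite [leRHS]mulrDl lerD//; last first.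
  rewrite !cmodM cmod_real (ger0_norm (amp_ge0 _)) -!mulrA ler_wpM2l ?cmod_ge0//.
  apply: le_trans (ler_wpM2l (amp_ge0 _) (expi_lipschitz _ _)) _.
  rewrite -mulrBr normrM gtr0_norm//.
  rewrite (_ : 2 * _ = amp r * (2 * (k * (rho ^+ 2 / r)))); last by ring.
  by rewrite ler_wpM2l ?amp_ge0// ler_wpM2l// ler_wpM2l ?(ltW k0)// ex//; lra.
apply: le_trans (cmodD _ _) _; rewrite [leRHS]mulrDl lerD//.
  by apply: le_trans H1 _; rewrite -mulrA ler_wpM2l.
by rewrite !cmodM cmod_real cmod_expi mulr1 -mulrA ler_wpM2l ?cmod_ge0.
Qed.

End kernel_asymptotics.

(** * Integrals and L^p norms of complex-valued functions *)

Section complex_integral.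
Context {disp : measure_display} {T : measurableType disp} {R : realType}.
Variables (mu : {measure set T -> \bar R}) (D : set T).
Hypothesis mD : measurable D.
Implicit Types (f g : T -> R[i]) (c : R[i]) (M : R).

Definition cmeasurable f := measurable_fun D (fun x => complex.Re (f x)) /\
  measurable_fun D (fun x => complex.Im (f x)).

Definition cintegrable f := mu.-integrable D (EFin \o (fun x => complex.Re (f x))) /\
  mu.-integrable D (EFin \o (fun x => complex.Im (f x))).

Lemma cmeasurableM f g : cmeasurable f -> cmeasurable g -> cmeasurable (fun x => f x * g x).
Proof.
move=> [fr fi] [gr gi]; split.
  under eq_fun do rewrite complex_ReM.
  apply: measurable_funB; exact: measurable_funM.
under eq_fun do rewrite complex_ImM.
by apply: measurable_funD; exact: measurable_funM.
Qed.

Lemma cmeasurableD f g : cmeasurable f -> cmeasurable g -> cmeasurable (fun x => f x + g x).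
Proof.
move=> [fr fi] [gr gi]; split.
  rewrite (_ : (fun x => _) = (fun x => complex.Re (f x) + complex.Re (g x))).
    exact: measurable_funD.
  by apply/funext => x; case: (f x); case: (g x).
rewrite (_ : (fun x => _) = (fun x => complex.Im (f x) + complex.Im (g x))).
  exact: measurable_funD.
by apply/funext => x; case: (f x); case: (g x).
Qed.

Lemma cmeasurable_cst c : cmeasurable (fun=> c).
Proof. by split; exact: measurable_cst. Qed.

Lemma cmeasurableN f : cmeasurable f -> cmeasurable (fun x => - f x).
Proof.
move=> mf; rewrite (_ : (fun x => _) = (fun x => (- 1) * f x)).
  by apply: cmeasurableM => //; exact: cmeasurable_cst.
by apply/funext => x; rewrite mulN1r.
Qed.

Lemma cmeasurable_real (u : T -> R) : measurable_fun D u -> cmeasurable (fun x => (u x)%:C).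
Proof. by move=> mu'; split => //=; exact: measurable_cst. Qed.

Lemma cmeasurable_expi (u : T -> R) : measurable_fun D u -> cmeasurable (fun x => expi (u x)).
Proof.
move=> mu'; split => /=.
  by apply: measurableT_comp mu'; apply: continuous_measurable_fun; exact: continuous_cos.
by apply: measurableT_comp mu'; apply: continuous_measurable_fun; exact: continuous_sin.
Qed.

Lemma measurable_cmod f : cmeasurable f -> measurable_fun D (fun x => cmod (f x)).
Proof.
move=> [fr fi]; rewrite (_ : (fun x => _) =
    Num.sqrt \o (fun x => complex.Re (f x) ^+ 2 + complex.Im (f x) ^+ 2)); last first.
  by apply/funext => x /=; case: (f x).
apply: measurableT_comp; first by apply: continuous_measurable_fun; exact: sqrt_continuous.
by apply: measurable_funD; exact: measurable_funX.
Qed.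

Lemma cintegrable_cmod f : cmeasurable f ->
  mu.-integrable D (EFin \o (fun x => cmod (f x))) -> cintegrable f.
Proof.
move=> [fr fi] If; split; apply: (le_integrable mD _ _ If).
- exact/measurable_EFinP.
- by move=> x _; rewrite /= lee_fin (ger0_norm (cmod_ge0 _)) Re_le_cmod.
- exact/measurable_EFinP.
- by move=> x _; rewrite /= lee_fin (ger0_norm (cmod_ge0 _)) Im_le_cmod.
Qed.

Lemma cintegralZ c f : cintegrable f -> cintegrable (fun x => c * f x) /\
  cintegral mu D (fun x => c * f x) = c * cintegral mu D f.
Proof.
case: c => a b [fr fi]; rewrite /cintegrable /cintegral.
under [X in mu.-integrable D (EFin \o X) /\ _]eq_fun do rewrite complex_ReM /=.
under [X in _ /\ mu.-integrable D (EFin \o X)]eq_fun do rewrite complex_ImM /=.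
under [X in Rintegral mu D X +i* _]eq_fun do rewrite complex_ReM /=.
under [X in _ +i* Rintegral mu D X]eq_fun do rewrite complex_ImM /=.
have Z e u : mu.-integrable D (EFin \o u) -> mu.-integrable D (EFin \o (fun x => e * u x)).
  by move=> Iu; have := integrableZl mD e Iu; apply: eq_integrable.
have Ia := Z a _ fr; have Ib := Z b _ fi; have Ic := Z a _ fi; have Id := Z b _ fr.
split.
  by split; [have := integrableB mD Ia Ib|have := integrableD mD Ic Id]; apply: eq_integrable.
rewrite (RintegralB mD Ia Ib) (RintegralD mD Ic Id) !(RintegralZl _ mD)//.
Qed.

Lemma cintegralB f g : cintegrable f -> cintegrable g -> cintegrable (fun x => f x - g x) /\
  cintegral mu D (fun x => f x - g x) = cintegral mu D f - cintegral mu D g.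
Proof.
move=> [fr fi] [gr gi]; rewrite /cintegrable /cintegral.
have er : (fun x => complex.Re (f x - g x)) = (fun x => complex.Re (f x) - complex.Re (g x)).
  by apply/funext => x; case: (f x); case: (g x).
have ei : (fun x => complex.Im (f x - g x)) = (fun x => complex.Im (f x) - complex.Im (g x)).
  by apply/funext => x; case: (f x); case: (g x).
rewrite er ei (RintegralB mD fr gr) (RintegralB mD fi gi); split => //.
by split; [have := integrableB mD fr gr|have := integrableB mD fi gi]; apply: eq_integrable.
Qed.

(** Let the integral be [a + i b] with modulus [N]. Then [N ^ 2] is the integral of
    [a Re f + b Im f], which is at most [N |f|] pointwise by the Cauchy-Schwarz inequality in the
    plane; dividing by [N] gives the claim. *)
Lemma cmod_cintegral_le f : cmeasurable f -> mu.-integrable D (EFin \o (fun x => cmod (f x))) ->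
  cmod (cintegral mu D f) <= Rintegral mu D (fun x => cmod (f x)).
Proof.
move=> mf If; have [fr fi] := cintegrable_cmod mf If.
rewrite /cintegral cmodE; set a := Rintegral mu D _; set b := Rintegral mu D _.
set c := Rintegral mu D _; set N := Num.sqrt _.
have [->|N0] := eqVneq N 0; first by apply: Rintegral_ge0 => x _; exact: cmod_ge0.
have Np : 0 < N by rewrite lt_def N0 sqrtr_ge0.
have N2 : N ^+ 2 = a ^+ 2 + b ^+ 2 by rewrite sqr_sqrtr// addr_ge0 ?sqr_ge0.
have Z e u : mu.-integrable D (EFin \o u) -> mu.-integrable D (EFin \o (fun x => e * u x)).
  by move=> Iu; have := integrableZl mD e Iu; apply: eq_integrable.
rewrite -(ler_pM2l Np) -expr2 N2 /c -(RintegralZl N mD If).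
have -> : a ^+ 2 + b ^+ 2 =
    Rintegral mu D (fun x => a * complex.Re (f x) + b * complex.Im (f x)).
  by rewrite (RintegralD mD (Z a _ fr) (Z b _ fi)) (RintegralZl a mD fr) (RintegralZl b mD fi).
apply: (le_Rintegral mD).
- by have := integrableD mD (Z a _ fr) (Z b _ fi); apply: eq_integrable.
- exact: Z.
move=> x _; case: (f x) => u v; rewrite /N cmodE /= -sqrtrM ?addr_ge0 ?sqr_ge0//.
apply: le_trans (ler_norm _) _; rewrite -sqrtr_sqr ler_wsqrtr//.
rewrite -subr_ge0 (_ : _ - _ = (a * v - b * u) ^+ 2); [exact: sqr_ge0|ring].
Qed.

Hypothesis Doo : (mu D < +oo)%E.

Lemma ae_bounded_integrable (u : T -> R) M : measurable_fun D u -> 0 <= M ->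
  {ae mu, forall x, D x -> `|u x| <= M} -> mu.-integrable D (EFin \o u) /\
  `|Rintegral mu D u| <= M * fine (mu D).
Proof.
move=> mu' M0 uM.
have le : (\int[mu]_(x in D) `|(u x)%:E| <= M%:E * mu D)%E.
  rewrite -(integral_cst _ mD); apply: ae_ge0_le_integral => //.
  by apply/measurable_EFinP; exact: measurableT_comp.
have fD : mu D \is a fin_num by rewrite ge0_fin_numE.
have lt : (\int[mu]_(x in D) `|(u x)%:E| < +oo)%E.
  by apply: le_lt_trans le _; rewrite -(fineK fD) -EFinM ltry.
have Iu : mu.-integrable D (EFin \o u).
  by apply/integrableP; split => //; exact/measurable_EFinP.
split => //; apply: le_trans (le_normr_Rintegral mD Iu) _.
rewrite /Rintegral -lee_fin fineK; last by rewrite ge0_fin_numE ?integral_ge0.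
by apply: le_trans le _; rewrite EFinM fineK.
Qed.

Lemma ae_bounded_cintegrable f M : cmeasurable f -> 0 <= M ->
  {ae mu, forall x, D x -> cmod (f x) <= M} -> cintegrable f /\
  cmod (cintegral mu D f) <= M * fine (mu D).
Proof.
move=> mf M0 fM; have mc := measurable_cmod mf.
have [|Ic cM] := ae_bounded_integrable mc M0.
  by apply: filterS fM => x fM Dx; rewrite (ger0_norm (cmod_ge0 _)) fM.
split; first exact: cintegrable_cmod.
by apply: le_trans (cmod_cintegral_le mf Ic) _; rewrite (le_trans (ler_norm _)).
Qed.

End complex_integral.

Section Lp_norms.
Context {disp : measure_display} {T : measurableType disp} {R : realType}.
Variables (mu : {measure set T -> \bar R}) (D : set T).
Hypothesis mD : measurable D.
Implicit Types (f g : T -> R[i]) (M : R).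

Lemma restrict_cmod f x : D x -> ((fun x => (cmod (f x))%:E) \_ D) x = (cmod (f x))%:E.
Proof. by move=> Dx; rewrite patchE mem_set. Qed.

Lemma Lpoo_leP f M : 0 <= M ->
  (Lp_norm mu D +oo f <= M%:E)%E <-> {ae mu, forall x, D x -> cmod (f x) <= M}.
Proof.
(* On a space of measure zero the L^oo norm is 0 by convention, and every property holds almost
   everywhere. *)
move=> M0; rewrite /Lp_norm unlock; have [mu0|mu0] := ltP 0%E (mu [set: T]); last first.
  split=> [_|_]; last by rewrite lee_fin.
  exists setT; split => //; apply/eqP; rewrite eq_le mu0/=; exact: measure_ge0.
split.
  move=> /ess_supP; apply: filterS => x + Dx; rewrite /= restrict_cmod//= lee_fin.
  by rewrite ger0_norm// cmod_ge0.
move=> H; apply/ess_supP; apply: filterS H => x H /=; rewrite patchE.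
case: ifPn => [/set_mem Dx|_] /=; last by rewrite normr0 lee_fin.
by rewrite lee_fin ger0_norm ?cmod_ge0// H.
Qed.

Lemma in_Lpoo_ae f : in_Lp mu D +oo f -> cmeasurable D f /\
  exists2 M, 0 <= M & {ae mu, forall x, D x -> cmod (f x) <= M}.
Proof.
move=> [mr mi lt]; split => //.
have ge : (0 <= Lp_norm mu D +oo f)%E by exact: Lnorm_ge0.
exists (fine (Lp_norm mu D +oo f)); first exact: fine_ge0.
by apply/Lpoo_leP; [exact: fine_ge0|rewrite fineK// ge0_fin_numE].
Qed.

Lemma ae_in_Lpoo f M : cmeasurable D f -> 0 <= M ->
  {ae mu, forall x, D x -> cmod (f x) <= M} -> in_Lp mu D +oo f.
Proof.
move=> [mr mi] M0 fM; split => //.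
by apply: le_lt_trans (ltry M); apply/Lpoo_leP.
Qed.

Lemma Lp2_sqr f : (Lp_norm mu D 2%:E f `^ 2 = \int[mu]_(x in D) (cmod (f x) ^+ 2)%:E)%E.
Proof.
rewrite /Lp_norm powR_Lnorm// [RHS]integral_mkcond; apply: eq_integral => x _.
rewrite !patchE; case: ifPn => _ /=; last by rewrite normr0 powR0.
by rewrite ger0_norm ?cmod_ge0// -[2]/(2%:R) powR_mulrn ?cmod_ge0.
Qed.

Lemma Lp2_lt f (e : R) : 0 <= e -> (Lp_norm mu D 2%:E f < e%:E)%E ->
  (\int[mu]_(x in D) (cmod (f x) ^+ 2)%:E <= (e ^+ 2)%:E)%E.
Proof.
move=> e0 lt; rewrite -Lp2_sqr.
have ge : (0 <= Lp_norm mu D 2%:E f)%E by exact: Lnorm_ge0.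
have fn : Lp_norm mu D 2%:E f \is a fin_num by rewrite ge0_fin_numE// (lt_trans lt)// ltry.
move: lt ge; rewrite -(fineK fn) lte_fin !lee_fin => lt ge.
by rewrite powR_mulrn// lerXn2r ?nnegrE// ltW.
Qed.

Lemma ae_in_Lp2 f M : (mu D < +oo)%E -> cmeasurable D f -> 0 <= M ->
  {ae mu, forall x, D x -> cmod (f x) <= M} -> in_Lp mu D 2%:E f.
Proof.
move=> Doo mf M0 fM; have [mr mi] := mf; split => //.
have fD : mu D \is a fin_num by rewrite ge0_fin_numE.
have le : (\int[mu]_(x in D) (cmod (f x) ^+ 2)%:E <= (M ^+ 2)%:E * mu D)%E.
  rewrite -(integral_cst _ mD); apply: ae_ge0_le_integral => //.
  - by move=> x _; rewrite lee_fin sqr_ge0.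
  - by apply/measurable_EFinP; apply: measurable_funX; exact: measurable_cmod.
  - by move=> x _; rewrite lee_fin sqr_ge0.
  - by apply: filterS fM => x fM Dx; rewrite lee_fin lerXn2r ?nnegrE ?cmod_ge0// fM.
have {}le : (Lp_norm mu D 2%:E f `^ 2 < +oo)%E.
  by rewrite Lp2_sqr; apply: le_lt_trans le _; rewrite -(fineK fD) -EFinM ltry.
have ge : (0 <= Lp_norm mu D 2%:E f)%E by exact: Lnorm_ge0.
move: le ge; case: (Lp_norm mu D 2%:E f) => [r _ _||//]; first exact: ltry.
by rewrite /= gt_eqF.
Qed.

(** Hoelder's inequality against the constant 1 on [D], whose L^2 norm [sqrt (mu D)] cancels the
    denominator in the hypothesis. On the sphere that denominator is the one in [dom_F]. *)
Lemma cmod_integrable_Lp2 f (C : R) : (mu D < +oo)%E -> in_Lp mu D 2%:E f -> 0 <= C ->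
  (Lp_norm mu D 2%:E f <= (C / Num.sqrt (fine (mu D)))%:E)%E ->
  mu.-integrable D (EFin \o (fun x => cmod (f x))) /\ Rintegral mu D (fun x => cmod (f x)) <= C.
Proof.
move=> Doo [mr mi lt] C0 le; have mf : cmeasurable D f by [].
have fD : mu D \is a fin_num by rewrite ge0_fin_numE.
pose u := (fun x => cmod (f x)) \_ D; pose v := (fun=> 1 : R) \_ D : T -> R.
have mu' : measurable_fun [set: T] u.
  by apply/measurable_restrict => //; rewrite setTI; exact: measurable_cmod.
have mv : measurable_fun [set: T] v.
  by apply/measurable_restrict => //; rewrite setTI; exact: measurable_cst.
have := hoelder mu mu' mv (ltr0Sn R 1) (ltr0Sn R 1).
have half : 2^-1 + 2^-1 = 1 :> R by field.
move=> /(_ half).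
have -> : 'N[mu]_1[EFin \o (u \* v)%R]%E = (\int[mu]_(x in D) (cmod (f x))%:E)%E.
  rewrite Lnorm1 [RHS]integral_mkcond; apply: eq_integral => x _.
  rewrite /= /u /v !patchE; case: ifPn => _ /=; last by rewrite mul0r normr0.
  by rewrite mulr1 ger0_norm// cmod_ge0.
have -> : 'N[mu]_2%:E[EFin \o u]%E = Lp_norm mu D 2%:E f.
  by apply: eq_Lnorm => x; rewrite /= /u !patchE; case: ifPn.
have -> : 'N[mu]_2%:E[EFin \o v]%E = (Num.sqrt (fine (mu D)))%:E.
  rewrite unlock /=.
  rewrite (_ : (\int[mu]_x _)%E = mu D); last first.
    rewrite -[RHS]mul1e -(integral_cst _ mD) [RHS]integral_mkcond; apply: eq_integral => x _.
    rewrite /= /v !patchE; case: ifPn => _ /=; last by rewrite normr0 powR0.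
    by rewrite normr1 powR1.
  by rewrite -{1}(fineK fD) poweR_EFin powR12_sqrt// fine_ge0.
move=> H.
have {}H : (\int[mu]_(x in D) (cmod (f x))%:E <= C%:E)%E.
  apply: le_trans H _; apply: (@le_trans _ _ ((C / Num.sqrt (fine (mu D)))%:E * (Num.sqrt (fine (mu D)))%:E)%E).
    by apply: lee_wpmul2r => //; rewrite lee_fin sqrtr_ge0.
  rewrite -EFinM lee_fin; have [->|n0] := eqVneq (Num.sqrt (fine (mu D))) 0; first by rewrite mulr0.
  by rewrite divfK.
split; last first.
  rewrite /Rintegral -lee_fin fineK// ge0_fin_numE.
    by apply: le_lt_trans H _; rewrite ltry.
  by apply: integral_ge0 => x _; rewrite lee_fin cmod_ge0.
apply/integrableP; split; first exact/measurable_EFinP/measurable_cmod.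
apply: le_lt_trans (ltry C); apply: le_trans H; apply: ge0_le_integral => //.
- by apply/measurable_EFinP; apply: measurableT_comp => //; exact: measurable_cmod.
- exact/measurable_EFinP/measurable_cmod.
- by move=> x _; rewrite /= lee_fin ger0_norm// cmod_ge0.
Qed.

(* Chebyshev's inequality on the sets where [M + 1/(n+1) <= |f|]. *)
Lemma Lp2_closure_bounded f M : cmeasurable D f -> 0 <= M ->
  (forall e : R, 0 < e -> exists g, [/\ cmeasurable D g,
     forall x, D x -> cmod (g x) <= M & (Lp_norm mu D 2%:E (fun x => (f x - g x)%R) < e%:E)%E]) ->
  {ae mu, forall x, D x -> cmod (f x) <= M}.
Proof.
move=> mf M0 fg; pose A n := D `&` [set x | M + n.+1%:R^-1 <= cmod (f x)].
have mA n : measurable (A n).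
  have := measurable_cmod mf mD (measurable_itv `[M + n.+1%:R^-1, +oo[).
  by congr measurable; apply/seteqP; split => x /=; rewrite in_itv/= andbT.
have A0 n : mu (A n) = 0%E.
  pose r : R := n.+1%:R^-1; have r0 : 0 < r by rewrite invr_gt0.
  have small (e : R) : 0 < e -> ((r ^+ 2)%:E * mu (A n) <= (e ^+ 2)%:E)%E.
    move=> e0; have [g [mg gM gl]] := fg e e0.
    apply: le_trans (Lp2_lt (ltW e0) gl); rewrite -(integral_cst _ (mA n)).
    have mfg : cmeasurable D (fun x => f x - g x) by apply: cmeasurableD => //; exact: cmeasurableN.
    have m2 : measurable_fun D (fun x => (cmod (f x - g x) ^+ 2)%:E).
      by apply/measurable_EFinP; apply: measurable_funX; exact: measurable_cmod.
    have AD : A n `<=` D by move=> x [].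
    apply: (@le_trans _ _ (\int[mu]_(x in A n) (cmod (f x - g x) ^+ 2)%:E)%E); last first.
      by apply: ge0_subset_integral => // x _; rewrite lee_fin sqr_ge0.
    apply: ge0_le_integral => //.
    - by move=> x _; rewrite lee_fin sqr_ge0.
    - exact: measurable_funS m2.
    - move=> x [Dx fx]; rewrite lee_fin lerXn2r ?nnegrE ?cmod_ge0 ?(ltW r0)//.
      have := cmodD (f x - g x) (g x); rewrite subrK => h; have := gM x Dx; rewrite /= in fx.
      move: fx; rewrite -/r; lra.
  apply/eqP; rewrite eq_le measure_ge0 andbT leNgt; apply/negP => pos.
  have [fin|] := boolP (mu (A n) \is a fin_num); last first.
    rewrite ge0_fin_numE// -leNgt leye_eq => /eqP Ay; have := small 1 ltr01.
    by rewrite Ay gt0_muley ?lte_fin ?exprn_gt0// leye_eq.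
  move: pos (small); rewrite -(fineK fin); set m := fine _; rewrite lte_fin => m0 {}small.
  (* This choice makes [e ^ 2] a quarter of [r ^ 2 * m], which contradicts [r ^ 2 * m <= e ^ 2]
     because [m > 0]. *)
  have e0 : 0 < r * Num.sqrt m / 2 by rewrite !mulr_gt0 ?sqrtr_gt0.
  have := small _ e0; rewrite -EFinM lee_fin !exprMn sqr_sqrtr ?(ltW m0)//.
  have := mulr_gt0 (exprn_gt0 2 r0) m0; move: (r ^+ 2 * m) => q q0; rewrite expr2; lra.
apply: (@negligibleS _ _ _ mu (\bigcup_n A n)); last first.
  by apply: negligible_bigcup => n; exists (A n); split.
move=> x /= /not_implyP[Dx /negP]; rewrite -ltNge => Mf.
have [n /= nl] : exists n : nat, (cmod (f x) - M)^-1 <= n%:R.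
  by exists (Num.trunc (cmod (f x) - M)^-1).+1; rewrite ltW// truncnS_gt.
exists n => //; split => //=; rewrite -lerBrDl -[leRHS]invrK lef_pV2 ?posrE ?invr_gt0 ?subr_gt0//.
by rewrite (le_trans nl)// ler_nat.
Qed.

End Lp_norms.

(** * Measurable sets and functions on R^n *)

Section rV_sets.
Context {R : realType}.

Lemma measurable_rV_forall n (P : 'I_n -> set R) : (forall i, measurable (P i)) ->
  measurable [set x : 'rV[R]_n | forall i, P i (x ord0 i)].
Proof.
move=> mP; rewrite (_ : [set x | _] = \bigcap_(i in [set: 'I_n]) ((fun x : 'rV[R]_n => x ord0 i) @^-1` P i)).
  apply: fin_bigcap_measurable => // i _.
  by rewrite -[X in measurable X]setTI; exact: measurable_rV_coord.
by apply/seteqP; split => x /= H i; [move=> _; exact: H|exact: H].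
Qed.

(* An open set is the union of the countably many cubes of this form that it contains. *)
Definition grid_cube n (p : nat * 'rV[int]_n) : set 'rV[R]_n :=
  [set x | forall i, `[(p.2 ord0 i)%:~R / p.1.+1%:R, (p.2 ord0 i + 1)%:~R / p.1.+1%:R[%classic (x ord0 i)].

Lemma open_measurable_rV n (D : set 'rV[R]_n) : open D -> measurable D.
Proof.
move=> oD; pose F p := if `[< grid_cube p `<=` D >] then grid_cube p else set0 : set 'rV[R]_n.
rewrite (_ : D = \bigcup_p F p).
  apply: countable_bigcupT_measurable; first exact: countableP.
  move=> p; rewrite /F; case: ifPn => _ //.
  apply: (@measurable_rV_forall n (fun i => `[(p.2 ord0 i)%:~R / p.1.+1%:R, (p.2 ord0 i + 1)%:~R / p.1.+1%:R[%classic)).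
  by move=> i; exact: measurable_itv.
apply/seteqP; split => [x Dx|x [p _]]; last by rewrite /F; case: ifPn => [/asboolP|//]; apply.
have /nbhs_ballP[e /= e0 eD] := open_nbhs_nbhs (conj oD Dx : open_nbhs x D).
have [m me] : exists m : nat, e^-1 <= m%:R.
  by exists (Num.trunc e^-1).+1; rewrite ltW// truncnS_gt.
have m0 : 0 < m.+1%:R :> R by rewrite ltr0n.
pose z : 'rV[int]_n := \row_i Num.floor (x ord0 i * m.+1%:R).
have me' : m.+1%:R^-1 < e.
  rewrite -[ltRHS]invrK ltf_pV2 ?posrE ?invr_gt0//.
  by rewrite (le_lt_trans me)// ltr_nat.
have xz : grid_cube (m, z) x.
  move=> i; rewrite /= in_itv/= /z mxE ler_pdivrMr// ltr_pdivlMr//.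
  by rewrite floor_le_tmp /= floorD1_gt.
exists (m, z) => //; rewrite /F asboolT// => y yz; apply: eD; split => //= i j.
rewrite ord1; have /= := xz j; have /= := yz j; rewrite !in_itv/= intrD mulrDl => /andP[y1 y2] /andP[x1 x2].
rewrite /ball /=; apply: le_lt_trans me'; move: x1 x2 y1 y2.
rewrite mulr1z div1r; set c := _ / _; set h := _^-1.
have -> : (0 : 'I_1) = ord0 by [].
set a := x _ _; set b := y _ _ => x1 x2 y1 y2.
by rewrite ler_norml; apply/andP; split; lra.
Qed.

Definition sup_box n (M : R) : set 'rV[R]_n := [set x | forall i, `|x ord0 i| <= M].

Lemma measurable_sup_box n M : measurable (@sup_box n M).
Proof.
apply: (@measurable_rV_forall n (fun=> [set r : R | `|r| <= M])) => i.
rewrite (_ : [set r | _] = `[- M, M]%classic); first exact: measurable_itv.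
by apply/seteqP; split => r /=; rewrite in_itv/= ler_norml.
Qed.

Lemma sup_box_lty n M : 0 <= M -> (lebesgue n (@sup_box n M) < +oo)%E.
Proof.
move=> M0; elim: n => [|n IH].
  by rewrite /lebesgue /= diracE ltry.
rewrite /= /lebesgue_cons /pushforward.
rewrite (_ : _ @^-1` _ = `[- M, M]%classic `*` @sup_box n M); last first.
  apply/seteqP; split => -[a x] /=.
    move=> H; split; first by have := H ord0; rewrite /consrV mxE unlift_none /= in_itv/= ler_norml.
    by move=> j; have := H (lift ord0 j); rewrite /consrV mxE liftK.
  rewrite in_itv/= -ler_norml => -[aM xM] i; rewrite /consrV mxE.
  by case: (unliftP ord0 i) => [j _|_] /=.
rewrite product_measure1E; [|exact: measurable_itv|exact: measurable_sup_box].
have lt1 : (@lebesgue_measure R `[(- M)%R, M] < +oo)%E.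
  by rewrite lebesgue_measure_itv /=; case: ifP => _; rewrite ?ltry// -EFinB ltry.
by rewrite lte_mul_pinfty ?measure_ge0// ge0_fin_numE ?measure_ge0.
Qed.

Lemma bounded_sup_box n (D : set 'rV[R]_n) : bounded_set D ->
  exists2 M, 0 <= M & D `<=` @sup_box n M.
Proof.
move=> [M [_ HM]]; exists (`|M| + 1); first by rewrite addr_ge0.
have MM : M < `|M| + 1 by rewrite (le_lt_trans (ler_norm M))// ltrDl.
move=> x Dx i; apply: le_trans (HM _ MM x Dx).
rewrite [leRHS]/Num.norm/= mx_normrE.
exact: (le_bigmax _ (fun ij : 'I_1 * 'I_n => `|x ij.1 ij.2|) (ord0, i)).
Qed.


Lemma enorm_le_coord n (x : 'rV[R]_n) (e : R) : (forall i, `|x ord0 i| <= e) -> enorm x <= n%:R * e.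
Proof.
case: n x => [|n] x xe.
  by rewrite /enorm /dotv big_ord0 sqrtr0 mul0r.
have e0 : 0 <= e by apply: le_trans (xe ord0).
rewrite -(@ler_pXn2r _ 2)// ?nnegrE ?enorm_ge0 ?mulr_ge0// enorm_sqr exprMn.
apply: (@le_trans _ _ (\sum_(i < n.+1) e ^+ 2)).
  by apply: ler_sum => i _; rewrite -expr2 -real_normK ?num_real// lerXn2r ?nnegrE.
rewrite sumr_const card_ord -(mulr_natl (e ^+ 2)) ler_wpM2r ?sqr_ge0//.
by rewrite expr2 ler_peMr// ler1n.
Qed.

Lemma bounded_set_lty n (D : set 'rV[R]_n) : measurable D -> bounded_set D ->
  (lebesgue n D < +oo)%E.
Proof.
move=> mD /bounded_sup_box[M M0 DM]; apply: le_lt_trans (@sup_box_lty n M M0).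
by apply: le_measure; rewrite ?inE//; exact: measurable_sup_box.
Qed.

Lemma bounded_set_enorm n (D : set 'rV[R]_n) : bounded_set D ->
  exists2 rho : R, 0 <= rho & forall y, D y -> enorm y <= rho.
Proof.
move=> /bounded_sup_box[M M0 DM]; exists (n%:R * M); first by rewrite mulr_ge0.
by move=> y /DM; exact: enorm_le_coord.
Qed.

Lemma coord_le_enorm n (x : 'rV[R]_n) i : `|x ord0 i| <= enorm x.
Proof.
rewrite -sqrtr_sqr ler_wsqrtr// /dotv (bigD1 i)//= -expr2 lerDl.
by apply: sumr_ge0 => j _; rewrite -expr2 sqr_ge0.
Qed.

(** Superlevel sets are open: a sup-norm ball of radius [e] moves the argument by at most [n * e] in
    [enorm]. The [+ 1] in the denominator of [e] keeps it positive when [K * n = 0]. The lemma makes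
    parameter integrals measurable from a Lipschitz bound in the parameter alone. *)
Lemma enorm_lipschitz_measurable n (f : 'rV[R]_n -> R) (K : R) : 0 <= K ->
  (forall x y, `|f x - f y| <= K * enorm (x - y)) -> measurable_fun [set: _] f.
Proof.
move=> K0 fK mT; apply: (measurability _ (RGenOInfty.measurableE R)) => // _ [_ [a ->] <-].
rewrite setTI; apply: open_measurable_rV.
rewrite openE => x; rewrite /= in_itv/= andbT => afx.
apply/nbhs_ballP; pose e := (f x - a) / (K * n%:R + 1).
have d0 : 0 < K * n%:R + 1 by rewrite ltr_wpDl// mulr_ge0.
have e0 : 0 < e by rewrite divr_gt0// subr_gt0.
exists e => //= y [_ xy]; rewrite /= in_itv/= andbT.
have := fK x y; have := @enorm_le_coord n (x - y) e _.
have h : forall i, `|(x - y) ord0 i| <= e.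
  by move=> i; rewrite !mxE ltW//; exact: xy.
move=> /(_ h) le1 le2; have := ler_wpM2l K0 le1.
have ed : e * (K * n%:R + 1) = f x - a by rewrite divfK// gt_eqF.
have := ler_norm (f x - f y); rewrite -subr_gt0; lra.
Qed.

Lemma measurable_unit_sphere n : measurable (@unit_sphere R n).
Proof.
rewrite (_ : @unit_sphere R n = @enorm R n @^-1` [set 1]); last by apply/seteqP; split.
by rewrite -[X in measurable X]setTI; exact: measurable_enorm.
Qed.

Lemma sphere_measure_lty n : (@sphere_measure R n (@unit_sphere R n) < +oo)%E.
Proof.
rewrite /sphere_measure /= /mscale /= /pushforward /= /mrestr /=.
rewrite lte_mul_pinfty//; apply: le_lt_trans (@sup_box_lty n 1 ler01).
apply: le_measure; rewrite ?inE.
- apply: measurableI; last exact: measurable_punctured_ball.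
  rewrite -[X in measurable X]setTI; apply: measurable_direction => //; exact: measurable_unit_sphere.
- exact: measurable_sup_box.
- move=> x [_ /= /andP[_ x1]] i; exact: le_trans (coord_le_enorm x i) x1.
Qed.

Lemma measurable_subv n (x : 'rV[R]_n) : measurable_fun [set: 'rV[R]_n] (fun y => x - y).
Proof.
apply: measurable_fun_rV => i; under eq_fun do rewrite !mxE.
by apply: measurable_funB; [exact: measurable_cst|exact: measurable_rV_coord].
Qed.

Lemma measurable_dotv n (x : 'rV[R]_n) : measurable_fun [set: 'rV[R]_n] (dotv x).
Proof.
by apply: measurable_sum => i; apply: measurable_funM; [exact: measurable_cst|exact: measurable_rV_coord].
Qed.

End rV_sets.

Section Phi_measurable.
Context {R : realType} {d : nat}.

Lemma measurable_besselJ0 : measurable_fun [set: R] (@besselJ0 R).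
Proof.
rewrite (_ : @besselJ0 R = pserq j0_coef); last by apply/funext => t; rewrite besselJ0E.
by apply: continuous_measurable_fun; exact: continuous_pserq entire_j0.
Qed.

Lemma measurable_besselY0 : measurable_fun [set: R] (@besselY0 R).
Proof.
rewrite (_ : @besselY0 R = fun t => 2 / pi * (ln (t / 2) + euler_gamma) * besselJ0 t - 2 / pi * pserq y0_coef t); last first.
  by apply/funext => t; rewrite besselY0E.
have mhalf : measurable_fun [set: R] (fun t : R => t / 2).
  by apply: measurable_funM => //; exact: measurable_cst.
apply: measurable_funB.
  apply: measurable_funM; last exact: measurable_besselJ0.
  apply: measurable_funM; first exact: measurable_cst.
  apply: measurable_funD; last exact: measurable_cst.
  exact: measurableT_comp (@measurable_ln R) mhalf.
apply: measurable_funM; first exact: measurable_cst.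
by apply: continuous_measurable_fun; exact: continuous_pserq entire_y0.
Qed.

Lemma cmeasurable_Phi (k : R) (D : set 'rV[R]_d) (x : 'rV[R]_d) :
  cmeasurable D (fun y => Phi k (x - y)).
Proof.
have mn : measurable_fun [set: 'rV[R]_d] (fun y => enorm (x - y)).
  exact: measurableT_comp (@measurable_enorm R d) (measurable_subv x).
have mkn : measurable_fun D (fun y => k * enorm (x - y)).
  by apply: measurable_funTS; apply: measurable_funM => //; exact: measurable_cst.
rewrite /Phi; case: (d == 2%N).
  apply: (@cmeasurableM _ _ _ _ (fun=> (0 +i* 1) / 4)); first exact: cmeasurable_cst.
  split => /=.
    exact: measurableT_comp measurable_besselJ0 mkn.
  exact: measurableT_comp measurable_besselY0 mkn.
apply: cmeasurableM; first exact: cmeasurable_expi.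
have -> : (fun y => ((4 * pi * enorm (x - y))%:C)^-1) =
    (fun y => ((4 * pi * enorm (x - y)) `^ (-1))%:C).
  by apply/funext => y; rewrite powR_inv1 ?fmorphV// !mulr_ge0 ?pi_ge0 ?enorm_ge0.
apply: cmeasurable_real; apply: measurable_funTS.
apply: measurableT_comp (measurable_powR (-1)) _.
by apply: measurable_funM => //; exact: measurable_cst.
Qed.

End Phi_measurable.

(** * Herglotz operators and far field patterns *)

Section oscillatory.
Context {R : realType} {d : nat} (mu : {measure set 'rV[R]_d -> \bar R}) (D : set 'rV[R]_d).
Hypothesis mD : measurable D.
Variables (phi : 'rV[R]_d -> R[i]) (t rho : R).
Hypothesis mphi : cmeasurable D phi.
Hypothesis Iphi : mu.-integrable D (EFin \o (fun y => cmod (phi y))).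
Hypothesis rho0 : 0 <= rho.
Hypothesis Drho : forall y, D y -> enorm y <= rho.

(** One integral covers both operators: [herglotz] is the case of the surface measure with [t = k],
    and [herglotz_adj] that of Lebesgue measure with [t = - k]. *)
Let osc x := cintegral mu D (fun y => phi y * expi (t * dotv x y)).

Lemma cmeasurable_osc_integrand x : cmeasurable D (fun y => phi y * expi (t * dotv x y)).
Proof.
apply: cmeasurableM => //; apply: cmeasurable_expi; apply: measurable_funTS.
by apply: measurable_funM; [exact: measurable_cst|exact: measurable_dotv].
Qed.

Let osc_cmod x : (fun y => cmod (phi y * expi (t * dotv x y))) = (fun y => cmod (phi y)).
Proof. by apply/funext => y; rewrite cmodM cmod_expi mulr1. Qed.

Lemma osc_integrable x : cintegrable mu D (fun y => phi y * expi (t * dotv x y)).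
Proof.
by apply: cintegrable_cmod => //; [exact: cmeasurable_osc_integrand|rewrite osc_cmod].
Qed.

Lemma osc_le x : cmod (osc x) <= Rintegral mu D (fun y => cmod (phi y)).
Proof.
rewrite -(osc_cmod x); apply: cmod_cintegral_le => //.
  exact: cmeasurable_osc_integrand.
by rewrite osc_cmod.
Qed.

Lemma osc_lipschitz x x' : cmod (osc x - osc x') <=
  2 * `|t| * rho * Rintegral mu D (fun y => cmod (phi y)) * enorm (x - x').
Proof.
have [_ <-] := cintegralB mD (osc_integrable x) (osc_integrable x').
have m := cmeasurableD (cmeasurable_osc_integrand x) (cmeasurableN (cmeasurable_osc_integrand x')).
set h := (fun y => _ - _) in m *.
set K := 2 * `|t| * rho * enorm (x - x').
have K0 : 0 <= K by rewrite !mulr_ge0 ?enorm_ge0.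
have hK y : D y -> cmod (h y) <= K * cmod (phi y).
  move=> Dy; rewrite /h -mulrBr cmodM mulrC ler_wpM2r ?cmod_ge0//.
  apply: le_trans (expi_lipschitz _ _) _; rewrite -mulrBr normrM /K -!mulrA ler_wpM2l// ler_wpM2l//.
  have -> : dotv x y - dotv x' y = dotv (x - x') y by rewrite dotvDl dotvNl.
  by rewrite (le_trans (dotv_cauchy _ _))// mulrC ler_wpM2r ?enorm_ge0// Drho.
have IK : mu.-integrable D (EFin \o (fun y => K * cmod (phi y))).
  by have := integrableZl mD K Iphi; apply: eq_integrable.
have Ih : mu.-integrable D (EFin \o (fun y => cmod (h y))).
  apply: le_integrable IK => //; first exact/measurable_EFinP/measurable_cmod.
  move=> y Dy; rewrite /= lee_fin (ger0_norm (cmod_ge0 _)).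
  exact: le_trans (hK _ Dy) (ler_norm _).
apply: le_trans (cmod_cintegral_le mD m Ih) _.
rewrite mulrAC -/K -RintegralZl//; exact: le_Rintegral.
Qed.

Lemma cmeasurable_osc : cmeasurable setT osc.
Proof.
set K := 2 * `|t| * rho * Rintegral mu D (fun y => cmod (phi y)).
have K0 : 0 <= K.
  by rewrite !mulr_ge0//; apply: Rintegral_ge0 => y _; exact: cmod_ge0.
split; apply: (enorm_lipschitz_measurable K0) => x y; apply: le_trans (osc_lipschitz x y).
  by apply: le_trans (Re_le_cmod _); case: (osc x) => a b; case: (osc y).
by apply: le_trans (Im_le_cmod _); case: (osc x) => a b; case: (osc y).
Qed.

End oscillatory.

(** * Uniqueness and existence of the far field pattern *)

Section far_field.
Context {R : realType} {d : nat} (k : R).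
Hypothesis d23 : d = 2%N \/ d = 3%N.
Hypothesis k0 : 0 < k.

Lemma cmod_farfield_const : 0 < cmod (@farfield_const R d k).
Proof.
rewrite /farfield_const; case: (d == 2%N).
  rewrite -fmorphV cmodM cmod_expi mul1r cmod_real normr_gt0 invr_eq0 gt_eqF//.
  by rewrite sqrtr_gt0 !mulr_gt0 ?pi_gt0.
by rewrite cmod_real normr_gt0 invr_eq0 gt_eqF// mulr_gt0 ?pi_gt0.
Qed.

(** Along the ray [r *: x] the direction is constantly [x], so subtracting the two expansions and
    dividing by the amplitude bounds [c |w1 x - w2 x|] by [(M1 + M2) / r] for all large [r]. *)
Lemma farfield_unique v (w1 w2 : 'rV[R]_d -> R[i]) : is_farfield k v w1 -> is_farfield k v w2 ->
  forall x, unit_sphere x -> w1 x = w2 x.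
Proof.
move=> [_ [M1 [r1 [r10 H1]]]] [_ [M2 [r2 [r20 H2]]]] x x1.
have ex r : 0 < r -> enorm (r *: x) = r.
  move=> r0; rewrite /enorm dotvZl dotvC dotvZl mulrA -expr2 sqrtrM ?sqr_ge0//.
  by rewrite sqrtr_sqr gtr0_norm// -/(enorm x) x1 mulr1.
have dx r : 0 < r -> direction (r *: x) = x.
  by move=> r0; rewrite /direction ex// scalerA mulVf ?scale1r// gt_eqF.
have c0 := cmod_farfield_const; set c := cmod _ in c0.
have le r : r1 <= r -> r2 <= r -> c * cmod (w1 x - w2 x) <= (M1 + M2) / r.
  move=> r1r r2r; have r0 : 0 < r := lt_le_trans r10 r1r.
  have a0 : 0 < @amp R d r by rewrite powR_gt0.
  have := H1 (r *: x); have := H2 (r *: x); rewrite ex// dx// amp_err// => /(_ r2r) e2 /(_ r1r) e1.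
  set B := @farfield_const R d k * expi (k * r) * (@amp R d r)%:C.
  have cB : c * @amp R d r = cmod B.
    by rewrite /B !cmodM cmod_expi mulr1 cmod_real ger0_norm// ltW.
  rewrite -(ler_pM2r a0).
  have -> : c * cmod (w1 x - w2 x) * @amp R d r = cmod (B * (w1 x - w2 x)).
    by rewrite cmodM -cB mulrAC.
  have -> : B * (w1 x - w2 x) = (v (r *: x) - B * w2 x) + - (v (r *: x) - B * w1 x) by ring.
  apply: le_trans (cmodD _ _) _; rewrite cmodN.
  apply: le_trans (lerD e2 e1) _; rewrite -mulrDl [M2 + M1]addrC mulrA mulrAC.
  exact: lexx.
apply/eqP; rewrite -subr_eq0; apply/eqP; apply: Normc.eq0_normc; apply/eqP.
rewrite eq_le cmod_ge0 andbT leNgt; apply/negP => w0.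
have [M M0 MM] : exists2 M, 0 < M & M1 + M2 <= M.
  exists (`|M1 + M2| + 1); first by rewrite ltr_wpDl.
  by rewrite (le_trans (ler_norm _))// lerDl.
have cw : 0 < c * cmod (w1 x - w2 x) by rewrite mulr_gt0.
(* Beyond both radii, and large enough that [(M1 + M2) / r] falls below [c |w1 x - w2 x|] if the
   latter is positive. *)
pose r := r1 + r2 + (M + 1) / (c * cmod (w1 x - w2 x)).
have q0 : 0 < (M + 1) / (c * cmod (w1 x - w2 x)) by rewrite divr_gt0// ltr_wpDl// ltW.
have r0 : 0 < r by rewrite /r; lra.
have := le r; rewrite /r -/r => /(_ _ _).
have l1 : r1 <= r by rewrite /r; lra.
have l2 : r2 <= r by rewrite /r; lra.
move=> /(_ l1 l2); rewrite ler_pdivlMr// leNgt => /negP; apply.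
apply: (le_lt_trans MM).
rewrite mulrC -ltr_pdivrMr//; apply: (@lt_le_trans _ _ ((M + 1) / (c * cmod (w1 x - w2 x)))).
  by rewrite ltr_pM2r ?invr_gt0// ltrDl.
by rewrite /r; lra.
Qed.

Variable D : set 'rV[R]_d.
Hypotheses (oD : open D) (bD : bounded_set D).

Let mD := open_measurable_rV oD.
Let Doo := bounded_set_lty mD bD.

Lemma volume_potential_farfield (h : 'rV[R]_d -> R[i]) B : cmeasurable D h -> 0 <= B ->
  {ae lebesgue d, forall x, D x -> cmod (h x) <= B} ->
  is_farfield k (fun x => (k ^+ 2)%:C * convPhi k D h x)
    (herglotz_adj k D (fun y => (k ^+ 2)%:C * h y)).
Proof.
move=> mh B0 hB; have [rho rho0 Drho] := bounded_set_enorm bD.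
have Ih : (lebesgue d).-integrable D (EFin \o (fun y => cmod (h y))).
  have [] // := ae_bounded_integrable mD Doo (measurable_cmod mh) B0.
  by apply: filterS hB => y hy Dy; rewrite ger0_norm ?cmod_ge0// hy.
pose E x y := h y * expi (- k * dotv x y).
have IE x : cintegrable (lebesgue d) D (E x) by exact: osc_integrable.
have adjE x : herglotz_adj k D (fun y => (k ^+ 2)%:C * h y) x =
    (k ^+ 2)%:C * cintegral (lebesgue d) D (E x).
  rewrite /herglotz_adj; have [_ <-] := cintegralZ mD (k ^+ 2)%:C (IE x).
  by congr cintegral; apply/funext => y; rewrite /E -mulrA mulNr.
split.
  have mS := @measurable_unit_sphere R d.
  apply: (@ae_in_Lp2 _ _ _ _ _ mS _ (`|k ^+ 2| * Rintegral (lebesgue d) D (fun y => cmod (h y)))).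
  - exact: sphere_measure_lty.
  - rewrite (_ : herglotz_adj _ _ _ = fun x => (k ^+ 2)%:C * cintegral (lebesgue d) D (E x)); last exact/funext.
    apply: cmeasurableM; first exact: cmeasurable_cst.
    have [m1 m2] := cmeasurable_osc mD (- k) mh Ih rho0 Drho.
    by split; exact: measurable_funTS.
  - by rewrite mulr_ge0//; apply: Rintegral_ge0 => y _; exact: cmod_ge0.
  - apply: aeW => x _; rewrite adjE cmodM cmod_real ler_wpM2l//.
    exact: osc_le.
have [M [r0 [r00 M0 HM]]] := kernel_asymp d23 k0 rho0.
exists (k ^+ 2 * (M * B * fine (lebesgue d D))), r0; split => // x xr.
have x0 : 0 < enorm x := lt_le_trans r00 xr.
rewrite adjE -/(@amp R d (enorm x)) amp_err//.
set c := farfield_const k * _ * _.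
(* The kernel minus its leading term, times [h]: it is bounded almost everywhere on a set of finite
   measure, hence integrable, and this splits [convPhi] into a remainder and [c] times the adjoint
   integral. *)
pose G y := (Phi k (x - y) - c * expi (- (k * dotv (direction x) y))) * h y.
have mG : cmeasurable D G.
  apply: cmeasurableM => //; apply: cmeasurableD; first exact: cmeasurable_Phi.
  apply: cmeasurableN; apply: cmeasurableM; first exact: cmeasurable_cst.
  apply: cmeasurable_expi; apply: measurable_funTS; apply: measurableT_comp => //.
  by apply: measurable_funM; [exact: measurable_cst|exact: measurable_dotv].
have A0 : 0 <= M * (@amp R d (enorm x) / enorm x).
  by rewrite mulr_ge0// divr_ge0 ?amp_ge0// ltW.
have GB : {ae lebesgue d, forall y, D y -> cmod (G y) <= M * (@amp R d (enorm x) / enorm x) * B}.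
  apply: filterS hB => y hy Dy; rewrite cmodM ler_pM ?cmod_ge0 ?hy//.
  by have [_] := HM x y xr (Drho y Dy).
have [IG Gle] := ae_bounded_cintegrable mD Doo mG (mulr_ge0 A0 B0) GB.
have [IcE cE] := cintegralZ mD (- c) (IE (direction x)).
have [_ e] := cintegralB mD IG IcE.
have -> : convPhi k D h x = cintegral (lebesgue d) D G + c * cintegral (lebesgue d) D (E (direction x)).
  rewrite -[c in RHS]opprK mulNr -cE -e; congr cintegral; apply/funext => y; rewrite /G /E.
  by rewrite [- k * _]mulNr; ring.
have -> : forall a b s : R[i], a * (b + c * s) - c * (a * s) = a * b by move=> a b s; ring.
rewrite cmodM cmod_real ger0_norm ?sqr_ge0// -mulrA ler_wpM2l ?sqr_ge0//.
by apply: le_trans Gle _; rewrite le_eqVlt; apply/orP; left; apply/eqP; ring.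
Qed.

End far_field.

(** [w] is measurable only on [D]. Extending its modulus by 0 gives a function [u] measurable on the
    whole space, and the joint measurability of [q] then applies along [x |-> (x, u x)]. *)
Lemma cmeasurable_nonlinearity {R : realType} {d : nat} (D : set 'rV[R]_d)
    (q : 'rV[R]_d -> R -> R) (w : 'rV[R]_d -> R[i]) : measurable D ->
  measurable_fun [set: 'rV[R]_d * R] (fun p => q p.1 p.2) -> cmeasurable D w ->
  cmeasurable D (nonlinearity q w).
Proof.
move=> mD mq mw; apply: cmeasurableM => //; apply: cmeasurable_real.
pose u := (fun x => cmod (w x)) \_ D.
have mu : measurable_fun [set: 'rV[R]_d] u.
  by apply/measurable_restrict => //; rewrite setTI; exact: measurable_cmod.
apply: (@eq_measurable_fun _ _ _ _ _ (fun x => q x (u x))).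
  by move=> x xD; rewrite /u patchE xD.
apply: measurable_funTS.
exact: (measurableT_comp mq (measurable_fun_pair (@measurable_id _ _ setT) mu)).
Qed.

(** * Bounds along the scattering map *)

Section scattering_map.
Context {R : realType} {d : nat} (k alpha delta : R).
Variables (D : set 'rV[R]_d) (q : 'rV[R]_d -> R -> R) (q0 : 'rV[R]_d -> R).
Hypotheses (oD : open D) (bD : bounded_set D).
Hypothesis cq : contrast D q q0 alpha.
Hypothesis adm : admissible k D q q0 alpha delta.

Let mD := open_measurable_rV oD.
Let Doo := bounded_set_lty mD bD.
Let delta0 : 0 <= delta. Proof. by case: adm => /ltW. Qed.

Lemma total_field_bounded f : U_ball D delta f ->
  let n := nonlinearity q (fun y => Vsol k D q q0 delta f y + f y) in
  cmeasurable D n /\ exists2 B, 0 <= B & {ae lebesgue d, forall x, D x -> cmod (n x) <= B}.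
Proof.
move=> Uf; have [_ [C' _ /(_ _ Uf) [exV _]]] := adm.
(* [Vsol] is an [xget] with default 0; admissibility supplies a solution, so the chosen function is
   one. *)
have [/in_Lpoo_ae[mv [Bv Bv0 Bv1]] _ _] : is_Vsol k D q q0 delta f (Vsol k D q q0 delta f).
  exact: xgetPex.
have [/in_Lpoo_ae[mf [Bf Bf0 Bf1]] _] := Uf.
split; first exact: cmeasurable_nonlinearity mD (contrast_measurable cq) (cmeasurableD mv mf).
(* The null set excluded here is the same for all [t], so the bound may be used at
   [t = |V f x + f x|], which varies with [x]. *)
have [M qM] := contrast_bounded cq.
exists (`|M| * (Bv + Bf)); first by rewrite mulr_ge0// addr_ge0.
apply: filterS3 Bv1 Bf1 qM => x v1 f1 q1 Dx.
rewrite cmodM cmod_real ler_pM ?cmod_ge0//.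
  exact: le_trans (q1 _) (ler_norm _).
by apply: le_trans (cmodD _ _) _; rewrite lerD ?v1 ?f1.
Qed.

Lemma Tmap_in_Lp2 f : U_ball D delta f -> in_Lp (lebesgue d) D 2%:E (Tmap k D q q0 delta f).
Proof.
move=> /total_field_bounded[mn [B B0 nB]].
apply: (@ae_in_Lp2 _ _ _ _ _ mD _ (k ^+ 2 * B)) => //.
- by apply: cmeasurableM => //; exact: cmeasurable_cst.
- by rewrite mulr_ge0// sqr_ge0.
apply: filterS nB => x nB Dx; rewrite /Tmap cmodM cmod_real ger0_norm ?sqr_ge0//.
by rewrite ler_wpM2l ?sqr_ge0// nB.
Qed.

(** Pointwise [|H psi|] is at most the L^1 norm of [psi] on the sphere, and the radius
    [delta / sqrt (sphere_area d)] in [dom_F] is what the Cauchy-Schwarz inequality turns into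
    [delta]. *)
Lemma herglotz_bounded psi : dom_F delta psi ->
  cmeasurable D (herglotz k psi) /\ forall x, cmod (herglotz k psi x) <= delta.
Proof.
move=> [pL2 ple]; have mS := @measurable_unit_sphere R d.
have [mr mi _] := pL2; have mp : cmeasurable (@unit_sphere R d) psi by [].
have [Ip Ip_le] := cmod_integrable_Lp2 mS (sphere_measure_lty d) pL2 delta0 ple.
split; last by move=> x; apply: le_trans Ip_le; exact: osc_le.
have Srho (y : 'rV[R]_d) : unit_sphere y -> enorm y <= 1 by move=> ->.
have [m1 m2] := cmeasurable_osc mS k mp Ip ler01 Srho.
by split; exact: measurable_funTS.
Qed.

Lemma dom_T_U_ball f : dom_T k D delta f -> U_ball D delta f.
Proof.
move=> [[mr mi _] clf]; have mf : cmeasurable D f by [].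
have fd : {ae lebesgue d, forall x, D x -> cmod (f x) <= delta}.
  apply: (Lp2_closure_bounded mD mf delta0) => e e0.
  have [psi Fpsi lt] := clf e e0; have [mh hd] := herglotz_bounded Fpsi.
  by exists (herglotz k psi); split => // x _.
by split; [exact: ae_in_Lpoo fd|exact/Lpoo_leP].
Qed.

Lemma herglotz_dom_T psi : dom_F delta psi -> dom_T k D delta (herglotz k psi).
Proof.
move=> Fpsi; have [mh hd] := herglotz_bounded Fpsi; split.
  by apply: (ae_in_Lp2 mD Doo mh delta0); apply: aeW => x _.
move=> e e0; exists psi => //.
rewrite /Lp_norm (_ : _ \_ D = cst 0%E) ?Lnorm0 ?lte_fin//.
by apply/funext => x; rewrite patchE; case: ifP => //; rewrite subrr cmod0.
Qed.

End scattering_map.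

Local Close Scope complex_scope.

(* The first part is the claim that Tmap maps dom_T, a subset of U_ball, to L^2(D). *)
Theorem proposition2p9 (R : realType) (d : nat) (k alpha delta : R)
    (D : set 'rV[R]_d) (q : 'rV[R]_d -> R -> R) (q0 : 'rV[R]_d -> R) :
  d = 2%N \/ d = 3%N -> 0 < k ->
  open D -> bounded_set D ->
  contrast D q q0 alpha ->
  admissible k D q q0 alpha delta ->
  (forall f, dom_T k D delta f ->
     U_ball D delta f /\ in_Lp (lebesgue d) D 2%:E (Tmap k D q q0 delta f)) /\
  (forall g, dom_F delta g ->
     [/\ dom_T k D delta (herglotz k g),
         is_farfield k (Vsol_ext k D q q0 delta (herglotz k g)) (farfield_map k D q q0 delta g) &
         forall xhat, unit_sphere xhat ->
           farfield_map k D q q0 delta g xhat =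
           herglotz_adj k D (Tmap k D q q0 delta (herglotz k g)) xhat]).
Proof.
move=> d23 k0 oD bD cq adm; split.
  move=> f Tf; have Uf := dom_T_U_ball oD adm Tf.
  by split => //; exact: (Tmap_in_Lp2 oD bD cq adm).
move=> g Fg; have Tg := herglotz_dom_T oD bD adm Fg.
have [mn [B B0 nB]] := total_field_bounded oD cq adm (dom_T_U_ball oD adm Tg).
have ff := volume_potential_farfield d23 k0 oD bD mn B0 nB.
(* [farfield] selects some far field pattern. [ff] shows that one exists, and [farfield_unique]
   identifies the selected one on the sphere with the pattern in [ff], which is [herglotz_adj] of
   [Tmap] by unfolding. *)
have fm : is_farfield k (Vsol_ext k D q q0 delta (herglotz k g)) (farfield_map k D q q0 delta g).
  by apply: xgetPex; eexists; exact: ff.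
split => // xhat; exact: (farfield_unique k0 fm ff).
Qed.
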